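(* Let $N$ be a positive integer and $0<p<\infty$ with $pN>1$. Then the class $\mathfrak{w}_N$ is dense in $H^p(T_\Gamma)$, where $\mathfrak{w}_N$ is the family of functions $f\in H^p(T_\Gamma)$ such that (i) $f$ is infinitely differentiable on the closure $\overline{T_\Gamma}$, and (ii) $|z|^Nf(z)\to0$ as $|z|\to\infty$ in $\overline{T_\Gamma}$, where $|z|\to\infty$ means $z_j\to\infty$ for every $1\le j\le n$.
   Context: $\Gamma=\{y\in\mathbb{R}^n: y_j>0,\ j=1,\dots,n\}$ is the first octant and $T_\Gamma=\{x+iy: x\in\mathbb{R}^n,y\in\Gamma\}$. $H^p(T_\Gamma)$ is the space of holomorphic $F$ on $T_\Gamma$ with $\|F\|_{H^p}=\sup_{y\in\Gamma}\left(\int_{\mathbb{R}^n}|F(x+iy)|^p\,dx\right)^{1/p}<\infty$, with density in the (quasi-)metric $\|F-G\|_{H^p}$. *)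

(* Defs.v *)
From HB Require Import structures.
From mathcomp Require Import all_boot all_order all_algebra.
From mathcomp Require Import all_classical all_reals all_analysis.
From mathcomp.real_closed Require Import complex.

Set Implicit Arguments.
Unset Strict Implicit.
Unset Printing Implicit Defensive.

Import Order.TTheory GRing.Theory Num.Theory.
Local Open Scope classical_set_scope.
Local Open Scope ring_scope.

(* A point z = x + i y of C^n is represented by its real and imaginary parts
   x y : 'I_n -> R.  A complex-valued function on (a subset of) C^n is a
   function F : ('I_n -> R) -> ('I_n -> R) -> R[i], F x y = F(x + i y). *)

Section Defs.
Context {R : realType} {n : nat}.

Definition cmod (w : R[i]) : R := Num.sqrt (complex.Re w ^+ 2 + complex.Im w ^+ 2).

Definition znorm (x y : 'I_n -> R) : R :=
  Num.sqrt (\sum_(j < n) (x j ^+ 2 + y j ^+ 2)).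

Definition octant : set ('I_n -> R) := [set y | forall j, 0 < y j].
Definition octant_cl : set ('I_n -> R) := [set y | forall j, 0 <= y j].

Definition upd (x : 'I_n -> R) (i : 'I_n) (t : R) : 'I_n -> R :=
  fun j => if j == i then t else x j.

Fixpoint iter_int (s : seq 'I_n) (g : ('I_n -> R) -> \bar R)
    (x : 'I_n -> R) : \bar R :=
  match s with
  | [::] => g x
  | i :: s' => (\int[lebesgue_measure]_t iter_int s' g (upd x i t))%E
  end.

(* integral over R^n of a nonnegative function (Tonelli: iterated integral) *)
Definition int_Rn (g : ('I_n -> R) -> \bar R) : \bar R :=
  iter_int (enum 'I_n) g (fun _ => 0).

(* F is holomorphic on the tube T_Gamma: continuous and complex
   differentiable in each variable separately (Osgood/Hartogs). *)
Definition holomorphic_tube (F : ('I_n -> R) -> ('I_n -> R) -> R[i]) : Prop :=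
  (forall x y, octant y -> forall e : R, 0 < e -> exists2 d : R, 0 < d &
     forall x' y', octant y' -> znorm (x' - x) (y' - y) < d ->
       cmod (F x' y' - F x y) < e) /\
  (forall x y, octant y -> forall j : 'I_n, exists c : R[i],
     forall e : R, 0 < e -> exists2 d : R, 0 < d &
       forall h : R[i], h != 0 -> cmod h < d ->
         cmod ((F (upd x j (x j + complex.Re h)) (upd y j (y j + complex.Im h)) - F x y) / h - c)
           < e).

Definition Lp_slice (p : R) (F : ('I_n -> R) -> ('I_n -> R) -> R[i])
    (y : 'I_n -> R) : \bar R :=
  int_Rn (fun x => ((cmod (F x y)) `^ p)%:E).

Definition Hp_norm (p : R) (F : ('I_n -> R) -> ('I_n -> R) -> R[i]) : \bar R :=
  ereal_sup [set poweR (Lp_slice p F y) p^-1 | y in octant].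

Definition in_Hp (p : R) (F : ('I_n -> R) -> ('I_n -> R) -> R[i]) : Prop :=
  holomorphic_tube F /\ (Hp_norm p F < +oo)%E.

(* real partial derivative directions: (false, j) = d/dx_j, (true, j) = d/dy_j *)
Definition shift (d : bool * 'I_n) (t : R) (x y : 'I_n -> R)
    : ('I_n -> R) * ('I_n -> R) :=
  if d.1 then (x, upd y d.2 (y d.2 + t)) else (upd x d.2 (x d.2 + t), y).

Definition has_pderiv (G : ('I_n -> R) -> ('I_n -> R) -> R[i])
    (d : bool * 'I_n) (x y : 'I_n -> R) (v : R[i]) : Prop :=
  forall e : R, 0 < e -> exists2 del : R, 0 < del &
    forall t : R, t != 0 -> `|t| < del ->
      cmod ((G (shift d t x y).1 (shift d t x y).2 - G x y) / (t +i* 0)%C - v) < e.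

(* F is C^infty on the closure of T_Gamma: D is a family of functions, indexed
   by finite words of real partial derivatives, each continuous on the closed
   tube, with D [::] = F on T_Gamma and, on T_Gamma, the partial derivative of
   D a in direction d equal to D (d :: a).  D [::] is then the extension of F
   to the closure, and D a the extension of the derivative d^a F. *)
Definition smooth_closure_family (F : ('I_n -> R) -> ('I_n -> R) -> R[i])
    (D : seq (bool * 'I_n) -> ('I_n -> R) -> ('I_n -> R) -> R[i]) : Prop :=
  (forall x y, octant y -> D [::] x y = F x y) /\
  (forall a x y, octant y -> forall d, has_pderiv (D a) d x y (D (d :: a) x y)) /\
  (forall a x y, octant_cl y -> forall e : R, 0 < e -> exists2 del : R, 0 < del &
     forall x' y', octant_cl y' -> znorm (x' - x) (y' - y) < del ->
       cmod (D a x' y' - D a x y) < e).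

Definition decays_at_infty (N : nat) (G : ('I_n -> R) -> ('I_n -> R) -> R[i])
    : Prop :=
  forall e : R, 0 < e -> exists M : R, forall x y, octant_cl y ->
    (forall j, M < Num.sqrt (x j ^+ 2 + y j ^+ 2)) ->
    znorm x y ^+ N * cmod (G x y) < e.

Definition w_class (N : nat) (p : R) (F : ('I_n -> R) -> ('I_n -> R) -> R[i])
    : Prop :=
  in_Hp p F /\
  exists D, smooth_closure_family F D /\ decays_at_infty N (D [::]).

End Defs.

(* Main.v *)
(** For [q > 0] the function [|F|^q] is subharmonic in each variable separately. A Fefferman-Stein
    sup argument shows that [F] in [H^p] is bounded on [{y_j >= d}], so there [|F|^q] is dominated
    by the Poisson integral, in any one variable, of its values on a lower level; hence integrals of
    such functions over the slices [y = const] are nonincreasing in [y].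

    Applied to [(|F|^(p/2) + |F(. + i d)|^(p/2))^2] and to [|F + F(. + i d)|^p], this monotonicity
    reduces lower bounds for all slices to one fixed slice, where Fatou's lemma applies; with the
    parallelogram law it follows that [F(. + i d)] tends to [F] in [H^p] as [d] tends to [0].
    Applied to [F (1 - Psi)] with [Psi = prod_j (1 - i e z_j)^-(N+1)], it reduces the approximation
    of [F] by [F Psi] on [{y_j > d}] to dominated convergence on a single slice. The approximant is
    [F Psi] translated by [i d]; since [|Psi| <= 1] it is in [H^p]. *)
Require Import Defs.
From HB Require Import structures.
From mathcomp Require Import all_boot all_order all_algebra.
From mathcomp Require Import all_classical all_reals all_analysis.
From mathcomp.real_closed Require Import complex.
From mathcomp Require Import measurable_realfun ring lra.
Import Order.TTheory GRing.Theory Num.Theory.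
Import numFieldNormedType.Exports.
Set Implicit Arguments.
Unset Strict Implicit.
Unset Printing Implicit Defensive.
Local Open Scope classical_set_scope.
Local Open Scope ring_scope.

(** The $H^p$ norm is a supremum over all slices up to the boundary of the octant, and the argument
    uses neither boundary values nor maximal functions. Monotonicity carries an estimate from a
    slice to every higher one; slices near the boundary are reached by a squeeze. Take a slice [t]
    on which the integral of |F|^p is within eta of its supremum m, and replace [y] by y1 = min(y,
    t). There the monotone quantities are at least what Fatou gives on [t], nearly 4m and m, while
    the integrals of |F|^p on y1 and y1 + d are at most m + eta. Hence the parallelogram law is
    almost an equality: |F|^(p/2) and |F_d|^(p/2) are close in L^2, and the size of |F + F_d| / 2
    then forces the arguments to agree as well. Half powers and squares stand in for the convexity
    of t^p, which fails for p < 1. Holomorphy is given as continuity plus complex differentiability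
    in each variable, so no continuity of derivatives is known at the start; this is why the
    one-variable theory begins with Goursat's theorem. *)

(** * Differentials of functions of two real variables *)

Section Real_differentials.
Context {R : realType}.
Implicit Types (x y a b c d e h k l : R) (U V W : R -> R -> R).

(** Clearing the denominator removes the exception h = 0 and turns later estimates into linear
    arithmetic. *)
Lemma is_derive1P (f : R -> R) x l : is_derive x 1 f l <->
  forall e, 0 < e -> exists2 d, 0 < d &
    forall h, `|h| < d -> `|f (x + h) - f x - l * h| <= e * `|h|.
Proof.
split.
  move=> [df Df] e e0; move: df; rewrite /derivable => /cvg_ex [l' /= cl].
  have ll' : l' = l.
    by rewrite -Df /derive; apply/esym/cvg_lim.
  subst l'; move/cvgrPdist_le : cl => /(_ _ e0).
  rewrite near_withinE => /nbhs_ballP[d /= d0 H]; exists d => // h hd.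
  have [->|h0] := eqVneq h 0.
    by rewrite addr0 subrr mulr0 subrr normr0 mulr0.
  have := H h; rewrite /ball /= sub0r normrN => /(_ hd h0).
  rewrite /GRing.scale /= mulr1 (addrC h x) => H1.
  rewrite (_ : f (x + h) - f x - l * h = - (l - h^-1 * (f (x + h) - f x)) * h); last by field.
  by rewrite normrM normrN ler_wpM2r.
move=> H.
have cl : (fun h => h^-1 *: (f (h *: 1 + x) - f x)) h @[h --> 0^'] --> l.
  apply/cvgrPdist_le => e e0; have [d d0 H1] := H _ e0.
  rewrite near_withinE; apply/nbhs_ballP; exists d => // h /=.
  rewrite /ball /= sub0r normrN => hd h0.
  rewrite /GRing.scale /= mulr1 (addrC h x).
  have := H1 _ hd.
  rewrite (_ : f (x + h) - f x - l * h = - (l - h^-1 * (f (x + h) - f x)) * h); last by field.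
  by rewrite normrM normrN ler_pM2r // normr_gt0.
by apply: DeriveDef; [apply/cvg_ex; exists l | apply/cvg_lim].
Qed.

Definition cont2 U x y := forall e, 0 < e -> exists2 d, 0 < d &
  forall x' y', `|x' - x| < d -> `|y' - y| < d -> `|U x' y' - U x y| < e.

(** Fréchet differentiability with gradient (a, b), the error being measured by |h| + |k|. *)
Definition TD U x y a b := forall e, 0 < e -> exists2 d, 0 < d &
  forall h k, `|h| < d -> `|k| < d ->
    `|U (x + h) (y + k) - U x y - (a * h + b * k)| <= e * (`|h| + `|k|).

(* [CR U V x y a b]: [U + iV] is complex differentiable with derivative [a + ib]. *)
Definition CR U V x y a b := TD U x y a (- b) /\ TD V x y b a.

Lemma TD_cont U x y a b : TD U x y a b -> cont2 U x y.
Proof.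
move=> H e e0; have [d d0 {}H] := H 1 ltr01.
pose K := 2 + `|a| + `|b|; have K0 : 0 < K by rewrite /K; have := normr_ge0 a; have := normr_ge0 b; lra.
exists (Num.min d (e / (2 * K))); first by rewrite lt_min d0 divr_gt0 // mulr_gt0.
move=> x' y'; rewrite !lt_min => /andP[hd he] /andP[kd ke].
have := H _ _ hd kd; rewrite mul1r.
rewrite !(addrC _ (_ - _)) !subrK.
set h := x' - x in hd he *; set k := y' - y in kd ke * => H1.
have -> : U x' y' - U x y = (U x' y' - U x y - (a * h + b * k)) + (a * h + b * k) by ring.
apply: le_lt_trans (ler_normD _ _) _.
have h1 : `|a * h + b * k| <= `|a| * `|h| + `|b| * `|k|.
  by apply: le_trans (ler_normD _ _) _; rewrite !normrM.
have h2 : `|a| * `|h| <= `|a| * (e / (2*K)) by rewrite ler_wpM2l // ltW.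
have h3 : `|b| * `|k| <= `|b| * (e / (2*K)) by rewrite ler_wpM2l // ltW.
have e1 : (2 + `|a| + `|b|) * (e / (2 * K)) = e / 2 by rewrite -/K; field; rewrite gt_eqF.
have : 0 < e / (2*K) by rewrite divr_gt0 // mulr_gt0.
lra.
Qed.

Lemma TD_chain U a b (g1 g2 : R -> R) t l1 l2 :
  TD U (g1 t) (g2 t) a b -> is_derive t 1 g1 l1 -> is_derive t 1 g2 l2 ->
  is_derive t 1 (fun s => U (g1 s) (g2 s)) (a * l1 + b * l2).
Proof.
move=> HU /is_derive1P H1 /is_derive1P H2; apply/is_derive1P => e e0.
pose K := 2 + `|l1| + `|l2|.
have K0 : 0 < K by rewrite /K; have := normr_ge0 l1; have := normr_ge0 l2; lra.
have [d d0 {}HU] := HU (e / (2 * K)) ltac:(by rewrite divr_gt0 // mulr_gt0).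
(* The bound 1 keeps the increments of [g1] and [g2] below (1 + |l1|) |h| and (1 + |l2|) |h|; the
   other bound makes their own errors, weighted by |a| and |b|, at most e/2 |h|. *)
pose e1 := Num.min 1 (e / (2 * (1 + `|a| + `|b|))).
have A0 : 0 < 1 + `|a| + `|b| by have := normr_ge0 a; have := normr_ge0 b; lra.
have e10 : 0 < e1 by rewrite lt_min ltr01 divr_gt0 // mulr_gt0.
have e11 : e1 <= 1 by rewrite ge_min lexx.
have e12 : e1 <= e / (2 * (1 + `|a| + `|b|)) by rewrite ge_min lexx orbT.
have {H1}[d1 d10 H1] := H1 _ e10; have {H2}[d2 d20 H2] := H2 _ e10.
exists (Num.min (Num.min d1 d2) (d / K)); first by rewrite !lt_min d10 d20 divr_gt0.
move=> h; rewrite !lt_min => /andP[/andP[hd1 hd2] hd].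
have {}H1 := H1 _ hd1; have {}H2 := H2 _ hd2.
set D1 := g1 (t + h) - g1 t in H1; set D2 := g2 (t + h) - g2 t in H2.
have hh := normr_ge0 h.
have n1 : `|D1| <= (1 + `|l1|) * `|h|.
  have -> : D1 = (D1 - l1 * h) + l1 * h by ring.
  apply: le_trans (ler_normD _ _) _; rewrite normrM mulrDl lerD2r (le_trans H1) //.
  by rewrite ler_wpM2r.
have n2 : `|D2| <= (1 + `|l2|) * `|h|.
  have -> : D2 = (D2 - l2 * h) + l2 * h by ring.
  apply: le_trans (ler_normD _ _) _; rewrite normrM mulrDl lerD2r (le_trans H2) //.
  by rewrite ler_wpM2r.
have hK : K * `|h| < d by rewrite mulrC -ltr_pdivlMr.
have p1 : 0 <= `|l1| * `|h| by rewrite mulr_ge0.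
have p2 : 0 <= `|l2| * `|h| by rewrite mulr_ge0.
have D1d : `|D1| < d by apply: le_lt_trans n1 _; move: hK; rewrite /K; lra.
have D2d : `|D2| < d by apply: le_lt_trans n2 _; move: hK; rewrite /K; lra.
have := HU _ _ D1d D2d.
rewrite /D1 /D2 !(addrC _ (_ - _)) !subrK -/D1 -/D2.
set E := U _ _ - U _ _ => H3.
have -> : E - (a * l1 + b * l2) * h =
  (E - (a * D1 + b * D2)) + (a * (D1 - l1 * h) + b * (D2 - l2 * h)) by ring.
apply: le_trans (ler_normD _ _) _.
have : `|a * (D1 - l1 * h) + b * (D2 - l2 * h)| <= (`|a| + `|b|) * (e1 * `|h|).
  apply: le_trans (ler_normD _ _) _; rewrite !normrM mulrDl.
  by apply: lerD; rewrite ler_wpM2l.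
have : (`|a| + `|b|) * (e1 * `|h|) <= e / 2 * `|h|.
  rewrite mulrA ler_wpM2r //.
  apply: (@le_trans _ _ ((1 + `|a| + `|b|) * e1)); first by rewrite ler_wpM2r ?ltW //; lra.
  apply: le_trans (ler_wpM2l (ltW A0) e12) _.
  by rewrite le_eqVlt; apply/orP; left; apply/eqP; field; rewrite gt_eqF.
have : e / (2 * K) * (`|D1| + `|D2|) <= e / 2 * `|h|.
  apply: (@le_trans _ _ (e / (2 * K) * (K * `|h|))).
    apply: ler_wpM2l; first by rewrite ltW // divr_gt0 // mulr_gt0.
    by rewrite /K; lra.
  by rewrite le_eqVlt; apply/orP; left; apply/eqP; field; rewrite gt_eqF.
lra.
Qed.

Lemma TD_ext_near U W x y a b r : 0 < r ->
  (forall x' y', `|x' - x| < r -> `|y' - y| < r -> U x' y' = W x' y') ->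
  TD U x y a b -> TD W x y a b.
Proof.
move=> r0 UW H e e0; have [d d0 {}H] := H e e0.
exists (Num.min d r); first by rewrite lt_min d0.
move=> h k; rewrite !lt_min => /andP[hd hr] /andP[kd kr].
have E : forall z w : R, z + w - z = w by move=> z w; ring.
by rewrite -!UW ?subrr ?normr0 ?E //; apply: H.
Qed.

Lemma TD_cst (c x y : R) : TD (fun _ _ => c) x y 0 0.
Proof.
move=> e e0; exists 1 => // h k _ _.
by rewrite !mul0r addr0 !subrr normr0 mulr_ge0 ?addr_ge0 // ltW.
Qed.

Lemma TD_fst x y : TD (fun s _ => s) x y 1 0.
Proof.
move=> e e0; exists 1 => // h k _ _.
rewrite (_ : _ - _ = 0); last by ring.
by rewrite normr0 mulr_ge0 ?addr_ge0 // ltW.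
Qed.

Lemma TD_snd x y : TD (fun _ s => s) x y 0 1.
Proof.
move=> e e0; exists 1 => // h k _ _.
rewrite (_ : _ - _ = 0); last by ring.
by rewrite normr0 mulr_ge0 ?addr_ge0 // ltW.
Qed.

Lemma TD_add U W x y a b c d : TD U x y a b -> TD W x y c d ->
  TD (fun s t => U s t + W s t) x y (a + c) (b + d).
Proof.
move=> H1 H2 e e0; have e20 : 0 < e / 2 by rewrite divr_gt0.
have [d1 d10 {}H1] := H1 _ e20; have [d2 d20 {}H2] := H2 _ e20.
exists (Num.min d1 d2); first by rewrite lt_min d10.
move=> h k; rewrite !lt_min => /andP[h1 h2] /andP[k1 k2].
have {}H1 := H1 _ _ h1 k1; have {}H2 := H2 _ _ h2 k2.
set X := (X in `|X| <= _).
have -> : X = (U (x + h) (y + k) - U x y - (a * h + b * k)) +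
  (W (x + h) (y + k) - W x y - (c * h + d * k)) by rewrite /X; ring.
by apply: le_trans (ler_normD _ _) _; lra.
Qed.

Lemma TD_comp (f : R -> R) U x y a b l : is_derive (U x y) 1 f l -> TD U x y a b ->
  TD (fun s t => f (U s t)) x y (l * a) (l * b).
Proof.
move=> /is_derive1P Hf HU e e0.
have [d1 d10 cU] := TD_cont HU ltr01.
pose K := 1 + `|a| + `|b|; have K0 : 0 < K by rewrite /K; have := normr_ge0 a; have := normr_ge0 b; lra.
have [r r0 {}Hf] := Hf (e / (2 * K)) ltac:(by rewrite divr_gt0 // mulr_gt0).
have [d2 d20 cU2] := TD_cont HU r0.
have L0 : 0 < 1 + `|l| by have := normr_ge0 l; lra.
have [d3 d30 H3] := HU (Num.min 1 (e / (2 * (1 + `|l|))))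
  ltac:(by rewrite lt_min ltr01 divr_gt0 // mulr_gt0).
exists (Num.min d2 d3); first by rewrite lt_min d20.
move=> h k; rewrite !lt_min => /andP[h2 h3] /andP[k2 k3].
have E : forall z w : R, z + w - z = w by move=> z w; ring.
have := cU2 (x + h) (y + k); rewrite !E => /(_ h2 k2) D.
have {}Hf := Hf _ D; have {}H3 := H3 _ _ h3 k3.
set D0 := U (x + h) (y + k) - U x y in D Hf H3.
have ED : U x y + D0 = U (x + h) (y + k) by rewrite /D0; ring.
rewrite ED in Hf.
set m := `|h| + `|k| in H3 *; have m0 : 0 <= m by rewrite addr_ge0.
have e1 : Num.min 1 (e / (2 * (1 + `|l|))) <= 1 by rewrite ge_min lexx.
have e2 : Num.min 1 (e / (2 * (1 + `|l|))) <= e / (2 * (1 + `|l|)) by rewrite ge_min lexx orbT.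
set mm := Num.min _ _ in H3 e1 e2.
have nD : `|D0| <= K * m.
  have -> : D0 = (D0 - (a * h + b * k)) + (a * h + b * k) by ring.
  apply: le_trans (ler_normD _ _) _.
  have : `|a * h + b * k| <= `|a| * m + `|b| * m.
    apply: le_trans (ler_normD _ _) _; rewrite !normrM; apply: lerD;
    by rewrite ler_wpM2l // /m ?lerDl ?lerDr.
  have : mm * m <= 1 * m by rewrite ler_wpM2r.
  by rewrite /K; lra.
set X := (X in `|X| <= _).
have -> : X = (f (U (x + h) (y + k)) - f (U x y) - l * D0) + l * (D0 - (a * h + b * k)).
  by rewrite /X; ring.
apply: le_trans (ler_normD _ _) _; rewrite normrM.
have : `|l| * `|D0 - (a * h + b * k)| <= e / 2 * m.
  apply: (@le_trans _ _ ((1 + `|l|) * ((e / (2 * (1 + `|l|))) * m))).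
    apply: ler_pM => //; first by lra.
    by apply: le_trans H3 _; rewrite ler_wpM2r.
  by rewrite le_eqVlt; apply/orP; left; apply/eqP; field; rewrite gt_eqF.
have : e / (2 * K) * `|D0| <= e / 2 * m.
  apply: (@le_trans _ _ (e / (2 * K) * (K * m))).
    by apply: ler_wpM2l => //; rewrite ltW // divr_gt0 // mulr_gt0.
  by rewrite le_eqVlt; apply/orP; left; apply/eqP; field; rewrite gt_eqF.
lra.
Qed.

Lemma TD_scale U x y a b c : TD U x y a b ->
  TD (fun s t => c * U s t) x y (c * a) (c * b).
Proof.
apply: (@TD_comp (fun z => c * z)); apply/is_derive1P => e e0; exists 1 => // h _.
rewrite (_ : c * (U x y + h) - c * U x y - c * h = 0); last by ring.
by rewrite normr0 mulr_ge0 // ltW.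
Qed.

Lemma TD_opp U x y a b : TD U x y a b -> TD (fun s t => - U s t) x y (- a) (- b).
Proof.
move=> /(TD_scale (-1)); rewrite !mulN1r; apply: (@TD_ext_near _ _ _ _ _ _ 1) => // *.
by rewrite mulN1r.
Qed.

Lemma TD_sqr U x y a b : TD U x y a b ->
  TD (fun s t => U s t ^+ 2) x y (2 * U x y * a) (2 * U x y * b).
Proof.
apply: (@TD_comp (fun z => z ^+ 2)); apply/is_derive1P => e e0; exists e => // h he.
rewrite (_ : (U x y + h) ^+ 2 - U x y ^+ 2 - 2 * U x y * h = h * h); last by ring.
by rewrite normrM ler_wpM2r // ltW.
Qed.

Lemma TD_eq U x y a b a' b' : TD U x y a b -> a = a' -> b = b' -> TD U x y a' b'.
Proof. by move=> H <- <-. Qed.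

(** Polarization: u w = ((u + w)^2 - u^2 - w^2) / 2 reduces products to sums and squares. *)
Lemma TD_mul U W x y a b c d : TD U x y a b -> TD W x y c d ->
  TD (fun s t => U s t * W s t) x y (a * W x y + U x y * c) (b * W x y + U x y * d).
Proof.
move=> H1 H2.
have := TD_add (TD_sqr (TD_add H1 H2)) (TD_opp (TD_add (TD_sqr H1) (TD_sqr H2))).
move=> /(TD_scale 2^-1) H; apply: TD_eq; first apply: TD_ext_near ltr01 _ H.
- by move=> x' y' _ _ /=; field.
- by field.
- by field.
Qed.

Lemma TD_inv U x y a b : U x y != 0 -> TD U x y a b ->
  TD (fun s t => (U s t)^-1) x y (- a / U x y ^+ 2) (- b / U x y ^+ 2).
Proof.
move=> u0 H; have d1 : is_derive (U x y) 1 (fun z : R => z^-1) (- (U x y) ^- 2).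
  have := @is_deriveV R id (U x y) 1 1 u0 (is_derive_id _ _).
  by rewrite /GRing.scale /= mulr1.
by apply: TD_eq (TD_comp d1 H) _ _; field.
Qed.

End Real_differentials.

(** * Goursat's theorem for rectangles *)

Section Goursat.
Context {R : realType}.
Implicit Types (x y a b c d e h k l w m n q r s t z K : R) (U V W : R -> R -> R).

Lemma mul01 z q : 0 <= z -> 0 <= q <= 1 -> 0 <= z * q <= z.
Proof.
move=> z0 /andP[q0 q1]; rewrite mulr_ge0 //=.
by rewrite -[leRHS]mulr1 ler_wpM2l.
Qed.

Lemma ler_norm4 (p1 p2 p3 p4 : R) :
  `|p1 + p2 + p3 + p4| <= `|p1| + `|p2| + `|p3| + `|p4|.
Proof.
have n1 := ler_normD (p1 + p2 + p3) p4; have n2 := ler_normD (p1 + p2) p3.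
by have n3 := ler_normD p1 p2; lra.
Qed.

(** The mean value theorem for t -> f (a + w t) on [0, 1]; with this parametrization [w] may have
    either sign or vanish. *)
Lemma mvt_bound (f df : R -> R) a w m K :
  (forall t : R, 0 <= t <= 1 -> is_derive (a + w * t) 1 f (df (a + w * t)) /\
    `|df (a + w * t) - m| <= K) ->
  `|f (a + w) - f a - m * w| <= K * `|w|.
Proof.
move=> H; pose g t := f (a + w * t).
have dl (t : R) : is_derive t 1 (fun s => a + w * s) w.
  apply/is_derive1P => e e0; exists 1 => // h _.
  rewrite (_ : a + w * (t + h) - (a + w * t) - w * h = 0); last by ring.
  by rewrite normr0 mulr_ge0 // ltW.
have dg (t : R) : 0 <= t <= 1 -> is_derive t 1 g (df (a + w * t) * w).
  move=> /H[Hd _].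
  have := @TD_chain R (fun s _ => f s) (df (a + w * t)) 0 (fun s => a + w * s) (fun s => s) t w 1.
  rewrite mul0r addr0; apply.
  have := @TD_comp R f (fun s _ => s) (a + w * t) t 1 0 _ Hd (TD_fst _ _).
  by rewrite mulr1 mulr0.
have [t] := @MVT_segment R g (fun t => df (a + w * t) * w) 0 1 ler01
  (fun x xi => dg x ltac:(by move: xi; rewrite in_itv /= => /andP[/ltW -> /ltW ->]))
  ltac:(by apply: derivable_within_continuous => x; rewrite in_itv /= => /dg []).
rewrite in_itv /= => /H [_ Hb].
rewrite /g mulr1 mulr0 addr0 subr0 mulr1 => ->.
by rewrite -mulrBl normrM ler_wpM2r.
Qed.

(** Integrating from c - r puts the base point to the left of every x of the open interval. *)
Lemma antiderivative (g : R -> R) c r :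
  0 < r -> (forall x, `|x - c| <= r -> {for x, continuous g}) ->
  exists G : R -> R, forall x, `|x - c| < r -> is_derive x 1 G (g x).
Proof.
move=> r0 cg.
have mu_int : (@lebesgue_measure R).-integrable `[c - r, c + r] (EFin \o g).
  apply: continuous_compact_integrable; first exact: segment_compact.
  apply: continuous_in_subspaceT => x; rewrite inE /= in_itv /= => /andP[h1 h2].
  by apply: cg; rewrite ler_norml; lra.
exists (fun x => \int[lebesgue_measure]_(t in `[c - r, x]) g t) => x.
rewrite ltr_norml => /andP[h1 h2].
have xu : x < c + r by lra.
have ax : c - r < x by lra.
have [d1 d2] := continuous_FTC1_closed xu mu_int ax (cg x ltac:(rewrite ler_norml; lra)).
by apply: DeriveDef; [exact: d1 | rewrite -derive1E; exact: d2].
Qed.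

(** Contour integrals are expressed by increments of antiderivatives: [Phi y] is one of U(., y) and
    [Psi x] is one of V(x, .), so that Goursat's argument needs no integration theory. *)
Variables (Phi Psi U V : R -> R -> R) (x0 y0 r : R).
Hypothesis dPhi : forall x y, `|x - x0| < r -> `|y - y0| < r -> is_derive x 1 (Phi y) (U x y).
Hypothesis dPsi : forall x y, `|x - x0| < r -> `|y - y0| < r -> is_derive y 1 (Psi x) (V x y).
Hypothesis holUV : forall x y, `|x - x0| < r -> `|y - y0| < r -> exists a b, CR U V x y a b.

(* The integral of [U dx - V dy] along the boundary of [[a, b] x [c, d]]. *)
Definition bdry_int a b c d :=
  Phi c b - Phi c a - (Phi d b - Phi d a) - (Psi b d - Psi b c) + (Psi a d - Psi a c).

(** Opposite sides are paired before the mean value theorem is used. The affine part of U + iV then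
    contributes [be * h * z * (w * z)] on the horizontal pair and [be * w * z * (h * z)] on the
    vertical pair; these cancel because both coefficients [be] agree by Cauchy-Riemann. Only the
    remainder, of order z^2, survives. *)
Lemma bdry_int_local a w c h s t x y :
  (forall s, 0 <= s <= 1 -> `|a + w * s - x0| < r) ->
  (forall s, 0 <= s <= 1 -> `|c + h * s - y0| < r) ->
  0 <= s <= 1 -> 0 <= t <= 1 ->
  forall e, 0 < e -> exists2 d, 0 < d & forall s' t' z, 0 < z -> z < d ->
    0 <= s' -> s' <= s -> s <= s' + z -> s' + z <= 1 ->
    0 <= t' -> t' <= t -> t <= t' + z -> t' + z <= 1 ->
    `|bdry_int (a + w * s') (a + w * s' + w * z) (c + h * t') (c + h * t' + h * z)| <=
      e * z ^+ 2.
Proof.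
move=> ain cin s01 t01 e e0.
have [al [be [HU HV]]] := holUV (ain _ s01) (cin _ t01).
pose K := 1 + `|w| + `|h|.
have K1 : 1 <= K by rewrite /K; have := normr_ge0 w; have := normr_ge0 h; lra.
have K0 : 0 < K by lra.
(* The remainder is at most ee K z on each side, and the two pairs add up to 2 ee K z (|w| + |h|) z,
   which is at most e z^2. *)
have e1 : 0 < e / (2 * K ^+ 2) by rewrite divr_gt0 // mulr_gt0 // exprn_gt0.
set ee := e / _ in e1.
have [d1 d10 {}HU] := HU _ e1; have [d2 d20 {}HV] := HV _ e1.
exists (Num.min d1 d2 / K); first by rewrite divr_gt0 // lt_min d10.
move=> s' t' z z0; rewrite ltr_pdivlMr // lt_min => /andP[zd1 zd2] s0 s1 s2 s3 t0 t1 t2 t3.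
pose xs := a + w * s; pose ys := c + h * t.
have near (g : R) (q q' : R) : q' <= q -> q <= q' + z -> forall v, q' <= v <= q' + z ->
    `|g * v - g * q| <= `|g| * z.
  move=> q1 q2 v v1; rewrite -mulrBr normrM ler_wpM2l // ler_norml; lra.
have gK (g : R) : `|g| * z <= (`|w| + `|h|) * z -> `|g| * z < K * z.
  by move=> H; apply: le_lt_trans H _; rewrite ltr_pM2r // /K; lra.
have wK : `|w| * z < K * z by apply: gK; rewrite ler_pM2r // lerDl.
have hK : `|h| * z < K * z by apply: gK; rewrite ler_pM2r // lerDr.
have EU u v : s' <= u <= s' + z -> t' <= v <= t' + z ->
    `|U (a + w * u) (c + h * v) - U xs ys - (al * (w * u - w * s) - be * (h * v - h * t))| <= ee * (K * z).
  move=> hu hv.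
  have n1 := near w s s' s1 s2 u hu; have n2 := near h t t' t1 t2 v hv.
  clear s0 s1 s2 s3 t0 t1 t2 t3 e0 s01 t01 hu hv.
  have := HU (w * u - w * s) (h * v - h * t) ltac:(lra) ltac:(lra).
  rewrite (_ : a + w * s + _ = a + w * u); last by ring.
  rewrite (_ : c + h * t + _ = c + h * v); last by ring.
  rewrite mulNr => /le_trans; apply; rewrite ler_pM2l // /K; lra.
have EV u v : s' <= u <= s' + z -> t' <= v <= t' + z ->
    `|V (a + w * u) (c + h * v) - V xs ys - (be * (w * u - w * s) + al * (h * v - h * t))| <= ee * (K * z).
  move=> hu hv.
  have n1 := near w s s' s1 s2 u hu; have n2 := near h t t' t1 t2 v hv.
  clear s0 s1 s2 s3 t0 t1 t2 t3 e0 s01 t01 hu hv.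
  have := HV (w * u - w * s) (h * v - h * t) ltac:(lra) ltac:(lra).
  rewrite (_ : a + w * s + _ = a + w * u); last by ring.
  rewrite (_ : c + h * t + _ = c + h * v); last by ring.
  move=> /le_trans; apply; rewrite ler_pM2l // /K; lra.
have P1 : `|(fun x => Phi (c + h * t') x - Phi (c + h * t' + h * z) x) (a + w * s' + w * z) -
    (fun x => Phi (c + h * t') x - Phi (c + h * t' + h * z) x) (a + w * s') -
    be * h * z * (w * z)| <= 2 * (ee * (K * z)) * `|w * z|.
  apply: (@mvt_bound (fun x => Phi (c + h * t') x - Phi (c + h * t' + h * z) x) (fun x => U x (c + h * t') - U x (c + h * t' + h * z))) => q q01.
  have qz := mul01 (ltW z0) q01.
  have -> : a + w * s' + w * z * q = a + w * (s' + z * q) by ring.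
  have -> : c + h * t' + h * z = c + h * (t' + z) by ring.
  have ix : `|a + w * (s' + z * q) - x0| < r by apply: ain; clear -qz s0 s3 t0 t3 z0; lra.
  split.
    by apply: is_deriveB; apply: dPhi => //; apply: cin; clear -qz s0 s3 t0 t3 z0; lra.
  have := EU (s' + z * q) t' ltac:(clear -qz s0 s3 t0 t3 z0; lra) ltac:(clear -qz s0 s3 t0 t3 z0; lra).
  have := EU (s' + z * q) (t' + z) ltac:(clear -qz s0 s3 t0 t3 z0; lra) ltac:(clear -qz s0 s3 t0 t3 z0; lra).
  clear; rewrite !ler_norml; lra.
have P2 : `|(fun y => Psi (a + w * s' + w * z) y - Psi (a + w * s') y) (c + h * t' + h * z) -
    (fun y => Psi (a + w * s' + w * z) y - Psi (a + w * s') y) (c + h * t') -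
    be * w * z * (h * z)| <= 2 * (ee * (K * z)) * `|h * z|.
  apply: (@mvt_bound (fun y => Psi (a + w * s' + w * z) y - Psi (a + w * s') y) (fun y => V (a + w * s' + w * z) y - V (a + w * s') y)) => q q01.
  have qz := mul01 (ltW z0) q01.
  have -> : c + h * t' + h * z * q = c + h * (t' + z * q) by ring.
  have -> : a + w * s' + w * z = a + w * (s' + z) by ring.
  have ix : `|c + h * (t' + z * q) - y0| < r by apply: cin; clear -qz s0 s3 t0 t3 z0; lra.
  split.
    by apply: is_deriveB; apply: dPsi => //; apply: ain; clear -qz s0 s3 t0 t3 z0; lra.
  have := EV s' (t' + z * q) ltac:(clear -qz s0 s3 t0 t3 z0; lra) ltac:(clear -qz s0 s3 t0 t3 z0; lra).
  have := EV (s' + z) (t' + z * q) ltac:(clear -qz s0 s3 t0 t3 z0; lra) ltac:(clear -qz s0 s3 t0 t3 z0; lra).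
  clear; rewrite !ler_norml; lra.
have P3 : 2 * (ee * (K * z)) * `|w * z| + 2 * (ee * (K * z)) * `|h * z| <= e * z ^+ 2.
  rewrite !normrM (gtr0_norm z0) -mulrDr.
  apply: (@le_trans _ _ (2 * (ee * (K * z)) * (K * z))).
    apply: ler_wpM2l; last by rewrite /K; lra.
    by apply/ltW/mulr_gt0 => //; apply: mulr_gt0 => //; apply: mulr_gt0.
  by rewrite le_eqVlt /ee; apply/orP; left; apply/eqP; field; rewrite gt_eqF.
move: P1 P2 P3 => /=; clear; rewrite /bdry_int !ler_norml; lra.
Qed.

Lemma bdry_int_split a b m c d n :
  bdry_int a b c d = bdry_int a m c n + bdry_int m b c n + bdry_int a m n d + bdry_int m b n d.
Proof. by rewrite /bdry_int; ring. Qed.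

(** Repeated quartering: the k-th subsquare, of parameter side 2^-k, carries at least 4^-k of the
    integral, while the local estimate at the common point of all subsquares bounds it by e 4^-k.
    Parametrizing by the unit square allows [w] and [h] of any sign. *)
Theorem goursat a w c h :
  (forall s, 0 <= s <= 1 -> `|a + w * s - x0| < r) ->
  (forall s, 0 <= s <= 1 -> `|c + h * s - y0| < r) ->
  bdry_int a (a + w) c (c + h) = 0.
Proof.
move=> ain cin.
pose J s t z := `|bdry_int (a + w * s) (a + w * s + w * z) (c + h * t) (c + h * t + h * z)|.
have J4 s t z : [|| J s t z <= 4 * J s t (z / 2), J s t z <= 4 * J (s + z / 2) t (z / 2),
    J s t z <= 4 * J s (t + z / 2) (z / 2) | J s t z <= 4 * J (s + z / 2) (t + z / 2) (z / 2)].
  apply/negP => /negP; rewrite !negb_or -!ltNge => /and4P[h1 h2 h3 h4].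
  have JJ : J s t z <= J s t (z / 2) + J (s + z / 2) t (z / 2) + J s (t + z / 2) (z / 2) +
      J (s + z / 2) (t + z / 2) (z / 2).
    have E1 : a + w * (s + z / 2) = a + w * s + w * (z / 2) by ring.
    have E2 : c + h * (t + z / 2) = c + h * t + h * (z / 2) by ring.
    have E3 : a + w * s + w * (z / 2) + w * (z / 2) = a + w * s + w * z by field.
    have E4 : c + h * t + h * (z / 2) + h * (z / 2) = c + h * t + h * z by field.
    rewrite {1}/J (@bdry_int_split _ _ (a + w * s + w * (z / 2)) _ _ (c + h * t + h * (z / 2))).
    by rewrite /J E1 E2 E3 E4; exact: ler_norm4.
  by lra.
(* Corner of a quarter that carries at least a fourth of the boundary integral. *)
pose nx z (p : R * R) : R * R :=
  if J p.1 p.2 z <= 4 * J p.1 p.2 (z / 2) then p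
  else if J p.1 p.2 z <= 4 * J (p.1 + z / 2) p.2 (z / 2) then (p.1 + z / 2, p.2)
  else if J p.1 p.2 z <= 4 * J p.1 (p.2 + z / 2) (z / 2) then (p.1, p.2 + z / 2)
  else (p.1 + z / 2, p.2 + z / 2).
have nxP z p : 0 < z -> [/\ J p.1 p.2 z <= 4 * J (nx z p).1 (nx z p).2 (z / 2),
   p.1 <= (nx z p).1 <= p.1 + z / 2 & p.2 <= (nx z p).2 <= p.2 + z / 2].
  move=> z0; have := J4 p.1 p.2 z; rewrite /nx.
  case: ifP => [H _|_]; first by split => //; lra.
  case: ifP => [H _|_]; first by split => //=; lra.
  case: ifP => [H _|_ /=]; first by split => //=; lra.
  by move=> H; split => //; lra.
pose q (k : nat) : R := 2 ^- k.
have q0 (k : nat) : 0 < q k by rewrite invr_gt0 exprn_gt0.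
have qS (k : nat) : q k / 2 = q k.+1 by rewrite /q exprS invfM mulrC.
pose sq := fix sq (k : nat) : R * R := if k is k'.+1 then nx (q k') (sq k') else (0, 0).
have sqP (k : nat) := nxP (q k) (sq k) (q0 k).
have Jk (k : nat) : J 0 0 1 <= 4 ^+ k * J (sq k).1 (sq k).2 (q k).
  elim: k => [|k IH]; first by rewrite expr0 mul1r /q expr0 invr1 /=.
  apply: le_trans IH _; rewrite exprSr -mulrA ler_wpM2l ?exprn_ge0 //.
  by have [+ _ _] := sqP k; rewrite qS.
(* Nested intervals: the supremum of the left corners lies in every interval of the sequence. *)
pose lim_ok (u : nat -> R) := exists s : R, forall k : nat, u k <= s <= u k + q k.
have lim_sq (u : nat -> R) : u 0%N = 0 -> (forall k : nat, u k <= u k.+1 <= u k + q k / 2) ->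
   (forall k : nat, 0 <= u k) /\ (forall k : nat, u k + q k <= 1) /\ lim_ok u.
  move=> u0 uS.
  have mon (k m : nat) : u k <= u (k + m)%N.
    elim: m => [|m IH]; first by rewrite addn0.
    by rewrite addnS (le_trans IH) //; case/andP: (uS (k + m)%N).
  have dec (k m : nat) : u (k + m)%N + q (k + m)%N <= u k + q k.
    elim: m => [|m IH]; first by rewrite addn0.
    by rewrite addnS; apply: le_trans IH; have := uS (k + m)%N; have := qS (k + m)%N; lra.
  split; first by move=> k; rewrite -u0; exact: (mon 0%N k).
  split; first by move=> k; have := dec 0%N k; rewrite add0n u0 /q expr0 invr1 add0r.
  have cross (k m : nat) : u m <= u k + q k.
    have [/subnKC <-|/ltnW /subnKC <-] := leqP k m.
      by have := dec k (m - k)%N; have := q0 (k + (m - k))%N; lra.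
    by have := mon m (k - m)%N; have := q0 (m + (k - m))%N; lra.
  exists (sup (range u)) => k.
  have hs : has_sup (range u).
    by split; [exists (u 0%N); exists 0%N | exists (u 0%N + q 0%N) => _ [m _ <-]].
  apply/andP; split.
    by apply: ub_le_sup; [case: hs|exists k].
  by apply: ge_sup; [case: hs|move=> _ [m _ <-]].
have [s0 [s1 [s Hs]]] := lim_sq (fun k : nat => (sq k).1) erefl
  (fun k : nat => ltac:(by have [_ ? _] := sqP k)).
have [t0 [t1 [t Ht]]] := lim_sq (fun k : nat => (sq k).2) erefl
  (fun k : nat => ltac:(by have [_ _ ?] := sqP k)).
have J0 : J 0 0 1 = 0.
  apply/eqP; rewrite eq_le; apply/andP; split; last exact: normr_ge0.
  apply/ler_addgt0Pr => e e0; rewrite add0r.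
  have s01 : 0 <= s <= 1 by have := Hs 0%N; have := s0 0%N; have := s1 0%N; lra.
  have t01 : 0 <= t <= 1 by have := Ht 0%N; have := t0 0%N; have := t1 0%N; lra.
  have [d d0 Hd] := bdry_int_local 0 0 ain cin s01 t01 e0.
  have [k kd] : exists k : nat, q k < d.
    have /cvgrPdist_lt /(_ _ d0) [k _ Hk] := @cvg_expr R 2^-1 ltac:(rewrite ger0_norm; lra).
    exists k; have := Hk k (leqnn k); rewrite /= sub0r normrN exprVn.
    by rewrite -/(q k) (gtr0_norm (q0 k)).
  have := Hd _ _ _ (q0 k) kd (s0 k) _ _ (s1 k) (t0 k) _ _ (t1 k).
  have /andP[-> ->] := Hs k; have /andP[-> ->] := Ht k => /(_ isT isT isT isT) H.
  apply: le_trans (Jk k) _; apply: (@le_trans _ _ (4 ^+ k * (e * q k ^+ 2))).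
    by rewrite ler_wpM2l ?exprn_ge0.
  have k0 : (2 : R) ^+ k != 0 by rewrite expf_neq0.
  have -> : (4 : R) ^+ k = (2 ^+ k) ^+ 2.
    by rewrite -exprM mulnC exprM; congr (_ ^+ _); ring.
  have -> : (2 ^+ k) ^+ 2 * (e * q k ^+ 2) = e by rewrite /q; field.
  exact: lexx.
have := J0; rewrite /J !mulr0 !mulr1 !addr0 => /normr0P/eqP //.
Qed.

End Goursat.

(** * Local primitives of holomorphic functions *)

Section Primitive.
Context {R : realType}.
Implicit Types (x y a b c d e h k l w m n q r s t z K : R) (U V W : R -> R -> R).

Lemma cont2_fst U x y : cont2 U x y -> {for x, continuous (U ^~ y)}.
Proof.
move=> H; apply/cvgrPdist_lt => e /H [d d0 Hd]; apply/nbhs_ballP.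
exists d => // z /= ; rewrite /ball /= => zd; rewrite distrC; apply: Hd; rewrite ?subrr ?normr0 //.
by rewrite distrC.
Qed.

Lemma cont2_snd U x y : cont2 U x y -> {for y, continuous (U x)}.
Proof.
move=> H; apply/cvgrPdist_lt => e /H [d d0 Hd]; apply/nbhs_ballP.
exists d => // z /= ; rewrite /ball /= => zd; rewrite distrC; apply: Hd; rewrite ?subrr ?normr0 //.
by rewrite distrC.
Qed.

(** The function integrates U dx - V dy along a horizontal leg at height [y0] and then a vertical
    leg. Goursat on the rectangle between the abscissas x, x + h and the heights y0, y turns its
    increment into the integral along the short path (x, y), (x + h, y), (x + h, y + k), where
    continuity of U and V is enough. Passing from [r] to [rho] gives continuity on the closed
    intervals on which the antiderivatives are built. *)
Lemma real_primitive U V x0 y0 r rho : 0 < rho -> rho < r ->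
  (forall x y, `|x - x0| < r -> `|y - y0| < r -> exists a b, CR U V x y a b) ->
  exists A, forall x y, `|x - x0| < rho -> `|y - y0| < rho -> TD A x y (U x y) (- V x y).
Proof.
move=> rho0 rhor hol.
have Phi_ex y : exists G : R -> R, `|y - y0| < rho -> forall x, `|x - x0| < rho -> is_derive x 1 G (U x y).
  have [yr|yr] := ltP `|y - y0| rho; last by exists (fun _ => 0).
  have [|G HG] := @antiderivative R (U ^~ y) x0 rho rho0; last by exists G.
  move=> x xr; have [a [b [H _]]] := hol x y (le_lt_trans xr rhor) (lt_trans yr rhor).
  exact/cont2_fst/(TD_cont H).
have Psi_ex x : exists G : R -> R, `|x - x0| < rho -> forall y, `|y - y0| < rho -> is_derive y 1 G (V x y).
  have [xr|xr] := ltP `|x - x0| rho; last by exists (fun _ => 0).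
  have [|G HG] := @antiderivative R (V x) y0 rho rho0; last by exists G.
  move=> y yr; have [a [b [_ H]]] := hol x y (lt_trans xr rhor) (le_lt_trans yr rhor).
  exact/cont2_snd/(TD_cont H).
have [Phi HPhi] := choice Phi_ex; have [Psi HPsi] := choice Psi_ex.
have seg c z w : `|z - c| < rho -> `|w - c| < rho -> forall s, 0 <= s <= 1 ->
    `|z + (w - z) * s - c| < rho.
  move=> zc wc s /andP[s0 s1].
  have -> : z + (w - z) * s - c = (1 - s) * (z - c) + s * (w - c) by ring.
  apply: le_lt_trans (ler_normD _ _) _; rewrite !normrM (ger0_norm s0) ger0_norm ?subr_ge0 //.
  have := ler_wpM2l s0 (ltW wc).
  have [s1'|s1'] := ltP s 1; last first.
    have -> : s = 1 by apply/eqP; rewrite eq_le s1.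
    by rewrite subrr mul0r mul1r add0r.
  have : (1 - s) * `|z - c| < (1 - s) * rho by rewrite ltr_pM2l // subr_gt0.
  by move=> /ltr_leD H /H {}H; apply: lt_le_trans H _; rewrite -mulrDl subrK mul1r.
have J0 x x' y y' : `|x - x0| < rho -> `|x' - x0| < rho -> `|y - y0| < rho ->
    `|y' - y0| < rho -> bdry_int Phi Psi x x' y y' = 0.
  move=> hx hx' hy hy'.
  have := @goursat R Phi Psi U V x0 y0 rho
    (fun x y hx hy => HPhi y hy x hx) (fun x y hx hy => HPsi x hx y hy)
    (fun x y hx hy => hol x y (lt_trans hx rhor) (lt_trans hy rhor)) x (x' - x) y (y' - y)
    (seg _ _ _ hx hx') (seg _ _ _ hy hy').
  by rewrite !(addrC _ (_ - _)) !subrK.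
exists (fun x y => Phi y0 x - Phi y0 x0 - (Psi x y - Psi x y0)) => x y hx hy e e0.
have y0r : `|y0 - y0| < rho by rewrite subrr normr0.
have [a [b [HU HV]]] := hol x y (lt_trans hx rhor) (lt_trans hy rhor).
have [d1 d10 cU] := TD_cont HU e0; have [d2 d20 cV] := TD_cont HV e0.
exists (Num.min (Num.min d1 d2) (Num.min (rho - `|x - x0|) (rho - `|y - y0|))).
  by rewrite !lt_min d10 d20 !subr_gt0 hx.
move=> h k; rewrite !lt_min => /andP[/andP[h1 h2] /andP[h3 h4]] /andP[/andP[k1 k2] /andP[k3 k4]].
have inb (z w c g : R) : 0 <= c <= 1 -> `|w| < rho - `|z - g| -> `|z + w * c - g| < rho.
  move=> c01 hw; rewrite -[z + w * c - g]addrA (addrCA z).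
  apply: le_lt_trans (ler_normD _ _) _; rewrite normrM [`|c|]ger0_norm; last by case/andP: c01.
  have /andP[_] := mul01 (normr_ge0 w) c01; lra.
have le01 : 0 <= (1 : R) <= 1 by rewrite ler01 lexx.
have hx' : `|x + h - x0| < rho by have := inb x h 1 x0 le01 h3; rewrite mulr1.
have hy' : `|y + k - y0| < rho by have := inb y k 1 y0 le01 k4; rewrite mulr1.
have j1 := J0 x (x + h) y0 y hx hx' y0r hy.
have small (w c : R) dd : 0 <= c <= 1 -> `|w| < dd -> forall z, `|z + w * c - z| < dd.
  move=> c01 wd z; rewrite (_ : z + w * c - z = w * c); last by ring.
  rewrite normrM [`|c|]ger0_norm; last by case/andP: c01.
  by apply: le_lt_trans wd; case/andP: (mul01 (normr_ge0 w) c01).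
have B1 : `|Phi y (x + h) - Phi y x - U x y * h| <= e * `|h|.
  apply: (@mvt_bound R (Phi y) (fun z => U z y)) => t t01; split.
    by apply: HPhi => //; apply: inb.
  by apply/ltW/cU; [exact: small|rewrite subrr normr0].
have B2 : `|Psi (x + h) (y + k) - Psi (x + h) y - V x y * k| <= e * `|k|.
  apply: (@mvt_bound R (Psi (x + h)) (fun z => V (x + h) z)) => t t01; split.
    by apply: HPsi => //; apply: inb.
  apply/ltW/cV; last exact: small.
  by have := small h 1 d2 le01 h2 x; rewrite mulr1.
move: j1 B1 B2; rewrite /bdry_int.
clear; rewrite !ler_norml; lra.
Qed.

Theorem primitive U V x0 y0 r rho : 0 < rho -> rho < r ->
  (forall x y, `|x - x0| < r -> `|y - y0| < r -> exists a b, CR U V x y a b) ->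
  exists A B, forall x y, `|x - x0| < rho -> `|y - y0| < rho ->
    CR A B x y (U x y) (V x y).
Proof.
move=> rho0 rhor hol.
have [A HA] := real_primitive rho0 rhor hol.
(* The imaginary part of a primitive of f is the real part of a primitive of -i f = V - i U. *)
have [|B HB] := @real_primitive V (fun x y => - U x y) x0 y0 r rho rho0 rhor.
  move=> x y hx hy; have [a [b [H1 H2]]] := hol x y hx hy.
  by exists b, (- a); split; [rewrite opprK|have := TD_opp H1; rewrite opprK].
exists A, B => x y hx hy; split; first exact: HA.
by have := HB x y hx hy; rewrite opprK.
Qed.

End Primitive.

(** * Compactness of segments and rectangles *)

Section Compactness.
Context {R : realType}.
Implicit Types (x y a b c d e h k l w m n q r s t z K : R) (U V W : R -> R -> R).

(** Compactness as a uniform choice of threshold: the local hypothesis covers all nearby points and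
    all small [d] at once, so finitely many neighbourhoods yield one [d]. *)
Lemma segment_unif (P : R -> R -> Prop) a b :
  (forall x, a <= x <= b -> exists2 e, 0 < e &
     forall x' d, `|x' - x| < e -> 0 < d -> d < e -> P d x') ->
  exists2 d, 0 < d & forall x, a <= x <= b -> P d x.
Proof.
move=> H.
have /compact_near_coveringP := @segment_compact R a b.
move=> /(_ _ (0 : R)^'+ P _) [].
  move=> x; rewrite /= in_itv /= => /H [e e0 He].
  exists (ball x e, [set d | 0 < d < e]); last first.
    by move=> [z d] [/= xz /andP[dz de]]; apply: He => //; rewrite distrC.
  split; first exact: nbhsx_ballx.
  near=> d; apply/andP; split; near: d; [exact: nbhs_right_gt|exact: nbhs_right_lt].
move=> e /= e0 He; exists (e / 2); first by rewrite divr_gt0.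
move=> x xab; apply: He; rewrite /= ?in_itv //= ?divr_gt0 //.
by rewrite sub0r normrN ger0_norm; lra.
Unshelve. all: by end_near. Qed.

Lemma cont2_continuous U x y : cont2 U x y ->
  {for (x, y), continuous (fun p : R * R => U p.1 p.2)}.
Proof.
move=> H; apply/cvgrPdist_lt => e /H [d d0 Hd].
exists (ball x d, ball y d); first by split; exact: nbhsx_ballx.
by move=> [x' y'] [/= hx hy]; rewrite distrC; apply: Hd; rewrite distrC.
Qed.

Lemma EVT2 U a b c d : a <= b -> c <= d ->
  (forall x y, a <= x <= b -> c <= y <= d -> cont2 U x y) ->
  exists x y, [/\ a <= x <= b, c <= y <= d &
    forall x' y', a <= x' <= b -> c <= y' <= d -> U x' y' <= U x y].
Proof.
move=> ab cd H.
have cp : compact (`[a, b] `*` `[c, d]) by apply: compact_setX; exact: segment_compact.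
have ne : (`[a, b] `*` `[c, d]) !=set0.
  by exists (a, c); split; rewrite /= in_itv /= lexx.
have cf : {within (`[a, b] `*` `[c, d]), continuous (fun p : R * R => U p.1 p.2)}.
  apply: continuous_in_subspaceT => -[x y]; rewrite inE => -[/=].
  by rewrite !in_itv /= => hx hy; exact/cont2_continuous/H.
have [[x y] + Hm] := compact_EVT_max ne cp cf.
rewrite inE => -[/=]; rewrite !in_itv /= => hx hy; exists x, y; split => // x' y' hx' hy'.
by apply: (Hm (x', y')); rewrite inE; split; rewrite /= in_itv.
Qed.

Lemma bounded2 U a b c d :
  (forall x y, a <= x <= b -> c <= y <= d -> cont2 U x y) ->
  exists2 M, 0 <= M & forall x y, a <= x <= b -> c <= y <= d -> `|U x y| <= M.
Proof.
move=> H.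
have [ab|ba] := leP a b; last by exists 0 => // x y; lra.
have [cd|dc] := leP c d; last by exists 0 => // x y _; lra.
have [|x [y [_ _ Hm]]] := @EVT2 (fun x y => `|U x y|) a b c d ab cd.
  move=> x y hx hy e e0; have [r r0 Hr] := H x y hx hy e e0; exists r => // x' y' h1 h2.
  exact: le_lt_trans (ler_dist_dist _ _) (Hr x' y' h1 h2).
by exists `|U x y|.
Qed.

Lemma cont2_comp U (f g : R -> R) t : cont2 U (f t) (g t) -> {for t, continuous f} -> {for t, continuous g} ->
  {for t, continuous (fun s => U (f s) (g s))}.
Proof.
move=> cU cf cg; apply/cvgrPdist_lt => e /cU [d d0 Hd].
move/cvgrPdist_lt : cf => /(_ _ d0) cf; move/cvgrPdist_lt : cg => /(_ _ d0) cg.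
near=> s; rewrite distrC; apply: Hd; rewrite distrC.
  by near: s.
by near: s.
Unshelve. all: by end_near. Qed.

End Compactness.

(** * Mean values over circles and Cauchy's formula for the derivative *)

Section Circle_means.
Context {R : realType}.
Implicit Types (x y a b c d e h k l w m q r s t z K M : R) (A B U V W : R -> R -> R).

Definition rint a b (g : R -> R) : R := \int[lebesgue_measure]_(t in `[a, b]) g t.

Lemma rint_integrable a b (g : R -> R) : continuous g ->
  (@lebesgue_measure R).-integrable `[a, b] (EFin \o g).
Proof.
move=> cg; apply: continuous_compact_integrable; first exact: segment_compact.
exact: continuous_subspaceT.
Qed.

Lemma rint_cst a b c : a < b -> rint a b (fun _ => c) = (b - a) * c.
Proof.
by move=> ab; rewrite /rint Rintegral_cst //= lebesgue_measure_itv /= lte_fin ab mulrC.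
Qed.

Lemma rintD a b (f g : R -> R) : continuous f -> continuous g ->
  rint a b (fun t => f t + g t) = rint a b f + rint a b g.
Proof. by move=> cf cg; rewrite /rint RintegralD //; exact: rint_integrable. Qed.

Lemma rintB a b (f g : R -> R) : continuous f -> continuous g ->
  rint a b (fun t => f t - g t) = rint a b f - rint a b g.
Proof. by move=> cf cg; rewrite /rint RintegralB //; exact: rint_integrable. Qed.

Lemma rintZ a b c (f : R -> R) : continuous f -> rint a b (fun t => c * f t) = c * rint a b f.
Proof. by move=> cf; rewrite /rint RintegralZl //; exact: rint_integrable. Qed.

Lemma rint_le a b (f g : R -> R) : continuous f -> continuous g ->
  (forall t, a <= t <= b -> f t <= g t) -> rint a b f <= rint a b g.
Proof.
move=> cf cg fg; apply: le_Rintegral => //; exact: rint_integrable.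
Qed.

Lemma rint_norm_le a b (f : R -> R) M : a < b -> continuous f ->
  (forall t, a <= t <= b -> `|f t| <= M) -> `|rint a b f| <= (b - a) * M.
Proof.
move=> ab cf fM; rewrite ler_norml -mulrN -!rint_cst //; apply/andP; split;
  apply: rint_le => // t; by [exact: cst_continuous|move=> /fM; rewrite ler_norml => /andP[]].
Qed.

Lemma eq_rint a b (f g : R -> R) : f =1 g -> rint a b f = rint a b g.
Proof. by move=> fg; congr rint; apply/funext. Qed.

Lemma rint_derive a b (G g : R -> R) : a < b -> continuous g -> (forall t, is_derive t 1 G (g t)) ->
  rint a b g = G b - G a.
Proof.
move=> ab cg dG; rewrite /rint /Rintegral (@continuous_FTC2 R g G) //.
- exact: continuous_subspaceT.
- have cG t : {for t, continuous G}.
    by apply/differentiable_continuous/derivable1_diffP; case: (dG t).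
  split; first by move=> x _; case: (dG x).
  + exact: (cvg_at_right_filter (cG a)).
  + exact: (cvg_at_left_filter (cG b)).
- by move=> x _; rewrite derive1E; case: (dG x).
Qed.

Let pi2_gt0 : 0 < 2 * (pi : R). Proof. by rewrite mulr_gt0 // pi_gt0. Qed.

Definition cint := rint 0 (2 * pi).

Lemma cint_cst c : cint (fun _ => c) = 2 * pi * c.
Proof. by rewrite /cint rint_cst // subr0. Qed.

Lemma cintD (f g : R -> R) : continuous f -> continuous g ->
  cint (fun t => f t + g t) = cint f + cint g.
Proof. exact: rintD. Qed.

Lemma cintB (f g : R -> R) : continuous f -> continuous g ->
  cint (fun t => f t - g t) = cint f - cint g.
Proof. exact: rintB. Qed.

Lemma cintZ c (f : R -> R) : continuous f -> cint (fun t => c * f t) = c * cint f.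
Proof. exact: rintZ. Qed.

Lemma cint_le (f g : R -> R) : continuous f -> continuous g ->
  (forall t, 0 <= t <= 2 * pi -> f t <= g t) -> cint f <= cint g.
Proof. exact: rint_le. Qed.

Lemma cint_norm_le (f : R -> R) M : continuous f -> (forall t, 0 <= t <= 2 * pi -> `|f t| <= M) ->
  `|cint f| <= 2 * pi * M.
Proof. by move=> cf fM; have := rint_norm_le pi2_gt0 cf fM; rewrite subr0. Qed.

Lemma eq_cint (f g : R -> R) : f =1 g -> cint f = cint g.
Proof. by move=> fg; congr cint; apply/funext. Qed.

Lemma cint_derive (G g : R -> R) : continuous g -> (forall t, is_derive t 1 G (g t)) ->
  cint g = G (2 * pi) - G 0.
Proof. exact: rint_derive. Qed.

Lemma is_derive_cint (Q q : R -> R -> R) s0 d M : 0 < d ->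
  (forall s, `|s - s0| < d -> continuous (Q s)) ->
  (forall s t, `|s - s0| < d -> is_derive s 1 (Q ^~ t) (q s t)) ->
  (forall s t, `|s - s0| < d -> `|q s t| <= M) ->
  is_derive s0 1 (fun s => cint (Q s)) (cint (q s0)).
Proof.
move=> d0 cQ dQ bQ.
have inI s : `]s0 - d, s0 + d[%classic s -> `|s - s0| < d.
  by rewrite /= in_itv /= ltr_norml => /andP[h1 h2]; apply/andP; split; lra.
have s0I : `]s0 - d, s0 + d[%classic s0 by rewrite /= in_itv /=; apply/andP; split; lra.
have M0 : 0 <= M by apply: le_trans (bQ s0 0 (inI _ s0I)).
have dQE s t : `|s - s0| < d -> partial1of2 Q s t = q s t.
  by move=> sd; rewrite /partial1of2 derive1E; case: (dQ s t sd).
have H1 x : `]s0 - d, s0 + d[%classic x ->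
    (@lebesgue_measure R).-integrable `[0, 2 * pi] (EFin \o Q x).
  by move=> /inI/cQ; exact: rint_integrable.
have H2 x y : `]s0 - d, s0 + d[%classic x -> `[0, 2 * pi]%classic y -> derivable (Q ^~ y) x 1.
  by move=> /inI xd _; case: (dQ x y xd).
have H3 : (@lebesgue_measure R).-integrable `[0, 2 * pi] (EFin \o (fun _ => M)).
  by apply: rint_integrable => t; exact: cst_continuous.
have H4 x y : `]s0 - d, s0 + d[%classic x -> `[0, 2 * pi]%classic y -> `|partial1of2 Q x y| <= M.
  by move=> /inI xd _; rewrite dQE //; exact: bQ.
have mI : measurable (`[0, 2 * pi] : set R) by [].
have Hd := @derivable_under_integral R _ _ (@lebesgue_measure R) Q _ mI s0 (s0 - d) (s0 + d) s0I H1 H2 (fun _ => M) (fun _ => M0) H3 H4.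
have He := @differentiation_under_integral R _ _ (@lebesgue_measure R) Q _ mI s0 (s0 - d) (s0 + d) s0I H1 H2 (fun _ => M) (fun _ => M0) H3 H4.
apply: DeriveDef; first exact: Hd.
rewrite -derive1E; apply: etrans He _.
by apply: eq_Rintegral => t _; rewrite dQE // inI.
Qed.

Lemma is_derive_radius U a b x y s t : TD U (x + s * cos t) (y + s * sin t) a b ->
  is_derive s 1 (fun s => U (x + s * cos t) (y + s * sin t)) (a * cos t + b * sin t).
Proof.
move=> H.
have L c g : is_derive s 1 (fun s => c + s * g) g.
  apply/is_derive1P => e e0; exists 1 => // h _.
  rewrite (_ : c + (s + h) * g - (c + s * g) - g * h = 0); last by ring.
  by rewrite normr0 mulr_ge0 // ltW.
exact: (@TD_chain R U a b (fun s => x + s * cos t) (fun s => y + s * sin t) s _ _ H (L _ _) (L _ _)).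
Qed.

Lemma is_derive_angle U a b x y s t : TD U (x + s * cos t) (y + s * sin t) a b ->
  is_derive t 1 (fun t => U (x + s * cos t) (y + s * sin t)) (a * (- (s * sin t)) + b * (s * cos t)).
Proof.
move=> H.
have L (f : R -> R) l c : is_derive t 1 f l -> is_derive t 1 (fun t => c + s * f t) (s * l).
  move=> Hf.
  have := @TD_chain R (fun z _ => c + s * f z) (s * l) 0 id (fun _ => 0) t 1 0.
  rewrite mulr1 mulr0 addr0; apply.
  have := @TD_comp R f (fun z _ => z) t 0 1 0 l Hf (TD_fst t 0).
  move=> /(TD_scale s) /(TD_add (TD_cst c t 0)).
  by rewrite !add0r mulr1 !mulr0.
rewrite -mulrN.
exact: (@TD_chain R U a b (fun t => x + s * cos t) (fun t => y + s * sin t) t _ _ H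
  (L _ _ x (is_derive_cos t)) (L _ _ y (is_derive_sin t))).
Qed.

Lemma is_derive_centre U a b x y p q : TD U (x + p) (y + q) a b ->
  is_derive x 1 (fun x => U (x + p) (y + q)) a.
Proof.
move=> H.
have L : is_derive x 1 (fun z => z + p) 1.
  apply/is_derive1P => e e0; exists 1 => // h _.
  rewrite (_ : x + h + p - (x + p) - 1 * h = 0); last by ring.
  by rewrite normr0 mulr_ge0 // ltW.
have L' : is_derive x 1 (fun z : R => y + q) 0 by exact: is_derive_cst.
by have := @TD_chain R U a b (fun z => z + p) (fun _ => y + q) x _ _ H L L'; rewrite mulr1 mulr0 addr0.
Qed.

Lemma circle_continuous U x y s :
  (forall t, cont2 U (x + s * cos t) (y + s * sin t)) ->
  continuous (fun t => U (x + s * cos t) (y + s * sin t)).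
Proof.
move=> H t; apply: (@cont2_comp R U (fun t => x + s * cos t) (fun t => y + s * sin t) t (H t)).
  by apply: cvgD; [exact: cvg_cst|apply: cvgM; [exact: cvg_cst|exact: continuous_cos]].
by apply: cvgD; [exact: cvg_cst|apply: cvgM; [exact: cvg_cst|exact: continuous_sin]].
Qed.

Lemma norm_circle s t : `|s * cos t| <= `|s| /\ `|s * sin t| <= `|s|.
Proof.
by split; rewrite normrM ler_piMr // ler_norml ?cos_geN1 ?cos_le1 ?sin_geN1 ?sin_le1.
Qed.

(** The derivative is asked to vanish for s > 0 only: the applications either divide by s or quote
    an identity for positive radii. *)
Lemma const_of_derive0 (f df : R -> R) rho r : 0 < r -> r < rho ->
  (forall s, `|s| < rho -> is_derive s 1 f (df s)) ->
  (forall s, 0 < s -> s < rho -> df s = 0) -> f r = f 0.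
Proof.
move=> r0 rr Hd H0.
have inr s : s \in `[0, r] -> `|s| < rho.
  by rewrite in_itv /= => /andP[h1 h2]; rewrite ger0_norm //; lra.
have [c] := @MVT R f df 0 r r0
  (fun x xi => Hd x (inr x ltac:(by move: xi; rewrite !in_itv /= => /andP[/ltW -> /ltW ->])))
  ltac:(by apply: derivable_within_continuous => x /inr /Hd []).
rewrite in_itv /= => /andP[c0 cr]; rewrite H0 ?mul0r //; last by lra.
by move=> /eqP; rewrite subr_eq0 => /eqP.
Qed.

Lemma is_derive_unique_near (f g : R -> R) x l l' d : 0 < d ->
  (forall x', `|x' - x| < d -> f x' = g x') ->
  is_derive x 1 f l -> is_derive x 1 g l' -> l = l'.
Proof.
move=> d0 fg Hf Hg; apply/eqP; rewrite -subr_eq0 -normr_le0.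
apply/ler_addgt0Pr => e e0; rewrite add0r.
have e20 : 0 < e / 2 by rewrite divr_gt0.
move/is_derive1P : Hf => /(_ _ e20)[d1 d10 Hf].
move/is_derive1P : Hg => /(_ _ e20)[d2 d20 Hg].
pose h := Num.min d (Num.min d1 d2) / 2.
have m0 : 0 < Num.min d (Num.min d1 d2) by rewrite !lt_min d0 d10.
have h0 : 0 < h by rewrite divr_gt0.
have : h < Num.min d (Num.min d1 d2) by rewrite /h ltr_pdivrMr // mulr_natr mulr2n ltrDl.
rewrite !lt_min => /and3P[hd hd1 hd2].
have nh : `|h| = h by rewrite gtr0_norm.
have := Hf h; rewrite nh => /(_ hd1); have := Hg h; rewrite nh => /(_ hd2).
rewrite !fg ?subrr ?normr0 //; last by rewrite addrC addKr nh.
move=> H1 H2; rewrite -(ler_pM2r h0) -{1}nh -normrM.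
have -> : (l - l') * h = (g (x + h) - g x - l' * h) - (g (x + h) - g x - l * h) by ring.
by apply: le_trans (ler_normB _ _) _; lra.
Qed.

Lemma cint_cos : cint (fun t => cos t) = 0.
Proof.
rewrite (_ : 0 = sin (2 * pi) - sin 0 :> R); last by rewrite mulrC mulr_natr sin2pi sin0 subrr.
by apply: (@cint_derive (fun t => sin t)); exact: continuous_cos.
Qed.

Lemma cint_sin : cint (fun t => sin t) = 0.
Proof.
rewrite (_ : 0 = - cos (2 * pi) - - cos 0 :> R); last by rewrite mulrC mulr_natr cos2pi cos0 subrr.
apply: (@cint_derive (fun t => - cos t)); first exact: continuous_sin.
by move=> t; apply: is_derive_eq; rewrite opprK.
Qed.

Section Mean_value_primitive.
Variables (A B U V : R -> R -> R) (x0 y0 rho kap M : R).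
Hypothesis kap0 : 0 < kap.
Hypothesis kaprho : kap < rho.
Hypothesis CRAB : forall x y, `|x - x0| < rho -> `|y - y0| < rho -> CR A B x y (U x y) (V x y).
Hypothesis cU : forall x y, `|x - x0| < rho -> `|y - y0| < rho -> cont2 U x y.
Hypothesis cV : forall x y, `|x - x0| < rho -> `|y - y0| < rho -> cont2 V x y.
Hypothesis bU : forall x y, `|x - x0| < rho -> `|y - y0| < rho -> `|U x y| <= M.
Hypothesis bV : forall x y, `|x - x0| < rho -> `|y - y0| < rho -> `|V x y| <= M.

Let inx x r t : `|x - x0| < kap -> `|r| < rho - kap -> `|x + r * cos t - x0| < rho.
Proof.
move=> hx hr; rewrite -addrA (addrCA x) addrC.
by apply: le_lt_trans (ler_normD _ _) _; have [h _] := norm_circle r t; lra.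
Qed.

Let iny y r t : `|y - y0| < kap -> `|r| < rho - kap -> `|y + r * sin t - y0| < rho.
Proof.
move=> hx hr; rewrite -addrA (addrCA y) addrC.
by apply: le_lt_trans (ler_normD _ _) _; have [_ h] := norm_circle r t; lra.
Qed.

Let cA x y : `|x - x0| < rho -> `|y - y0| < rho -> cont2 A x y.
Proof. by move=> hx hy; have [H _] := CRAB hx hy; exact: TD_cont H. Qed.

Let cB x y : `|x - x0| < rho -> `|y - y0| < rho -> cont2 B x y.
Proof. by move=> hx hy; have [_ H] := CRAB hx hy; exact: TD_cont H. Qed.

Let circ W x y r t := W (x + r * cos t) (y + r * sin t).

Let ccirc W x y r : (forall x y, `|x - x0| < rho -> `|y - y0| < rho -> cont2 W x y) ->
  `|x - x0| < kap -> `|y - y0| < kap -> `|r| < rho - kap -> continuous (circ W x y r).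
Proof. by move=> cW hx hy hr; apply: circle_continuous => t; apply: cW; [exact: inx|exact: iny]. Qed.

Let ccos : continuous (fun t : R => cos t). Proof. exact: continuous_cos. Qed.
Let csin : continuous (fun t : R => sin t). Proof. exact: continuous_sin. Qed.

Let cmul (f g : R -> R) : continuous f -> continuous g -> continuous (fun t => f t * g t).
Proof. by move=> cf cg t; apply: cvgM; [exact: cf|exact: cg]. Qed.

Let cadd (f g : R -> R) : continuous f -> continuous g -> continuous (fun t => f t + g t).
Proof. by move=> cf cg t; apply: cvgD; [exact: cf|exact: cg]. Qed.

Let bcos (p q t : R) : `|p| <= M -> `|q| <= M -> `|p * cos t + q * sin t| <= M + M.
Proof.
move=> hp hq; apply: le_trans (ler_normD _ _) _.
apply: lerD; rewrite normrM -[leRHS]mulr1; apply: ler_pM => //;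
  by rewrite ler_norml ?cos_geN1 ?cos_le1 ?sin_geN1 ?sin_le1.
Qed.

(** The radial derivative of the mean of A is the integral of U cos t - V sin t, and s times this
    integrand is the angular derivative of B along the circle, hence integrates to 0. The argument
    is run on a primitive because its derivative U + iV is known to be continuous, whereas the
    derivative of U + iV is not yet. *)
Lemma mean_value_primitive x y r : `|x - x0| < kap -> `|y - y0| < kap -> 0 < r -> r < rho - kap ->
  cint (circ A x y r) = 2 * pi * A x y.
Proof.
move=> hx hy r0 rr.
transitivity (cint (circ A x y 0)); last first.
  by rewrite -cint_cst; apply: eq_cint => t; rewrite /circ !mul0r !addr0.
apply: (@const_of_derive0 (fun r => cint (circ A x y r))
  (fun s => cint (fun t => circ U x y s t * cos t + - circ V x y s t * sin t)) (rho - kap)) => //.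
  move=> s sr; apply: (@is_derive_cint _ (fun s t => circ U x y s t * cos t + - circ V x y s t * sin t)
    s (rho - kap - `|s|) (M + M)).
  - by rewrite subr_gt0.
  - move=> s' ss; apply: ccirc => //.
    by rewrite -(subrK s s'); apply: le_lt_trans (ler_normD _ _) _; lra.
  - move=> s' t ss; have hs' : `|s'| < rho - kap.
      by rewrite -(subrK s s'); apply: le_lt_trans (ler_normD _ _) _; lra.
    by apply: is_derive_radius; case: (CRAB (inx t hx hs') (iny t hy hs')).
  - move=> s' t ss; have hs' : `|s'| < rho - kap.
      by rewrite -(subrK s s'); apply: le_lt_trans (ler_normD _ _) _; lra.
    by apply: bcos; rewrite ?normrN; [apply: bU|apply: bV]; by [exact: inx|exact: iny].
move=> s s0 sr; have hs : `|s| < rho - kap by rewrite gtr0_norm.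
apply: (mulfI (x := s)); first by rewrite gt_eqF.
have cg : continuous (fun t => circ U x y s t * cos t + - circ V x y s t * sin t).
  apply: cadd; apply: cmul => //; first exact: ccirc.
  by move=> t; apply: cvgN; exact: ccirc.
rewrite mulr0 -cintZ //.
transitivity (circ B x y s (2 * pi) - circ B x y s 0); last first.
  by rewrite /circ !(mulrC 2 pi) !mulr_natr cos2pi sin2pi cos0 sin0 subrr.
apply: cint_derive.
- by apply: cmul => // t; exact: cvg_cst.
- move=> t; have [_ H] := CRAB (inx t hx hs) (iny t hy hs).
  have := is_derive_angle H; rewrite (_ : _ * - _ + _ = s * (circ U x y s t * cos t + - circ V x y s t * sin t)) //.
  by rewrite /circ; ring.
Qed.

(** Differentiate the mean value identity for A in the centre; [kap] is the room in which the centre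
    moves. *)
Lemma mean_value_of_primitive x y r : `|x - x0| < kap -> `|y - y0| < kap -> 0 < r -> r < rho - kap ->
  cint (circ U x y r) = 2 * pi * U x y.
Proof.
move=> hx hy r0 rr; have hr : `|r| < rho - kap by rewrite gtr0_norm.
have sub x' : `|x' - x| < kap - `|x - x0| -> `|x' - x0| < kap.
  move=> hx'; rewrite -(subrK x x') -addrA.
  by apply: le_lt_trans (ler_normD _ _) _; lra.
have D1 : is_derive x 1 (fun x => cint (circ A x y r)) (cint (circ U x y r)).
  apply: (@is_derive_cint (fun x t => circ A x y r t) (fun x t => circ U x y r t) x (kap - `|x - x0|) M).
  - by rewrite subr_gt0.
  - by move=> x' /sub hx'; apply: ccirc.
  - move=> x' t /sub hx'; apply: is_derive_centre.
    by have [H _] := CRAB (inx t hx' hr) (iny t hy hr); exact: H.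
  - by move=> x' t /sub hx'; apply: bU; [exact: inx|exact: iny].
have D2 : is_derive x 1 (fun x => 2 * pi * A x y) (2 * pi * U x y).
  have hx' : `|x - x0| < rho by apply: lt_trans kaprho.
  have hy' : `|y - y0| < rho by apply: lt_trans kaprho.
  have [H _] := CRAB hx' hy'.
  have := @is_derive_centre (fun x y => 2 * pi * A x y) (2 * pi * U x y) (2 * pi * - V x y) x y 0 0.
  under [X in is_derive _ _ X]eq_fun do rewrite !addr0.
  by apply; rewrite !addr0; exact: TD_scale.
have kx : 0 < kap - `|x - x0| by rewrite subr_gt0.
apply: (is_derive_unique_near kx _ D1 D2).
by move=> x' /sub hx'; exact: mean_value_primitive.
Qed.

(** Real part of Cauchy's formula for the derivative U + iV of A + iB, since A cos t + B sin t is
    the real part of (A + iB) e^(-it). By Cauchy-Riemann its radial derivative is U (cos^2 t + sin^2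
    t) = U, whose mean is known. *)
Lemma circle_moment_of_primitive x y r : `|x - x0| < kap -> `|y - y0| < kap -> 0 < r -> r < rho - kap ->
  cint (fun t => circ A x y r t * cos t + circ B x y r t * sin t) = 2 * pi * r * U x y.
Proof.
move=> hx hy r0 rr.
pose Q s t := circ A x y s t * cos t + circ B x y s t * sin t.
have cQ s : `|s| < rho - kap -> continuous (Q s).
  by move=> hs; apply: cadd; apply: cmul => //; exact: ccirc.
pose f s := cint (Q s) - 2 * pi * s * U x y.
have E : f r = f 0.
  apply: (@const_of_derive0 f (fun s => cint (circ U x y s) - 2 * pi * U x y) (rho - kap)) => //.
    move=> s sr; apply: is_deriveB; last first.
      apply/is_derive1P => e e0; exists 1 => // h _.
      rewrite (_ : 2 * pi * (s + h) * U x y - 2 * pi * s * U x y - 2 * pi * U x y * h = 0); last by ring.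
      by rewrite normr0 mulr_ge0 // ltW.
    apply: (@is_derive_cint Q (fun s t => circ U x y s t) s (rho - kap - `|s|) M).
    - by rewrite subr_gt0.
    - move=> s' ss; apply: cQ.
      by rewrite -(subrK s s'); apply: le_lt_trans (ler_normD _ _) _; lra.
    - move=> s' t ss; have hs' : `|s'| < rho - kap.
        by rewrite -(subrK s s'); apply: le_lt_trans (ler_normD _ _) _; lra.
      have [HA HB] := CRAB (inx t hx hs') (iny t hy hs').
      have := is_derive_radius (TD_add (TD_scale (cos t) HA) (TD_scale (sin t) HB)).
      under [X in is_derive _ _ X]eq_fun do rewrite !(mulrC (cos t)) !(mulrC (sin t)).
      move=> K; apply: is_derive_eq K _.
      rewrite -[RHS]mulr1 -(cos2Dsin2 t) /circ; ring.
    - move=> s' t ss; have hs' : `|s'| < rho - kap.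
        by rewrite -(subrK s s'); apply: le_lt_trans (ler_normD _ _) _; lra.
      by apply: bU; [exact: inx|exact: iny].
  by move=> s sp sr; rewrite mean_value_of_primitive // subrr.
have f0 : f 0 = 0.
  rewrite /f mulr0 mul0r subr0 /Q /circ.
  transitivity (cint (fun t => A x y * cos t + B x y * sin t)).
    by apply: eq_cint => t; rewrite !mul0r !addr0.
  have cc c : continuous (fun _ : R => c) by move=> t; exact: cvg_cst.
  by rewrite cintD ?cintZ ?cint_cos ?cint_sin ?mulr0 ?addr0 //; apply: cmul.
by move: E; rewrite f0 /f => /eqP; rewrite subr_eq0 => /eqP.
Qed.

(** Differentiating the previous identity in the centre gives the same formula one order higher,
    with U + iV on the circle and its derivative at the centre. *)
Lemma circle_moment_of_primitive_deriv r a b : 0 < r -> r < rho - kap -> TD U x0 y0 a b ->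
  cint (fun t => circ U x0 y0 r t * cos t + circ V x0 y0 r t * sin t) = 2 * pi * r * a.
Proof.
move=> r0 rr HU; have hr : `|r| < rho - kap by rewrite gtr0_norm.
have hy : `|y0 - y0| < kap by rewrite subrr normr0.
have D1 : is_derive x0 1 (fun x => cint (fun t => circ A x y0 r t * cos t + circ B x y0 r t * sin t))
    (cint (fun t => circ U x0 y0 r t * cos t + circ V x0 y0 r t * sin t)).
  apply: (@is_derive_cint (fun x t => circ A x y0 r t * cos t + circ B x y0 r t * sin t)
    (fun x t => circ U x y0 r t * cos t + circ V x y0 r t * sin t) x0 kap (M + M)) => //.
  - by move=> x' hx'; apply: cadd; apply: cmul => //; exact: ccirc.
  - move=> x' t hx'.
    have [HA HB] := CRAB (inx t hx' hr) (iny t hy hr).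
    have := is_derive_centre (TD_add (TD_scale (cos t) HA) (TD_scale (sin t) HB)).
    under [X in is_derive _ _ X]eq_fun do rewrite !(mulrC (cos t)) !(mulrC (sin t)).
    by move=> K; apply: is_derive_eq K _; rewrite !(mulrC (cos t)) !(mulrC (sin t)).
  - by move=> x' t hx'; apply: bcos; [apply: bU|apply: bV]; by [exact: inx|exact: iny].
have D2 : is_derive x0 1 (fun x => 2 * pi * r * U x y0) (2 * pi * r * a).
  have := @is_derive_centre (fun x y => 2 * pi * r * U x y) (2 * pi * r * a) (2 * pi * r * b) x0 y0 0 0.
  under [X in is_derive _ _ X]eq_fun do rewrite !addr0.
  by apply; rewrite !addr0; exact: TD_scale.
apply: (is_derive_unique_near kap0 _ D1 D2).
by move=> x' hx'; exact: circle_moment_of_primitive.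
Qed.

End Mean_value_primitive.

Section Holomorphic_means.
Variables (U V : R -> R -> R) (x0 y0 r0 : R).
Hypothesis hol : forall x y, `|x - x0| < r0 -> `|y - y0| < r0 -> exists a b, CR U V x y a b.

Let prim r : 0 < r -> r < r0 -> exists A B rho kap M, [/\ 0 < kap, kap < rho, r < rho - kap &
  forall x y, `|x - x0| < rho -> `|y - y0| < rho ->
    [/\ CR A B x y (U x y) (V x y), cont2 U x y, cont2 V x y, `|U x y| <= M & `|V x y| <= M]].
Proof.
(* [rho] is halfway between r and r0, and [kap] is half of rho - r, so circles of radius r stay
   inside while the centre moves by [kap]. *)
move=> rp rr; pose rho := r + (r0 - r) / 2; pose kap := (r0 - r) / 4.
have [A [B HAB]] := @primitive R U V x0 y0 r0 rho ltac:(rewrite /rho; lra) ltac:(rewrite /rho; lra) hol.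
have cU x y : `|x - x0| < r0 -> `|y - y0| < r0 -> cont2 U x y.
  by move=> hx hy; have [a [b [H _]]] := hol hx hy; exact: TD_cont H.
have cV x y : `|x - x0| < r0 -> `|y - y0| < r0 -> cont2 V x y.
  by move=> hx hy; have [a [b [_ H]]] := hol hx hy; exact: TD_cont H.
have inb c z : c - rho <= z <= c + rho -> `|z - c| < r0.
  by move=> hz; rewrite ltr_norml; apply/andP; move: hz; rewrite /rho; lra.
have [M1 M10 HM1] := @bounded2 R U (x0 - rho) (x0 + rho) (y0 - rho) (y0 + rho)
  (fun x y hx hy => cU x y (inb _ _ hx) (inb _ _ hy)).
have [M2 M20 HM2] := @bounded2 R V (x0 - rho) (x0 + rho) (y0 - rho) (y0 + rho)
  (fun x y hx hy => cV x y (inb _ _ hx) (inb _ _ hy)).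
have ins c z : `|z - c| < rho -> c - rho <= z <= c + rho.
  by rewrite ltr_norml => /andP[h1 h2]; apply/andP; lra.
exists A, B, rho, kap, (M1 + M2); split; rewrite /kap /rho; try lra.
rewrite -/rho => x y hx hy.
have hx' : `|x - x0| < r0 by apply: lt_trans hx _; rewrite /rho; lra.
have hy' : `|y - y0| < r0 by apply: lt_trans hy _; rewrite /rho; lra.
split; [exact: HAB|exact: cU|exact: cV| |].
  by apply: le_trans (HM1 x y (ins _ _ hx) (ins _ _ hy)) _; rewrite lerDl.
by apply: le_trans (HM2 x y (ins _ _ hx) (ins _ _ hy)) _; rewrite lerDr.
Qed.

Theorem mean_value r : 0 < r -> r < r0 ->
  cint (fun t => U (x0 + r * cos t) (y0 + r * sin t)) = 2 * pi * U x0 y0.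
Proof.
move=> rp rr; have [A [B [rho [kap [M [k0 krho rrho H]]]]]] := prim rp rr.
apply: (@mean_value_of_primitive A B U V x0 y0 rho kap M) => //; rewrite ?subrr ?normr0 //;
  by move=> x y hx hy; case: (H x y hx hy).
Qed.

Theorem derivative_formula r a b : 0 < r -> r < r0 -> CR U V x0 y0 a b ->
  cint (fun t => U (x0 + r * cos t) (y0 + r * sin t) * cos t +
    V (x0 + r * cos t) (y0 + r * sin t) * sin t) = 2 * pi * r * a.
Proof.
move=> rp rr [HU _]; have [A [B [rho [kap [M [k0 krho rrho H]]]]]] := prim rp rr.
apply: (@circle_moment_of_primitive_deriv A B U V x0 y0 rho kap M _ _ _ _ _ _ _ r a (- b)) => //;
  by move=> x y hx hy; case: (H x y hx hy).
Qed.

End Holomorphic_means.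

End Circle_means.

(** * The modulus of a complex number *)

Section Complex_modulus.
Context {R : realType}.
Implicit Types (u v w : R[i]) (e : R).

Lemma cmodE w : (`|w| = (cmod w)%:C)%C. Proof. exact: normc_def. Qed.

Let rc_inj : injective (real_complex R). Proof. by move=> a b []. Qed.

Lemma cmod_ge0 w : 0 <= cmod w. Proof. exact: sqrtr_ge0. Qed.

Lemma cmodM u v : cmod (u * v) = cmod u * cmod v.
Proof. by apply: rc_inj; rewrite rmorphM /= -!cmodE normrM. Qed.

Lemma cmodD u v : cmod (u + v) <= cmod u + cmod v.
Proof. by have := ler_normD u v; rewrite !cmodE -rmorphD /= lecR. Qed.

Lemma cmodN u : cmod (- u) = cmod u.
Proof. by apply: rc_inj; rewrite -!cmodE normrN. Qed.

Lemma cmodV u : cmod u^-1 = (cmod u)^-1.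
Proof. by apply: rc_inj; rewrite fmorphV /= -!cmodE normfV. Qed.

Lemma cmod0 : cmod (0 : R[i]) = 0.
Proof. by apply: rc_inj; rewrite -cmodE normr0. Qed.

Lemma cmod1 : cmod (1 : R[i]) = 1.
Proof. by apply: rc_inj; rewrite -cmodE normr1. Qed.

Lemma cmodX u n : cmod (u ^+ n) = cmod u ^+ n.
Proof. by elim: n => [|n IH]; rewrite ?expr0 ?cmod1 // !exprS cmodM IH. Qed.

Lemma cmod_gt0 w : (0 < cmod w) = (w != 0).
Proof. by rewrite -normr_gt0 cmodE ltcR. Qed.

Lemma cmod_sqr w : cmod w ^+ 2 = complex.Re w ^+ 2 + complex.Im w ^+ 2.
Proof. by rewrite sqr_sqrtr // addr_ge0 // sqr_ge0. Qed.

Lemma cmodB u v : cmod (u - v) <= cmod u + cmod v.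
Proof. by rewrite -(cmodN v); exact: cmodD. Qed.

Lemma cmodBC u v : cmod (u - v) = cmod (v - u).
Proof. by rewrite -cmodN opprB. Qed.

Lemma Re_le_cmod w : `|complex.Re w| <= cmod w.
Proof. by rewrite -sqrtr_sqr ler_wsqrtr // lerDl sqr_ge0. Qed.

Lemma Im_le_cmod w : `|complex.Im w| <= cmod w.
Proof. by rewrite -sqrtr_sqr ler_wsqrtr // lerDr sqr_ge0. Qed.

Lemma cmod_le w : cmod w <= `|complex.Re w| + `|complex.Im w|.
Proof.
rewrite -[leRHS]ger0_norm ?addr_ge0 // -sqrtr_sqr ler_wsqrtr //.
rewrite sqrrD !real_normK ?num_real // mulr2n.
by have := mulr_ge0 (normr_ge0 (complex.Re w)) (normr_ge0 (complex.Im w)); lra.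
Qed.

Lemma ReD u v : complex.Re (u + v) = complex.Re u + complex.Re v. Proof. by case: u; case: v. Qed.
Lemma ImD u v : complex.Im (u + v) = complex.Im u + complex.Im v. Proof. by case: u; case: v. Qed.
Lemma ReN u : complex.Re (- u) = - complex.Re u. Proof. by case: u. Qed.
Lemma ImN u : complex.Im (- u) = - complex.Im u. Proof. by case: u. Qed.
Lemma ReM u v : complex.Re (u * v) = complex.Re u * complex.Re v - complex.Im u * complex.Im v.
Proof. by case: u; case: v. Qed.
Lemma ImM u v : complex.Im (u * v) = complex.Re u * complex.Im v + complex.Im u * complex.Re v.
Proof. by case: u => a b; case: v => c d /=; rewrite addrC (mulrC b) addrC. Qed.

End Complex_modulus.

(** * Differentials with a uniform radius and differentiation under the integral *)

Section Uniform_differentials.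
Context {R : realType}.
Implicit Types (x y a b c d e h k r s t : R) (U V W : R -> R -> R).

(** The radius of the linear approximation depends only on the oscillation of the gradient, so one
    radius serves all parameters at once; this is the uniformity that [TD_rint] asks for. *)
Lemma TD_unif U (ga gb : R -> R -> R) x y d e :
  (forall x' y', `|x' - x| < d -> `|y' - y| < d -> TD U x' y' (ga x' y') (gb x' y') /\
     `|ga x' y' - ga x y| <= e /\ `|gb x' y' - gb x y| <= e) ->
  forall h k, `|h| < d -> `|k| < d ->
    `|U (x + h) (y + k) - U x y - (ga x y * h + gb x y * k)| <= e * (`|h| + `|k|).
Proof.
move=> H h k hd kd.
pose g (s : R) := U (x + h * s) (y + k * s).
have L c p (t : R) : is_derive t 1 (fun s => c + p * s) p.
  apply/is_derive1P => e' e0; exists 1 => // z _.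
  rewrite (_ : c + p * (t + z) - (c + p * t) - p * z = 0); last by ring.
  by rewrite normr0 mulr_ge0 // ltW.
have sm p c (t : R) : 0 <= t <= 1 -> `|p| < d -> `|c + p * t - c| < d.
  move=> t01 pd; rewrite (_ : c + p * t - c = p * t); last by ring.
  rewrite normrM [`|t|]ger0_norm; last by case/andP: t01.
  by apply: le_lt_trans pd; case/andP: (mul01 (normr_ge0 p) t01).
have := @mvt_bound R g (fun s => ga (x + h * s) (y + k * s) * h + gb (x + h * s) (y + k * s) * k)
  0 1 (ga x y * h + gb x y * k) (e * (`|h| + `|k|)).
rewrite /g !add0r !mulr0 !mulr1 !addr0 normr1 mulr1; apply=> t t01; rewrite !add0r !mul1r.
have [HT [Ha Hb]] := H (x + h * t) (y + k * t) (sm h x t t01 hd) (sm k y t t01 kd).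
split; first exact: (@TD_chain R U _ _ (fun s => x + h * s) (fun s => y + k * s) t _ _ HT (L _ _ _) (L _ _ _)).
rewrite opprD addrACA -!mulrBl mulrDr; apply: le_trans (ler_normD _ _) _.
by rewrite !normrM; apply: lerD; rewrite ler_wpM2r.
Qed.

Lemma TD_rint lo hi (Q : R -> R -> R -> R) (a b : R -> R) x y r : lo < hi -> 0 < r ->
  (forall x' y', `|x' - x| < r -> `|y' - y| < r -> continuous (Q x' y')) ->
  continuous a -> continuous b ->
  (forall e, 0 < e -> exists2 d, 0 < d & forall t h k, lo <= t <= hi -> `|h| < d -> `|k| < d ->
    `|Q (x + h) (y + k) t - Q x y t - (a t * h + b t * k)| <= e * (`|h| + `|k|)) ->
  TD (fun x y => rint lo hi (Q x y)) x y (rint lo hi a) (rint lo hi b).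
Proof.
move=> lohi r0 cQ ca cb H e e0.
have p0 : 0 < hi - lo by rewrite subr_gt0.
have [d d0 Hd] := H (e / (hi - lo)) (divr_gt0 e0 p0).
exists (Num.min d r); first by rewrite lt_min d0.
move=> h k; rewrite !lt_min => /andP[hd hr] /andP[kd kr].
have c1 : continuous (Q (x + h) (y + k)) by apply: cQ; rewrite addrC addKr.
have c2 : continuous (Q x y) by apply: cQ; rewrite subrr normr0.
have cm (f : R -> R) c : continuous f -> continuous (fun t => c * f t).
  by move=> cf t; apply: cvgM; [exact: cvg_cst|exact: cf].
have cs (f g : R -> R) : continuous f -> continuous g -> continuous (fun t => f t + g t).
  by move=> cf cg t; apply: cvgD; [exact: cf|exact: cg].
have cd (f g : R -> R) : continuous f -> continuous g -> continuous (fun t => f t - g t).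
  by move=> cf cg t; apply: cvgB; [exact: cf|exact: cg].
have -> : rint lo hi (Q (x + h) (y + k)) - rint lo hi (Q x y) - (rint lo hi a * h + rint lo hi b * k) =
    rint lo hi (fun t => Q (x + h) (y + k) t - Q x y t - (h * a t + k * b t)).
  rewrite (rintB _ _ (cd _ _ c1 c2) (cs _ _ (cm _ h ca) (cm _ k cb))) (rintB _ _ c1 c2).
  by rewrite (rintD _ _ (cm _ h ca) (cm _ k cb)) (rintZ _ _ h ca) (rintZ _ _ k cb) !(mulrC _ (rint _ _ _)).
have -> : e * (`|h| + `|k|) = (hi - lo) * (e / (hi - lo) * (`|h| + `|k|)).
  by rewrite mulrA (mulrCA (hi - lo) e) divff ?mulr1 // gt_eqF.
apply: rint_norm_le => // [|t t2]; first exact: (cd _ _ (cd _ _ c1 c2) (cs _ _ (cm _ h ca) (cm _ k cb))).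
by rewrite (mulrC h) (mulrC k); exact: Hd.
Qed.

End Uniform_differentials.

(** * Holomorphic functions on the tube: their complex derivatives are again holomorphic *)

Section Tube.
Context {R : realType} {n : nat}.
Local Notation vec := ('I_n -> R).
Local Notation fct := (vec -> vec -> R[i]).
Implicit Types (x y : vec) (F G : fct) (j k : 'I_n) (e d r s t : R).

Lemma upd_id x j : upd x j (x j) = x.
Proof. by apply/funext => k; rewrite /upd; case: eqP => [->|]. Qed.

Lemma updE x j s : upd x j s j = s. Proof. by rewrite /upd eqxx. Qed.

Lemma upd_upd x j s t : upd (upd x j s) j t = upd x j t.
Proof. by apply/funext => k; rewrite /upd; case: eqP. Qed.

Lemma updC x j k s t : j != k -> upd (upd x j s) k t = upd (upd x k t) j s.
Proof.
move=> jk; apply/funext => i; rewrite /upd.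
by case: eqP => // ->; rewrite eq_sym (negbTE jk).
Qed.

Lemma octant_upd y j t : octant y -> 0 < t -> octant (upd y j t).
Proof. by move=> oy t0 k; rewrite /upd; case: eqP => _; [exact: t0|exact: oy]. Qed.

(** Neighbourhoods for the sup norm, which behave better than [znorm] balls when a single coordinate
    is changed. *)
Definition near_vec d x x' := forall j, `|x' j - x j| < d.

Lemma near_vec_le d d' x x' : d <= d' -> near_vec d x x' -> near_vec d' x x'.
Proof. by move=> dd H j; exact: lt_le_trans (H j) dd. Qed.

Lemma near_vec_refl d x : 0 < d -> near_vec d x x.
Proof. by move=> d0 j; rewrite subrr normr0. Qed.

Lemma near_vec_upd d x x' j s s' : near_vec d x x' -> `|s' - s| < d -> near_vec d (upd x j s) (upd x' j s').
Proof. by move=> h1 h2 k; rewrite /upd; case: eqP. Qed.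

Lemma near_vec_znorm d x x' y y' : znorm (x' - x) (y' - y) < d -> near_vec d x x' /\ near_vec d y y'.
Proof.
move=> H.
have S0 j : 0 <= \sum_(i < n | i != j) ((x' - x) i ^+ 2 + (y' - y) i ^+ 2).
  by apply: sumr_ge0 => i _; rewrite addr_ge0 ?sqr_ge0.
split=> j; apply: le_lt_trans H; rewrite /znorm -sqrtr_sqr ler_wsqrtr // (bigD1 j) //=.
  rewrite -[x' j - x j]/((x' - x) j).
  by have := S0 j; have := sqr_ge0 ((y' - y) j); lra.
rewrite -[y' j - y j]/((y' - y) j).
by have := S0 j; have := sqr_ge0 ((x' - x) j); lra.
Qed.

Lemma znorm_near_vec d x x' y y' : 0 < d -> near_vec (d / (2 * n.+1%:R)) x x' ->
  near_vec (d / (2 * n.+1%:R)) y y' -> znorm (x' - x) (y' - y) < d.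
Proof.
move=> d0 hx hy; rewrite /znorm.
have N0 : (0 : R) < n.+1%:R by rewrite ltr0n.
(* The factor n + 1 instead of n also covers n = 0 and makes the last comparison strict. *)
set q := d / (2 * n.+1%:R) in hx hy.
have q0 : 0 < q by rewrite divr_gt0 // mulr_gt0.
apply: (@le_lt_trans _ _ (Num.sqrt ((n%:R * q * 2) ^+ 2))); last first.
  rewrite sqrtr_sqr ger0_norm ?mulr_ge0 ?ler0n ?ltW // /q.
  have -> : n%:R * (d / (2 * n.+1%:R)) * 2 = d * (n%:R / n.+1%:R) by field; rewrite gt_eqF.
  by rewrite -[ltRHS]mulr1 ltr_pM2l // ltr_pdivrMr // mul1r ltr_nat.
apply: ler_wsqrtr.
apply: (@le_trans _ _ (\sum_(j < n) (q ^+ 2 + q ^+ 2))).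
  apply: ler_sum => j _; apply: lerD.
    by rewrite -real_normK ?num_real //; apply: lerXn2r; rewrite ?nnegrE //; [exact: ltW q0|exact: ltW (hx j)].
  by rewrite -real_normK ?num_real //; apply: lerXn2r; rewrite ?nnegrE //; [exact: ltW q0|exact: ltW (hy j)].
rewrite sumr_const card_ord -[_ *+ n]mulr_natl.
have M1 : (n%:R : R) <= n%:R * n%:R.
  by rewrite -natrM ler_nat; case: (n) => // m; rewrite leq_pmulr.
have -> : (n%:R * q * 2) ^+ 2 = (n%:R * n%:R) * (4 * q ^+ 2) by ring.
have := ler_wpM2r (sqr_ge0 q) M1.
by have := mulr_ge0 (ler0n R n) (sqr_ge0 q); lra.
Qed.

Definition cont_tube F := forall x y, octant y -> forall e, 0 < e -> exists2 d, 0 < d &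
  forall x' y', octant y' -> near_vec d x x' -> near_vec d y y' -> cmod (F x' y' - F x y) < e.

Definition cderiv F j x y (c : R[i]) := forall e : R, 0 < e -> exists2 d : R, 0 < d &
  forall h : R[i], h != 0 -> cmod h < d ->
    cmod ((F (upd x j (x j + complex.Re h)) (upd y j (y j + complex.Im h)) - F x y) / h - c) < e.

Lemma holomorphic_tubeP F : holomorphic_tube F <->
  cont_tube F /\ (forall x y, octant y -> forall j, exists c, cderiv F j x y c).
Proof.
split=> -[H1 H2]; split=> // x y oy e e0; have [d d0 H] := H1 x y oy e e0.
  exists (d / (2 * n.+1%:R)); first by rewrite divr_gt0 // mulr_gt0 // ltr0n.
  by move=> x' y' oy' hx hy; apply: H => //; exact: znorm_near_vec.
by exists d => // x' y' oy' /near_vec_znorm[hx hy]; exact: H.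
Qed.

(** Transfers the one-variable theory, which speaks of pairs of real functions, to the variable [j]
    of the tube. *)
Lemma cderivP F j x y c : cderiv F j x y c <->
  CR (fun s t => complex.Re (F (upd x j s) (upd y j t)))
     (fun s t => complex.Im (F (upd x j s) (upd y j t))) (x j) (y j) (complex.Re c) (complex.Im c).
Proof.
have key (h k : R) (w : R[i]) :
   complex.Re (w - c * (h +i* k)%C) = complex.Re w - (complex.Re c * h + - complex.Im c * k) /\
   complex.Im (w - c * (h +i* k)%C) = complex.Im w - (complex.Im c * h + complex.Re c * k).
  by case: c w => [a b] [p q] /=; split; ring.
split=> H.
  have H' (e : R) : 0 < e -> exists2 d, 0 < d & forall h k : R, `|h| < d -> `|k| < d ->
      cmod (F (upd x j (x j + h)) (upd y j (y j + k)) - F x y - c * (h +i* k)%C) <= e * (`|h| + `|k|).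
    move=> e0; have [d d0 Hd] := H e e0.
    exists (d / 2); first by rewrite divr_gt0.
    move=> h k hd kd; have [z0|z0] := eqVneq (h +i* k)%C 0.
      case: z0 => -> ->; rewrite !addr0 !upd_id subrr mulr0 subrr cmod0 normr0 addr0 mulr0 //.
    have hk : cmod (h +i* k)%C <= `|h| + `|k| by exact: cmod_le.
    have := Hd _ z0 ltac:(lra) => /= H1.
    set D := F _ _ - F x y in H1 *.
    have -> : D - c * (h +i* k)%C = (D / (h +i* k)%C - c) * (h +i* k)%C.
      by rewrite mulrBl divfK.
    rewrite cmodM; apply: ler_pM; rewrite ?cmod_ge0 // ltW //.
  split=> e e0; have [d d0 Hd] := H' e e0; exists d => // h k hd kd.
    have := Hd h k hd kd; apply: le_trans; apply: le_trans (Re_le_cmod _).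
    have [-> _] := key h k (F (upd x j (x j + h)) (upd y j (y j + k)) - F x y).
    by rewrite ReD ReN !upd_id.
  have := Hd h k hd kd; apply: le_trans; apply: le_trans (Im_le_cmod _).
  have [_ ->] := key h k (F (upd x j (x j + h)) (upd y j (y j + k)) - F x y).
  by rewrite ImD ImN !upd_id.
move=> e e0; case: H => H1 H2.
have e40 : 0 < e / 8 by rewrite divr_gt0.
have [d1 d10 {}H1] := H1 _ e40; have [d2 d20 {}H2] := H2 _ e40.
exists (Num.min d1 d2); first by rewrite lt_min d10.
move=> [h k] z0; rewrite lt_min => /andP[hd1 hd2] /=.
have hr := Re_le_cmod (h +i* k)%C; have hi := Im_le_cmod (h +i* k)%C; rewrite /= in hr hi.
have := H1 h k (le_lt_trans hr hd1) (le_lt_trans hi hd1).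
have := H2 h k (le_lt_trans hr hd2) (le_lt_trans hi hd2).
rewrite !upd_id; set D := F _ _ - F x y => P2 P1.
have m0 : 0 < cmod (h +i* k)%C by rewrite cmod_gt0.
have -> : D / (h +i* k)%C - c = (D - c * (h +i* k)%C) / (h +i* k)%C.
  by rewrite [RHS]mulrBl mulfK.
rewrite cmodM cmodV ltr_pdivrMr //.
apply: le_lt_trans (cmod_le _) _; have [-> ->] := key h k D.
rewrite /D !ReD !ImD !ReN !ImN.
set m := cmod _ in m0 hr hi *; have : e / 8 * (`|h| + `|k|) <= e / 8 * (2 * m) by rewrite ler_pM2l //; lra.
have : 0 < e * m by rewrite mulr_gt0.
move: P1 P2; lra.
Qed.

(* Both components of the derivative come from [derivative_formula]: the imaginary
   one is the real one for [-i F]. *)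
Lemma cderiv_formula F j x y c r : holomorphic_tube F -> octant y -> 0 < r -> r < y j ->
  cderiv F j x y c ->
  let W t := F (upd x j (x j + r * cos t)) (upd y j (y j + r * sin t)) in
  cint (fun t => complex.Re (W t) * cos t + complex.Im (W t) * sin t) = 2 * pi * r * complex.Re c /\
  cint (fun t => complex.Im (W t) * cos t - complex.Re (W t) * sin t) = 2 * pi * r * complex.Im c.
Proof.
move=> /holomorphic_tubeP[_ HF] oy r0 ry /cderivP HC W.
pose U s t := complex.Re (F (upd x j s) (upd y j t)).
pose V s t := complex.Im (F (upd x j s) (upd y j t)).
have hol s t : `|s - x j| < y j -> `|t - y j| < y j -> exists a b, CR U V s t a b.
  move=> _; rewrite ltr_norml => /andP[t0 _].
  have oy' : octant (upd y j t) by apply: octant_upd => //; lra.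
  have [c' /cderivP H] := HF (upd x j s) (upd y j t) oy' j.
  exists (complex.Re c'), (complex.Im c'); move: H; rewrite !updE.
  by rewrite /U /V; under eq_fun do under eq_fun do rewrite !upd_upd;
    under [X in CR _ X]eq_fun do under eq_fun do rewrite !upd_upd.
have hol' s t : `|s - x j| < y j -> `|t - y j| < y j -> exists a b, CR V (fun s t => - U s t) s t a b.
  move=> hs ht; have [a [b [H1 H2]]] := hol s t hs ht.
  by exists b, (- a); split; [rewrite opprK|have := TD_opp H1; rewrite opprK].
have HC' : CR V (fun s t => - U s t) (x j) (y j) (complex.Im c) (- complex.Re c).
  by case: HC => H1 H2; split; [rewrite opprK|have := TD_opp H1; rewrite opprK].
split; first exact: (derivative_formula hol r0 ry HC).
rewrite -(derivative_formula hol' r0 ry HC').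
by apply: eq_cint => t; rewrite mulNr.
Qed.

Lemma circle_octant j (y : vec) r t : octant y -> 0 < r -> r < y j -> octant (upd y j (y j + r * sin t)).
Proof.
move=> oy r0 ry; apply: octant_upd => //.
by have [_] := norm_circle r t; rewrite (gtr0_norm r0) ler_norml; lra.
Qed.

Lemma circle_continuous_tube G j x y r : cont_tube G -> octant y -> 0 < r -> r < y j ->
  continuous (fun t => complex.Re (G (upd x j (x j + r * cos t)) (upd y j (y j + r * sin t)))) /\
  continuous (fun t => complex.Im (G (upd x j (x j + r * cos t)) (upd y j (y j + r * sin t)))).
Proof.
move=> cG oy r0 ry.
have key t e : 0 < e -> exists2 d, 0 < d & forall s' t', `|s' - (x j + r * cos t)| < d ->
    `|t' - (y j + r * sin t)| < d ->
    cmod (G (upd x j s') (upd y j t') - G (upd x j (x j + r * cos t)) (upd y j (y j + r * sin t))) < e.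
  move=> e0; have ow := circle_octant t oy r0 ry.
  have [d d0 Hd] := cG (upd x j (x j + r * cos t)) _ ow e e0.
  exists (Num.min d (y j + r * sin t)); first by rewrite lt_min d0; have := ow j; rewrite updE.
  move=> s' t'; rewrite !lt_min => /andP[h1 _] /andP[h2 h3]; apply: Hd.
  - by apply: octant_upd => //; move: h3; rewrite ltr_norml; lra.
  - by apply: near_vec_upd => //; exact: near_vec_refl.
  - by apply: near_vec_upd => //; exact: near_vec_refl.
split.
  apply: (@circle_continuous R (fun s t => complex.Re (G (upd x j s) (upd y j t)))) => t e /(key t)[d d0 Hd].
  exists d => // s' t' h1 h2; rewrite -ReN -ReD; apply: le_lt_trans (Re_le_cmod _) _; exact: Hd.
apply: (@circle_continuous R (fun s t => complex.Im (G (upd x j s) (upd y j t)))) => t e /(key t)[d d0 Hd].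
exists d => // s' t' h1 h2; rewrite -ImN -ImD; apply: le_lt_trans (Im_le_cmod _) _; exact: Hd.
Qed.

(** The angles form a compact set, so joint continuity of G becomes uniform along the circle when
    the centre moves in all variables. *)
Lemma circle_equicontinuous G j x y r e : cont_tube G -> octant y -> 0 < r -> r < y j -> 0 < e ->
  exists2 d, 0 < d & forall t, 0 <= t <= 2 * pi -> forall x' y', octant y' ->
    near_vec d x x' -> near_vec d y y' ->
    cmod (G (upd x' j (x' j + r * cos t)) (upd y' j (y' j + r * sin t)) -
          G (upd x j (x j + r * cos t)) (upd y j (y j + r * sin t))) < e.
Proof.
move=> cG oy r0 ry e0.
(* The condition r < y'_j keeps the moved circle in the tube; it is recovered at the end from d <=
   y_j - r. *)
pose P d t := forall x' y', octant y' -> r < y' j -> near_vec d x x' -> near_vec d y y' ->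
    cmod (G (upd x' j (x' j + r * cos t)) (upd y' j (y' j + r * sin t)) -
          G (upd x j (x j + r * cos t)) (upd y j (y j + r * sin t))) < e.
have opos t (y' : vec) (oy' : octant y') := @circle_octant j y' r t oy' r0.
have [|d d0 Hd] := @segment_unif R P 0 (2 * pi).
  move=> t _.
  have [d d0 Hd] := cG (upd x j (x j + r * cos t)) _ (opos t y oy ry) (e / 2) ltac:(by rewrite divr_gt0).
  have d20 : 0 < d / 2 by rewrite divr_gt0.
  have [d1 d10 Hc] : exists2 d1, 0 < d1 & forall t', `|t' - t| < d1 ->
      `|r * cos t' - r * cos t| < d / 2 /\ `|r * sin t' - r * sin t| < d / 2.
    have e1 : 0 < d / 2 / r by rewrite divr_gt0.
    have /cvgrPdist_lt /(_ _ e1) /nbhs_ballP [a /= a0 Ha] := @continuous_cos R t.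
    have /cvgrPdist_lt /(_ _ e1) /nbhs_ballP [b /= b0 Hb] := @continuous_sin R t.
    exists (Num.min a b); first by rewrite lt_min a0.
    move=> t'; rewrite lt_min => /andP[h1 h2]; rewrite -!mulrBr !normrM (gtr0_norm r0).
    rewrite -!ltr_pdivlMl // !(mulrC r^-1) distrC (distrC (sin t')).
    by split; [apply: Ha|apply: Hb]; rewrite /ball /= distrC.
  exists (Num.min d1 (d / 2)); first by rewrite lt_min d10.
  move=> t' dd; rewrite !lt_min => /andP[h1 h2] dd0 /andP[dd1 dd2] x' y' oy' ry' hx hy.
  have [c1 c2] := Hc _ h1.
  have N1 (z z' : vec) (u u' : R) : near_vec dd z z' -> `|u' - u| < d / 2 ->
      near_vec d (upd z j (z j + u)) (upd z' j (z' j + u')).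
    move=> hz hu; apply: near_vec_upd; first by apply: near_vec_le hz; lra.
    have -> : z' j + u' - (z j + u) = (z' j - z j) + (u' - u) by ring.
    by apply: le_lt_trans (ler_normD _ _) _; have := hz j; lra.
  have B1 := Hd _ _ (opos t' y' oy' ry') (N1 _ _ _ _ hx c1) (N1 _ _ _ _ hy c2).
  have B2 := Hd _ _ (opos t' y oy ry) (N1 _ _ _ _ (near_vec_refl x dd0) c1) (N1 _ _ _ _ (near_vec_refl y dd0) c2).
  rewrite -[X in cmod X](subrKA (G (upd x j (x j + r * cos t)) (upd y j (y j + r * sin t)))).
  apply: le_lt_trans (cmodD _ _) _; rewrite [X in _ + X]cmodBC; lra.
exists (Num.min d (y j - r)); first by rewrite lt_min d0 subr_gt0.
move=> t t2 x' y' oy' hx hy; apply: Hd => //.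
- by have := hy j; rewrite lt_min ltr_norml => /andP[_]; rewrite ltr_norml; lra.
- by apply: near_vec_le hx; rewrite ge_min lexx.
- by apply: near_vec_le hy; rewrite ge_min lexx.
Qed.

Lemma holomorphic_tube_deriv_ex F j : holomorphic_tube F ->
  exists F' : fct, forall x y, octant y -> cderiv F j x y (F' x y).
Proof.
move=> /holomorphic_tubeP[_ HF].
have H (p : vec * vec) : exists c, octant p.2 -> cderiv F j p.1 p.2 c.
  by have [oy|noy] := pselect (octant p.2); [have [c Hc] := HF p.1 p.2 oy j; exists c|exists 0].
by have [F' HF'] := choice H; exists (fun x y => F' (x, y)) => x y oy; exact: (HF' (x, y)).
Qed.

(** Cauchy's formula on circles of the fixed radius y_j / 2 writes F' through values of F, and these
    are equicontinuous along the circle. *)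
Lemma cont_tube_deriv F F' j : holomorphic_tube F ->
  (forall x y, octant y -> cderiv F j x y (F' x y)) -> cont_tube F'.
Proof.
move=> HF HF' x y oy e e0.
have [cF _] := (holomorphic_tubeP F).1 HF.
pose r := y j / 2; have yj := oy j.
have r0 : 0 < r by rewrite divr_gt0.
have ry : r < y j by rewrite /r; lra.
have e1 : 0 < r * e / 8 by rewrite divr_gt0 // mulr_gt0.
have [d d0 Hd] := circle_equicontinuous x cF oy r0 ry e1.
exists (Num.min d (y j - r)); first by rewrite lt_min d0 subr_gt0.
move=> x' y' oy' hx hy.
have ry' : r < y' j by have := hy j; rewrite lt_min => /andP[_]; rewrite ltr_norml; lra.
have {}hx : near_vec d x x' by apply: near_vec_le hx; rewrite ge_min lexx.
have {}hy : near_vec d y y' by apply: near_vec_le hy; rewrite ge_min lexx.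
have [E1 E2] := cderiv_formula HF oy r0 ry (HF' x y oy).
have [E1' E2'] := cderiv_formula HF oy' r0 ry' (HF' x' y' oy').
pose W (z w : vec) t := F (upd z j (z j + r * cos t)) (upd w j (w j + r * sin t)).
have cR z w ow rw := @circle_continuous_tube F j z w r cF ow r0 rw.
have cmul (f g : R -> R) : continuous f -> continuous g -> continuous (fun t => f t * g t).
  by move=> cf cg t; apply: cvgM; [exact: cf|exact: cg].
have cadd (f g : R -> R) : continuous f -> continuous g -> continuous (fun t => f t + g t).
  by move=> cf cg t; apply: cvgD; [exact: cf|exact: cg].
have csub (f g : R -> R) : continuous f -> continuous g -> continuous (fun t => f t - g t).
  by move=> cf cg t; apply: cvgB; [exact: cf|exact: cg].
have ccos : continuous (fun t : R => cos t) := @continuous_cos R.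
have csin : continuous (fun t : R => sin t) := @continuous_sin R.
have [c1 c2] := cR x y oy ry; have [c1' c2'] := cR x' y' oy' ry'.
have bnd (p q t : R) : `|p| <= r * e / 8 -> `|q| <= r * e / 8 -> `|p * cos t + q * sin t| <= r * e / 4.
  move=> hp hq; apply: le_trans (ler_normD _ _) _.
  have : `|p * cos t| <= r * e / 8.
    rewrite normrM -[leRHS]mulr1; apply: ler_pM => //.
    by rewrite ler_norml cos_geN1 cos_le1.
  have : `|q * sin t| <= r * e / 8.
    rewrite normrM -[leRHS]mulr1; apply: ler_pM => //.
    by rewrite ler_norml sin_geN1 sin_le1.
  lra.
have WW t : 0 <= t <= 2 * pi -> cmod (W x' y' t - W x y t) < r * e / 8.
  by move=> t2; exact: Hd.
have RW t : 0 <= t <= 2 * pi -> `|complex.Re (W x' y' t) - complex.Re (W x y t)| <= r * e / 8.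
  by move=> t2; rewrite -ReN -ReD; apply: le_trans (Re_le_cmod _) _; exact/ltW/WW.
have IW t : 0 <= t <= 2 * pi -> `|complex.Im (W x' y' t) - complex.Im (W x y t)| <= r * e / 8.
  by move=> t2; rewrite -ImN -ImD; apply: le_trans (Im_le_cmod _) _; exact/ltW/WW.
have p0 : 0 < 2 * (pi : R) by rewrite mulr_gt0 // pi_gt0.
have fin (p p' I I' : R) : I = 2 * pi * r * p -> I' = 2 * pi * r * p' -> `|I' - I| <= 2 * pi * (r * e / 4) ->
    `|p' - p| <= e / 4.
  move=> -> ->; rewrite -mulrBr -(mulrA (2 * pi)) normrM (gtr0_norm p0) ler_pM2l //.
  by rewrite normrM (gtr0_norm r0) -mulrA ler_pM2l.
have D1 : `|complex.Re (F' x' y') - complex.Re (F' x y)| <= e / 4.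
  apply: (fin _ _ _ _ E1 E1').
  rewrite -/(W x y) -/(W x' y') -cintB; last 2 first.
    by apply: (cadd); apply: (cmul).
    by apply: (cadd); apply: (cmul).
  apply: cint_norm_le => [|t t2]; first by apply: (csub); apply: (cadd); apply: (cmul).
  by rewrite opprD addrACA -!mulrBl; apply: bnd; [exact: RW|exact: IW].
have D2 : `|complex.Im (F' x' y') - complex.Im (F' x y)| <= e / 4.
  apply: (fin _ _ _ _ E2 E2').
  rewrite -/(W x y) -/(W x' y') -cintB; last 2 first.
    by apply: (csub); apply: (cmul).
    by apply: (csub); apply: (cmul).
  apply: cint_norm_le => [|t t2]; first by apply: (csub); apply: (csub); apply: (cmul).
  rewrite opprD addrACA -mulrBl -opprD -mulrBl -mulNr; apply: bnd; first exact: IW.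
  by rewrite normrN; exact: RW.
apply: le_lt_trans (cmod_le _) _; rewrite ReD ImD ReN ImN; lra.
Qed.

Lemma cderiv_shift F j k x y (p q : R) c :
  cderiv F k (upd x j (x j + p)) (upd y j (y j + q)) c ->
  cderiv (fun x y => F (upd x j (x j + p)) (upd y j (y j + q))) k x y c.
Proof.
move=> H e /H[d d0 Hd]; exists d => // h h0 hd; have := Hd h h0 hd.
have E (z : vec) (u v : R) : upd (upd z j (z j + u)) k (upd z j (z j + u) k + v) =
    upd (upd z k (z k + v)) j (upd z k (z k + v) j + u).
  have [<-|jk] := eqVneq j k; first by rewrite !upd_upd !updE addrAC.
  rewrite updC //; congr (upd (upd _ _ _) _ _); rewrite /upd.
    by rewrite eq_sym (negbTE jk).
  by rewrite (negbTE jk).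
by rewrite !E.
Qed.

Lemma near_upd d x k s : 0 < d -> `|s - x k| < d -> near_vec d x (upd x k s).
Proof. by move=> d0 hs i; rewrite /upd; case: eqP => [->//|_]; rewrite subrr normr0. Qed.

(** Cauchy's formula in the variable [j] is differentiated in the variable [k] under the integral.
    The required uniformity comes from the continuity of the k-th derivative, just proved; the case
    j = k is included because only the centre of the circle moves. *)
Lemma cderiv_deriv F F' j k : holomorphic_tube F ->
  (forall x y, octant y -> cderiv F j x y (F' x y)) ->
  forall x y, octant y -> exists c, cderiv F' k x y c.
Proof.
move=> HF HF' x y oy.
have [cF _] := (holomorphic_tubeP F).1 HF.
have [Fk HFk] := holomorphic_tube_deriv_ex k HF.
have cFk := cont_tube_deriv HF HFk.
pose r := y j / 2; have yj := oy j; have yk := oy k.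
have r0 : 0 < r by rewrite divr_gt0.
have ry : r < y j by rewrite /r; lra.
pose sh (G : fct) (z w : vec) t := G (upd z j (z j + r * cos t)) (upd w j (w j + r * sin t)).
pose xs s := upd x k s; pose ys s := upd y k s.
(* y_k keeps the point in the octant; y_j - r matters when k = j and keeps the circle of radius r in
   the tube. *)
pose rho := Num.min (y j - r) (y k).
have rho0 : 0 < rho by rewrite lt_min subr_gt0 ry.
have oys s : `|s - y k| < rho -> octant (ys s) /\ r < ys s j.
  rewrite lt_min => /andP[h1 h2]; split.
    by apply: octant_upd => //; move: h2; rewrite ltr_norml; lra.
  rewrite /ys /upd; case: eqP => [E|//].
  by move: h1; rewrite -E ltr_norml; lra.
have cmul (f g : R -> R) : continuous f -> continuous g -> continuous (fun t => f t * g t).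
  by move=> cf cg t; apply: cvgM; [exact: cf|exact: cg].
have cadd (f g : R -> R) : continuous f -> continuous g -> continuous (fun t => f t + g t).
  by move=> cf cg t; apply: cvgD; [exact: cf|exact: cg].
have csub (f g : R -> R) : continuous f -> continuous g -> continuous (fun t => f t - g t).
  by move=> cf cg t; apply: cvgB; [exact: cf|exact: cg].
have ccos : continuous (fun t : R => cos t) := @continuous_cos R.
have csin : continuous (fun t : R => sin t) := @continuous_sin R.
(* [A] and [B] are the real and imaginary parts of G e^(-it) on the circle, so they inherit the
   Cauchy-Riemann equations from G. *)
pose A G (z w : vec) t := complex.Re (sh G z w t) * cos t + complex.Im (sh G z w t) * sin t.
pose B G (z w : vec) t := complex.Im (sh G z w t) * cos t - complex.Re (sh G z w t) * sin t.
have cA G z w : cont_tube G -> octant w -> r < w j -> continuous (A G z w).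
  move=> cG ow rw; have [c1 c2] := @circle_continuous_tube G j z w r cG ow r0 rw.
  by apply: (cadd); apply: (cmul).
have cB G z w : cont_tube G -> octant w -> r < w j -> continuous (B G z w).
  move=> cG ow rw; have [c1 c2] := @circle_continuous_tube G j z w r cG ow r0 rw.
  by apply: (csub); apply: (cmul).
have CRW t s u : `|u - y k| < rho ->
    CR (fun s u => complex.Re (sh F (xs s) (ys u) t)) (fun s u => complex.Im (sh F (xs s) (ys u) t))
      s u (complex.Re (sh Fk (xs s) (ys u) t)) (complex.Im (sh Fk (xs s) (ys u) t)).
  move=> hu; have [ow rw] := oys u hu.
  have := cderiv_shift (HFk (upd (xs s) j (xs s j + r * cos t)) _ (circle_octant t ow r0 rw)).
  move/cderivP; rewrite /xs /ys !updE.
  by under eq_fun do under eq_fun do rewrite !upd_upd;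
    under [X in CR _ X]eq_fun do under eq_fun do rewrite !upd_upd.
have TA t s u : `|u - y k| < rho -> TD (fun s u => A F (xs s) (ys u) t) s u
    (A Fk (xs s) (ys u) t) (- B Fk (xs s) (ys u) t).
  move=> /(CRW t s)[H1 H2].
  apply: TD_eq; first apply: TD_ext_near ltr01 _ (TD_add (TD_scale (cos t) H1) (TD_scale (sin t) H2)).
  - by move=> *; rewrite /A; ring.
  - by rewrite /A; ring.
  - by rewrite /B; ring.
have TB t s u : `|u - y k| < rho -> TD (fun s u => B F (xs s) (ys u) t) s u
    (B Fk (xs s) (ys u) t) (A Fk (xs s) (ys u) t).
  move=> /(CRW t s)[H1 H2].
  apply: TD_eq; first apply: TD_ext_near ltr01 _ (TD_add (TD_scale (cos t) H2) (TD_scale (- sin t) H1)).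
  - by move=> *; rewrite /B; ring.
  - by rewrite /B; ring.
  - by rewrite /A; ring.
have equi e : 0 < e -> exists2 d, 0 < d & d <= rho /\ forall t s u, 0 <= t <= 2 * pi ->
    `|s - x k| < d -> `|u - y k| < d ->
    `|A Fk (xs s) (ys u) t - A Fk (xs (x k)) (ys (y k)) t| <= e /\
    `|B Fk (xs s) (ys u) t - B Fk (xs (x k)) (ys (y k)) t| <= e.
  move=> e0; have [d d0 Hd] := circle_equicontinuous x cFk oy r0 ry (divr_gt0 e0 (ltr0n R 2)).
  exists (Num.min d rho); first by rewrite lt_min d0.
  split; first by rewrite ge_min lexx orbT.
  have md : Num.min d rho <= d by rewrite ge_min lexx.
  have mr : Num.min d rho <= rho by rewrite ge_min lexx orbT.
  move=> t s u t2 /lt_le_trans/(_ md) s1 hu.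
  have u1 := lt_le_trans hu md; have u2 := lt_le_trans hu mr.
  have [ow rw] := oys u u2.
  have := Hd t t2 (xs s) (ys u) ow (near_upd d0 s1) (near_upd d0 u1).
  rewrite -/(sh Fk x y t) -/(sh Fk (xs s) (ys u) t) /xs /ys !upd_id -/(xs s) -/(ys u) => H.
  have := Re_le_cmod (sh Fk (xs s) (ys u) t - sh Fk x y t).
  have := Im_le_cmod (sh Fk (xs s) (ys u) t - sh Fk x y t).
  rewrite ReD ImD ReN ImN => h1 h2.
  have ct : `|cos t| <= 1 by rewrite ler_norml cos_geN1 cos_le1.
  have st : `|sin t| <= 1 by rewrite ler_norml sin_geN1 sin_le1.
  have bnd (p q a b : R) : `|p| < e / 2 -> `|q| < e / 2 -> `|a| <= 1 -> `|b| <= 1 -> `|p * a + q * b| <= e.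
    move=> hp hq ha hb; apply: le_trans (ler_normD _ _) _; rewrite !normrM.
    have : `|p| * `|a| <= e / 2 by rewrite -[leRHS]mulr1; apply: ler_pM => //; exact: ltW.
    have : `|q| * `|b| <= e / 2 by rewrite -[leRHS]mulr1; apply: ler_pM => //; exact: ltW.
    lra.
  split; rewrite /A /B.
    by rewrite opprD addrACA -!mulrBl; apply: bnd => //; apply: le_lt_trans H.
  rewrite opprD addrACA -mulrBl -opprD -mulrBl -mulNr.
  by apply: bnd => //; rewrite ?normrN; apply: le_lt_trans H.
have p20 : 0 < 2 * (pi : R) by rewrite mulr_gt0 // pi_gt0.
have xk0 : `|y k - y k| < rho by rewrite subrr normr0.
have [oyk ryk] := oys _ xk0.
have TDA : TD (fun s u => cint (A F (xs s) (ys u))) (x k) (y k)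
   (cint (A Fk (xs (x k)) (ys (y k)))) (cint (fun t => - B Fk (xs (x k)) (ys (y k)) t)).
  apply: (@TD_rint R 0 (2 * pi) (fun s u => A F (xs s) (ys u)) _ _ _ _ rho) => //.
  - by move=> s u _ hu; have [ow rw] := oys u hu; exact: cA.
  - exact: cA.
  - by move=> t; apply: cvgN; exact: cB.
  - move=> e /equi[d d0 [drho Hd]]; exists d => // t h l t2.
    apply: (@TD_unif R (fun s u => A F (xs s) (ys u) t) (fun s u => A Fk (xs s) (ys u) t)
      (fun s u => - B Fk (xs s) (ys u) t) (x k) (y k) d e) => s u hs hu.
    have [H1 H2] := Hd t s u t2 hs hu; split; first by apply: TA; exact: lt_le_trans hu drho.
    by split => //; rewrite -opprD normrN.
have TDB : TD (fun s u => cint (B F (xs s) (ys u))) (x k) (y k)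
   (cint (B Fk (xs (x k)) (ys (y k)))) (cint (A Fk (xs (x k)) (ys (y k)))).
  apply: (@TD_rint R 0 (2 * pi) (fun s u => B F (xs s) (ys u)) _ _ _ _ rho) => //.
  - by move=> s u _ hu; have [ow rw] := oys u hu; exact: cB.
  - exact: cB.
  - exact: cA.
  - move=> e /equi[d d0 [drho Hd]]; exists d => // t h l t2.
    apply: (@TD_unif R (fun s u => B F (xs s) (ys u) t) (fun s u => B Fk (xs s) (ys u) t)
      (fun s u => A Fk (xs s) (ys u) t) (x k) (y k) d e) => s u hs hu.
    have [H1 H2] := Hd t s u t2 hs hu; split; first by apply: TB; exact: lt_le_trans hu drho.
    by split.
have cN : cint (fun t => - B Fk (xs (x k)) (ys (y k)) t) = - cint (B Fk (xs (x k)) (ys (y k))).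
  rewrite -mulN1r -cintZ; last exact: cB.
  by apply: eq_cint => t; rewrite mulN1r.
rewrite cN in TDA.
pose K : R := 2 * pi * r; have K0 : K != 0 by rewrite !mulf_neq0 // gt_eqF // pi_gt0.
exists ((K^-1 * cint (A Fk (xs (x k)) (ys (y k)))) +i* (K^-1 * cint (B Fk (xs (x k)) (ys (y k)))))%C.
apply/cderivP => /=; split.
  rewrite -mulrN; apply: (@TD_ext_near R _ _ _ _ _ _ rho rho0 _ (TD_scale K^-1 TDA)) => s u _ hu.
  have [ow rw] := oys u hu.
  have [E _] := cderiv_formula HF ow r0 rw (HF' (xs s) _ ow).
  by rewrite /A /sh E mulKf.
apply: (@TD_ext_near R _ _ _ _ _ _ rho rho0 _ (TD_scale K^-1 TDB)) => s u _ hu.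
have [ow rw] := oys u hu.
have [_ E] := cderiv_formula HF ow r0 rw (HF' (xs s) _ ow).
by rewrite /B /sh E mulKf.
Qed.

Theorem holomorphic_tube_deriv F F' j : holomorphic_tube F ->
  (forall x y, octant y -> cderiv F j x y (F' x y)) -> holomorphic_tube F'.
Proof.
move=> HF HF'; apply/holomorphic_tubeP; split; first exact: cont_tube_deriv HF HF'.
by move=> x y oy k; exact: cderiv_deriv HF HF' x y oy.
Qed.

End Tube.

(** * Products and reciprocals of Cauchy-Riemann pairs; continuity of real powers *)

Section CR_algebra.
Context {R : realType}.
Implicit Types (x y a b c d e : R) (U V : R -> R -> R).

Lemma CR_mul U V U' V' x y a b a' b' : CR U V x y a b -> CR U' V' x y a' b' ->
  CR (fun s t => U s t * U' s t - V s t * V' s t) (fun s t => U s t * V' s t + V s t * U' s t) x y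
    (a * U' x y - b * V' x y + U x y * a' - V x y * b')
    (a * V' x y + b * U' x y + U x y * b' + V x y * a').
Proof.
move=> [H1 H2] [H3 H4]; split.
  by apply: TD_eq (TD_add (TD_mul H1 H3) (TD_opp (TD_mul H2 H4))) _ _; ring.
by apply: TD_eq (TD_add (TD_mul H1 H4) (TD_mul H2 H3)) _ _; ring.
Qed.

Lemma CR_inv U V x y a b : U x y ^+ 2 + V x y ^+ 2 != 0 -> CR U V x y a b ->
  exists c d, CR (fun s t => U s t / (U s t ^+ 2 + V s t ^+ 2))
    (fun s t => - V s t / (U s t ^+ 2 + V s t ^+ 2)) x y c d.
Proof.
move=> S0 [H1 H2]; have HS := @TD_inv R (fun s t => U s t ^+ 2 + V s t ^+ 2) x y _ _ S0
  (TD_add (TD_sqr H1) (TD_sqr H2)).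
have HA := TD_mul H1 HS; have HB := TD_mul (TD_opp H2) HS.
exists (a * (U x y ^+ 2 + V x y ^+ 2)^-1 + U x y *
  (- (2 * U x y * a + 2 * V x y * b) / (U x y ^+ 2 + V x y ^+ 2) ^+ 2)),
 (- b * (U x y ^+ 2 + V x y ^+ 2)^-1 + - V x y *
  (- (2 * U x y * a + 2 * V x y * b) / (U x y ^+ 2 + V x y ^+ 2) ^+ 2)).
by split; [apply: TD_eq HA _ _|apply: TD_eq HB _ _]; field.
Qed.

Lemma CR_id x y c d : CR (fun s _ => s - c) (fun _ t => t - d) x y 1 0.
Proof.
split.
  apply: TD_eq; first exact: (TD_add (TD_fst x y) (TD_cst (- c) x y)).
    by rewrite addr0.
  by rewrite addr0 oppr0.
apply: TD_eq; first exact: (TD_add (TD_snd x y) (TD_cst (- d) x y)).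
  by rewrite addr0.
by rewrite addr0.
Qed.

Lemma seg_of_norm c (p r : R) : `|p| < r -> c - r <= c + p <= c + r.
Proof. by rewrite ltr_norml => H; lra. Qed.

(** At a = 0 the power may fail to be differentiable; there the threshold e^(1/q) is explicit. For a
    > 0 continuity follows from differentiability. *)
Lemma powR_cont (q a e : R) : 0 < q -> 0 <= a -> 0 < e -> exists2 d, 0 < d &
  forall b, 0 <= b -> `|b - a| < d -> `|b `^ q - a `^ q| < e.
Proof.
move=> q0; rewrite le_eqVlt => /orP[/eqP <-|a0] e0.
  exists (e `^ q^-1); first exact: powR_gt0.
  move=> b b0; rewrite subr0 powR0 ?gt_eqF // subr0 !ger0_norm ?powR_ge0 // => be.
  have := @gt0_ltr_powR R q q0 b (e `^ q^-1); rewrite !nnegrE b0 powR_ge0 => /(_ isT isT be).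
  by rewrite -powRrM mulVf ?gt_eqF // powRr1 // ltW.
have /cvgrPdist_lt/(_ _ e0)/nbhs_ballP[d /= d0 Hd] : {for a, continuous (fun b : R => b `^ q)}.
  apply/differentiable_continuous/derivable1_diffP/derivable_powR.
  by rewrite in_itv /= a0.
by exists d => // b b0 bd; rewrite distrC; apply: Hd; rewrite /ball /= distrC.
Qed.

End CR_algebra.

(** * Powers of the modulus have the sub-mean value property *)

Section One_variable.
Context {R : realType}.
Implicit Types (x y c d e h k l r s t : R).
Variables (U V a b : R -> R -> R) (q : R).
Hypothesis q0 : 0 < q.
Hypothesis CUV : forall x y, 0 < y -> CR U V x y (a x y) (b x y).
Hypothesis Cab : forall x y, 0 < y -> exists c d, CR a b x y c d.

(** With f = U + iV and f' = a + ib, [S] is |f|^2 and [u] is |f|^q. *)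
Let S x y := U x y ^+ 2 + V x y ^+ 2.
Let u x y := Num.sqrt (S x y) `^ q.

Let S_ge0 x y : 0 <= S x y. Proof. by rewrite addr_ge0 ?sqr_ge0. Qed.

Let TDS x y : 0 < y -> TD S x y (2 * U x y * a x y + 2 * V x y * b x y)
  (2 * U x y * - b x y + 2 * V x y * a x y).
Proof. by move=> y0; have [H1 H2] := CUV x y0; exact: (TD_add (TD_sqr H1) (TD_sqr H2)). Qed.

Lemma cont2_powR x y : 0 < y -> cont2 u x y.
Proof.
move=> y0 e e0.
have [d d0 Hd] := powR_cont q0 (sqrtr_ge0 (S x y)) e0.
have /cvgrPdist_lt/(_ _ d0)/nbhs_ballP[d1 /= d10 Hd1] := @sqrt_continuous R (S x y).
have [d2 d20 Hd2] := TD_cont (TDS x y0) d10.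
exists d2 => // x' y' hx hy; rewrite /u; apply: Hd; rewrite ?sqrtr_ge0 // distrC.
by apply: Hd1; rewrite /ball /= distrC; exact: Hd2.
Qed.

(** No branch of the logarithm is needed. The radial derivative of the circle mean of ln |f|^2,
    multiplied by the radius, is twice the circle integral of Re((z - z0) f'/f). This is the real
    part of a holomorphic function vanishing at z0, so the integral is 0 by the mean value
    property. *)
Lemma ln_mean_value x0 y0 : 0 < y0 -> S x0 y0 != 0 -> exists rho, [/\ 0 < rho, rho <= y0,
  (forall x y, `|x - x0| < rho -> `|y - y0| < rho -> 0 < S x y) &
  forall r, 0 < r -> r < rho ->
    cint (fun t => ln (S (x0 + r * cos t) (y0 + r * sin t))) = 2 * pi * ln (S x0 y0)].
Proof.
move=> y00 S0; have Sp : 0 < S x0 y0 by rewrite lt_def S0 S_ge0.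
have [d d0 Hd] := TD_cont (TDS x0 y00) Sp.
pose r0 := Num.min d y0; have r00 : 0 < r0 by rewrite lt_min d0.
have r0d : r0 <= d by rewrite ge_min lexx.
have r0y : r0 <= y0 by rewrite ge_min lexx orbT.
have ypos y : `|y - y0| < r0 -> 0 < y by rewrite ltr_norml; lra.
have Spos x y : `|x - x0| < r0 -> `|y - y0| < r0 -> 0 < S x y.
  move=> hx hy; have := Hd x y (lt_le_trans hx r0d) (lt_le_trans hy r0d).
  by rewrite ltr_norml; lra.
(* g1 - i g2 is f'/f, the gradient of ln S is (2 g1, 2 g2), and K is the real part of (z - z0)
   f'/f. *)
pose g1 x y := (U x y * a x y + V x y * b x y) / S x y.
pose g2 x y := (V x y * a x y - U x y * b x y) / S x y.
pose K x y := (x - x0) * g1 x y + (y - y0) * g2 x y.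
have CG x y : `|x - x0| < r0 -> `|y - y0| < r0 ->
    exists c d, CR g1 (fun x y => - g2 x y) x y c d.
  move=> hx hy; have [c1 [d1 H1]] := Cab x (ypos _ hy).
  have Sn : U x y ^+ 2 + V x y ^+ 2 != 0 by rewrite gt_eqF // Spos.
  have [c2 [d2 H2]] := CR_inv Sn (CUV x (ypos _ hy)).
  have [H3 H4] := CR_mul H1 H2.
  eexists; eexists; split; [apply: TD_ext_near ltr01 _ H3|apply: TD_ext_near ltr01 _ H4] => x' y' _ _.
    by rewrite /g1 /S; ring.
  by rewrite /g2 /S; ring.
have CK x y : `|x - x0| < r0 -> `|y - y0| < r0 ->
    exists c d, CR K (fun x y => (y - y0) * g1 x y - (x - x0) * g2 x y) x y c d.
  move=> hx hy; have [c1 [d1 H1]] := CG x y hx hy.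
  have [H3 H4] := CR_mul (CR_id x y x0 y0) H1.
  eexists; eexists; split; [apply: TD_ext_near ltr01 _ H3|apply: TD_ext_near ltr01 _ H4] => x' y' _ _.
    by rewrite /K; ring.
  by ring.
have TL x y : `|x - x0| < r0 -> `|y - y0| < r0 ->
    TD (fun x y => ln (S x y)) x y (2 * g1 x y) (2 * g2 x y).
  move=> hx hy; have Sxy := Spos x y hx hy.
  apply: TD_eq (TD_comp (is_derive1_ln Sxy) (TDS x (ypos _ hy))) _ _.
    by rewrite /g1; field; rewrite gt_eqF.
  by rewrite /g2; field; rewrite gt_eqF.
have cg1 x y : `|x - x0| < r0 -> `|y - y0| < r0 -> cont2 g1 x y.
  by move=> hx hy; have [c [d' [H _]]] := CG x y hx hy; exact: TD_cont H.
have cg2 x y : `|x - x0| < r0 -> `|y - y0| < r0 -> cont2 g2 x y.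
  move=> hx hy; have [c [d' [_ /TD_opp H]]] := CG x y hx hy.
  by apply: (TD_cont (a := - d') (b := - c)); apply: TD_ext_near ltr01 _ H => x' y' _ _; rewrite opprK.
pose rho := r0 / 2; have rho0 : 0 < rho by rewrite divr_gt0.
have inb c z : c - rho <= z <= c + rho -> `|z - c| < r0.
  by move=> hz; rewrite ltr_norml; apply/andP; move: hz; rewrite /rho; lra.
have [M1 M10 HM1] := @bounded2 R g1 (x0 - rho) (x0 + rho) (y0 - rho) (y0 + rho)
  (fun x y hx hy => cg1 x y (inb _ _ hx) (inb _ _ hy)).
have [M2 M20 HM2] := @bounded2 R g2 (x0 - rho) (x0 + rho) (y0 - rho) (y0 + rho)
  (fun x y hx hy => cg2 x y (inb _ _ hx) (inb _ _ hy)).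
have circ_in s t : `|s| < rho -> (x0 - rho <= x0 + s * cos t <= x0 + rho) /\
    (y0 - rho <= y0 + s * sin t <= y0 + rho).
  move=> hs; have [h1 h2] := norm_circle s t.
  by split; apply: seg_of_norm; [exact: le_lt_trans h1 hs|exact: le_lt_trans h2 hs].
have circ_in' s t : `|s| < rho -> `|x0 + s * cos t - x0| < r0 /\ `|y0 + s * sin t - y0| < r0.
  by move=> /(circ_in s t)[h1 h2]; split; exact: inb.
exists rho; split => //.
- by rewrite /rho; lra.
- have rr0 : rho < r0 by rewrite /rho; lra.
  by move=> x y hx hy; apply: Spos; exact: lt_trans rr0.
move=> r rp rr.
transitivity (cint (fun t => ln (S (x0 + 0 * cos t) (y0 + 0 * sin t)))); last first.
  by rewrite -cint_cst; apply: eq_cint => t; rewrite !mul0r !addr0.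
apply: (@const_of_derive0 R (fun r => cint (fun t => ln (S (x0 + r * cos t) (y0 + r * sin t))))
  (fun s => cint (fun t => 2 * g1 (x0 + s * cos t) (y0 + s * sin t) * cos t +
    2 * g2 (x0 + s * cos t) (y0 + s * sin t) * sin t)) rho) => //.
  move=> s hs; apply: (@is_derive_cint R (fun s t => ln (S (x0 + s * cos t) (y0 + s * sin t)))
    (fun s t => 2 * g1 (x0 + s * cos t) (y0 + s * sin t) * cos t +
    2 * g2 (x0 + s * cos t) (y0 + s * sin t) * sin t) s (rho - `|s|) (2 * M1 + 2 * M2)).
  - by rewrite subr_gt0.
  - move=> s' ss; have hs' : `|s'| < rho.
      by rewrite -(subrK s s'); apply: le_lt_trans (ler_normD _ _) _; lra.
    apply: (@circle_continuous R (fun x y => ln (S x y))) => t; have [h1 h2] := circ_in' s' t hs'.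
    exact: TD_cont (TL _ _ h1 h2).
  - move=> s' t ss; have hs' : `|s'| < rho.
      by rewrite -(subrK s s'); apply: le_lt_trans (ler_normD _ _) _; lra.
    have [h1 h2] := circ_in' s' t hs'.
    exact: (@is_derive_radius R (fun x y => ln (S x y)) _ _ _ _ _ _ (TL _ _ h1 h2)).
  - move=> s' t ss; have hs' : `|s'| < rho.
      by rewrite -(subrK s s'); apply: le_lt_trans (ler_normD _ _) _; lra.
    have [h1 h2] := circ_in s' t hs'.
    apply: le_trans (ler_normD _ _) _.
    have ct : `|cos t| <= 1 by rewrite ler_norml cos_geN1 cos_le1.
    have st : `|sin t| <= 1 by rewrite ler_norml sin_geN1 sin_le1.
    have b1 := HM1 _ _ h1 h2; have b2 := HM2 _ _ h1 h2.
    have tri (p p' M : R) : `|p| <= M -> `|p'| <= 1 -> `|2 * p * p'| <= 2 * M.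
      move=> hp hp'; rewrite !normrM (ger0_norm (ler0n R 2)) -mulrA ler_pM2l // -[leRHS]mulr1; exact: ler_pM.
    by apply: lerD; exact: tri.
move=> s s0 sr; have hs : `|s| < rho by rewrite gtr0_norm.
have cK x y : `|x - x0| < r0 -> `|y - y0| < r0 -> cont2 K x y.
  by move=> hx hy; have [c [d' [H _]]] := CK x y hx hy; exact: TD_cont H.
have := @mean_value R K _ x0 y0 r0 CK s s0 ltac:(rewrite /rho in sr; lra).
rewrite {2}/K !subrr !mul0r addr0 mulr0 => E0.
apply: (mulfI (x := s)); first by rewrite gt_eqF.
rewrite mulr0 -[RHS](mulr0 2) -E0 -cintZ; last first.
  move=> t; apply: cvgD; apply: cvgM.
  - apply: cvgM; first exact: cvg_cst.
    by apply: (@circle_continuous R g1) => t'; have [h1 h2] := circ_in' s t' hs; exact: cg1.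
  - exact: continuous_cos.
  - apply: cvgM; first exact: cvg_cst.
    by apply: (@circle_continuous R g2) => t'; have [h1 h2] := circ_in' s t' hs; exact: cg2.
  - exact: continuous_sin.
rewrite -cintZ; last first.
  by apply: (@circle_continuous R K) => t'; have [h1 h2] := circ_in' s t' hs; exact: cK.
by apply: eq_cint => t; rewrite /K; ring.
Qed.

(* [exp] is above its tangent and [ln |f|] has the mean value property off the zeros of [f]. *)
Lemma powR_sub_mean_value x0 y0 : 0 < y0 -> 0 < u x0 y0 -> exists2 rho, 0 < rho &
  forall r, 0 < r -> r < rho -> 2 * pi * u x0 y0 <= cint (fun t => u (x0 + r * cos t) (y0 + r * sin t)).
Proof.
move=> y00 u0.
have S0 : S x0 y0 != 0.
  by apply: contraTneq u0 => H; rewrite /u H sqrtr0 powR0 ?ltxx // gt_eqF.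
have [rho [rho0 rhoy Spos Hm]] := ln_mean_value y00 S0.
have uE x y : 0 < S x y -> u x y = expR (q / 2 * ln (S x y)).
  move=> Sxy; rewrite /u -powR12_sqrt ?ltW // -powRrM /powR gt_eqF //.
  by rewrite (mulrC 2^-1).
exists rho => // r r0 rr; have hr : `|r| < rho by rewrite gtr0_norm.
have circ_in t : `|x0 + r * cos t - x0| < rho /\ `|y0 + r * sin t - y0| < rho.
  have [h1 h2] := norm_circle r t.
  by rewrite !(addrC _ (r * _)) !addrK; split; apply: le_lt_trans hr.
have cL : continuous (fun t => ln (S (x0 + r * cos t) (y0 + r * sin t))).
  apply: (@circle_continuous R (fun x y => ln (S x y))) => t; have [h1 h2] := circ_in t.
  have yp : 0 < y0 + r * sin t by move: h2; rewrite ltr_norml; lra.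
  exact: TD_cont (TD_comp (is_derive1_ln (Spos _ _ h1 h2)) (TDS _ yp)).
have cu : continuous (fun t => u (x0 + r * cos t) (y0 + r * sin t)).
  apply: (@circle_continuous R u) => t; have [h1 h2] := circ_in t; apply: cont2_powR.
  by move: h2; rewrite ltr_norml; lra.
have x00 : `|x0 - x0| < rho by rewrite subrr normr0.
have y000 : `|y0 - y0| < rho by rewrite subrr normr0.
have S00 := Spos _ _ x00 y000.
(* A + B l is the tangent to l -> exp(q l / 2) at l = ln S(x0, y0). *)
pose A := u x0 y0 * (1 - q / 2 * ln (S x0 y0)); pose B := u x0 y0 * (q / 2).
have -> : 2 * pi * u x0 y0 = cint (fun t => A + B * ln (S (x0 + r * cos t) (y0 + r * sin t))).
  rewrite cintD; last 2 first.
  - by move=> t; exact: cvg_cst.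
  - by move=> t; apply: cvgM; [exact: cvg_cst|exact: cL].
  by rewrite cintZ // cint_cst Hm // /A /B; ring.
apply: cint_le => //.
  by move=> t; apply: cvgD; [exact: cvg_cst|apply: cvgM; [exact: cvg_cst|exact: cL]].
move=> t _; have [h1 h2] := circ_in t; rewrite [leRHS]uE ?Spos // /A /B uE //.
set p := q / 2 * ln _; set p0 := ln (S x0 y0).
have -> : q / 2 * ln (S (x0 + r * cos t) (y0 + r * sin t)) = (q / 2 * p0) +
   (q / 2 * ln (S (x0 + r * cos t) (y0 + r * sin t)) - q / 2 * p0) by ring.
rewrite expRD.
set E := expR (q / 2 * p0).
have -> : forall z, E * (1 - q / 2 * p0) + E * (q / 2) * z = E * (1 + (q / 2 * z - q / 2 * p0)).
  by move=> z; ring.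
by rewrite ler_pM2l ?expR_gt0 //; exact: expR_ge1Dx.
Qed.

End One_variable.

(** * The maximum principle and Poisson majorants on boxes *)

Section Poisson.
Context {R : realType}.
Implicit Types (x y c d e h k l r s t L M : R) (u U V W g : R -> R -> R).

Let ccst c : continuous (fun _ : R => c). Proof. by move=> t; exact: cvg_cst. Qed.
Let cmul (f g : R -> R) : continuous f -> continuous g -> continuous (fun t => f t * g t).
Proof. by move=> cf cg t; apply: cvgM; [exact: cf|exact: cg]. Qed.
Let cadd (f g : R -> R) : continuous f -> continuous g -> continuous (fun t => f t + g t).
Proof. by move=> cf cg t; apply: cvgD; [exact: cf|exact: cg]. Qed.
Let csub (f g : R -> R) : continuous f -> continuous g -> continuous (fun t => f t - g t).
Proof. by move=> cf cg t; apply: cvgB; [exact: cf|exact: cg]. Qed.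

Let ccos : continuous (fun t : R => cos t). Proof. exact: continuous_cos. Qed.
Let csin : continuous (fun t : R => sin t). Proof. exact: continuous_sin. Qed.

(* The strictly submean perturbation [eta |z|^2] rules out interior maxima. *)
Lemma max_principle u W W' xa xb ya yb yl : yl < ya -> xa <= xb -> ya <= yb ->
  (forall x y, yl < y -> cont2 u x y) ->
  (forall x y, yl < y -> 0 < u x y -> exists2 rho, 0 < rho & forall r, 0 < r -> r < rho ->
     2 * pi * u x y <= cint (fun t => u (x + r * cos t) (y + r * sin t))) ->
  (forall x y, yl < y -> exists c d, CR W W' x y c d) ->
  (forall x y, xa <= x <= xb -> ya <= y <= yb -> 0 <= W x y) ->
  (forall x y, xa <= x <= xb -> ya <= y <= yb -> [\/ x = xa, x = xb, y = ya | y = yb] ->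
     u x y <= W x y) ->
  forall x y, xa <= x <= xb -> ya <= y <= yb -> u x y <= W x y.
Proof.
move=> ylya xab yab cu sm hW W0 bd xs ys hxs hys.
have [//|lt] := leP (u xs ys) (W xs ys); exfalso.
pose m := u xs ys - W xs ys; have m0 : 0 < m by rewrite subr_gt0.
pose D := (xb - xa) ^+ 2 + (yb - ya) ^+ 2 + 1.
have D0 : 0 < D by rewrite /D; have := sqr_ge0 (xb - xa); have := sqr_ge0 (yb - ya); lra.
(* D exceeds |z - (xa, ya)|^2 on the box, so the perturbation is at most m/2 there and cannot raise
   a boundary point to the level m. *)
pose eta := m / (2 * D); have eta0 : 0 < eta by rewrite divr_gt0 // mulr_gt0.
have etaD : eta * D = m / 2 by rewrite /eta; field; rewrite gt_eqF.
have cW x y : yl < y -> cont2 W x y.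
  by move=> /(hW x) [c [d [H _]]]; exact: TD_cont H.
pose N x y := (x - xa) ^+ 2 + (y - ya) ^+ 2.
have N0 x y : 0 <= N x y by rewrite addr_ge0 ?sqr_ge0.
have ND x y : xa <= x <= xb -> ya <= y <= yb -> eta * N x y <= m / 2.
  move=> hx hy; rewrite -etaD ler_pM2l // /N /D.
  have : (x - xa) ^+ 2 <= (xb - xa) ^+ 2 by rewrite lerXn2r ?nnegrE; lra.
  have : (y - ya) ^+ 2 <= (yb - ya) ^+ 2 by rewrite lerXn2r ?nnegrE; lra.
  lra.
have cN x y : cont2 N x y.
  have := TD_add (TD_sqr (TD_add (TD_fst x y) (TD_cst (- xa) x y)))
    (TD_sqr (TD_add (TD_snd x y) (TD_cst (- ya) x y))).
  exact: TD_cont.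
pose psi x y := u x y - W x y + eta * N x y.
have cpsi x y : yl < y -> cont2 psi x y.
  move=> hy e e0; have e40 : 0 < e / 4 by rewrite divr_gt0.
  have [d1 d10 H1] := cu x y hy _ e40; have [d2 d20 H2] := cW x y hy _ e40.
  have [d3 d30 H3] := cN x y (e / 4 / eta) (divr_gt0 e40 eta0).
  exists (Num.min d1 (Num.min d2 d3)); first by rewrite !lt_min d10 d20.
  move=> x' y'; rewrite !lt_min => /and3P[a1 a2 a3] /and3P[b1 b2 b3].
  have := H1 _ _ a1 b1; have := H2 _ _ a2 b2; have := H3 _ _ a3 b3.
  rewrite ltr_pdivlMr // -{1}(gtr0_norm eta0) -normrM => h3 h2 h1.
  rewrite /psi (_ : _ - _ = (u x' y' - u x y) - (W x' y' - W x y) + (N x' y' - N x y) * eta); last by ring.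
  apply: le_lt_trans (ler_normD _ _) _.
  by have := ler_normB (u x' y' - u x y) (W x' y' - W x y); lra.
have [x0 [y0 [hx0 hy0 Hmax]]] := @EVT2 R psi xa xb ya yb xab yab
  (fun x y _ hy => cpsi x y ltac:(by case/andP: hy => hy _; exact: lt_le_trans ylya hy)).
have psim : m <= psi x0 y0.
  apply: le_trans (Hmax xs ys hxs hys); rewrite /psi -/m lerDl.
  by apply: mulr_ge0; [exact: ltW|exact: N0].
have nbd : ~ [\/ x0 = xa, x0 = xb, y0 = ya | y0 = yb].
  move=> /(bd x0 y0 hx0 hy0) H; have := ND _ _ hx0 hy0; move: psim; rewrite /psi; lra.
have int : [/\ x0 != xa, x0 != xb, y0 != ya & y0 != yb].
  by split; apply/eqP => E; apply: nbd; [constructor 1|constructor 2|constructor 3|constructor 4].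
case: int => n1 n2 n3 n4.
have xa0 : xa < x0 by rewrite lt_neqAle eq_sym n1; case/andP: hx0.
have xb0 : x0 < xb by rewrite lt_neqAle n2; case/andP: hx0.
have ya0 : ya < y0 by rewrite lt_neqAle eq_sym n3; case/andP: hy0.
have yb0 : y0 < yb by rewrite lt_neqAle n4; case/andP: hy0.
have yl0 : yl < y0 by exact: lt_trans ylya ya0.
(* The sub-mean value property is available only where u > 0; since W >= 0, the maximizer is such a
   point. *)
have u0 : 0 < u x0 y0.
  have := W0 _ _ hx0 hy0; have := ND _ _ hx0 hy0; move: psim; rewrite /psi; lra.
have [rho rho0 Hrho] := sm x0 y0 yl0 u0.
pose r1 := Num.min (Num.min (x0 - xa) (xb - x0)) (Num.min (y0 - ya) (yb - y0)).
have r10 : 0 < r1 by rewrite !lt_min !subr_gt0 xa0 xb0 ya0 yb0.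
pose r := Num.min rho r1 / 2.
have mr0 : 0 < Num.min rho r1 by rewrite lt_min rho0.
have r0 : 0 < r by rewrite divr_gt0.
have rm : r < Num.min rho r1 by rewrite /r ltr_pdivrMr // mulr_natr mulr2n ltrDl.
have rrho : r < rho by apply: lt_le_trans rm _; rewrite ge_min lexx.
have : r < r1 by apply: lt_le_trans rm _; rewrite ge_min lexx orbT.
rewrite !lt_min => /andP[/andP[ra rb] /andP[rc rd]].
have circ_in t : xa <= x0 + r * cos t <= xb /\ ya <= y0 + r * sin t <= yb.
  have [+ +] := norm_circle r t; rewrite (gtr0_norm r0) !ler_norml.
  by move: ra rb rc rd; clear; split; lra.
have circ_y t : yl < y0 + r * sin t by have [_ /andP[h _]] := circ_in t; exact: lt_le_trans h.
have ccu : continuous (fun t => u (x0 + r * cos t) (y0 + r * sin t)).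
  by apply: circle_continuous => t; exact: cu.
have ccW : continuous (fun t => W (x0 + r * cos t) (y0 + r * sin t)).
  by apply: circle_continuous => t; exact: cW.
have cpsi' : continuous (fun t => psi (x0 + r * cos t) (y0 + r * sin t)).
  by apply: circle_continuous => t; exact: cpsi.
have c1 : cint (fun t => psi (x0 + r * cos t) (y0 + r * sin t)) <= 2 * pi * psi x0 y0.
  rewrite -cint_cst; apply: cint_le => // t _.
  by have [h1 h2] := circ_in t; exact: Hmax.
have mW : cint (fun t => W (x0 + r * cos t) (y0 + r * sin t)) = 2 * pi * W x0 y0.
  apply: (@mean_value R W W' x0 y0 (y0 - ya)) => //; move=> x y _ hy; apply: hW.
  by move: hy; rewrite ltr_norml; lra.
(* The circle mean of N exceeds its central value by r^2, which is the strict excess that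
   contradicts maximality. *)
have mN : cint (fun t => N (x0 + r * cos t) (y0 + r * sin t)) = 2 * pi * (N x0 y0 + r ^+ 2).
  transitivity (cint (fun t => (N x0 y0 + r ^+ 2) + (2 * r * (x0 - xa)) * cos t + (2 * r * (y0 - ya)) * sin t)).
    apply: eq_cint => t.
    have -> : N (x0 + r * cos t) (y0 + r * sin t) = N x0 y0 + r ^+ 2 * (cos t ^+ 2 + sin t ^+ 2) +
      2 * r * (x0 - xa) * cos t + 2 * r * (y0 - ya) * sin t by rewrite /N; ring.
    by rewrite cos2Dsin2 mulr1.
  have k1 : continuous (fun t => 2 * r * (x0 - xa) * cos t) by apply: cmul => //; exact: continuous_cos.
  have k2 : continuous (fun t => 2 * r * (y0 - ya) * sin t) by apply: cmul => //; exact: continuous_sin.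
  rewrite (cintD (cadd (@ccst (N x0 y0 + r ^+ 2)) k1) k2) (cintD (@ccst (N x0 y0 + r ^+ 2)) k1).
  rewrite (cintZ _ ccos) (cintZ _ csin) cint_cst cint_cos cint_sin.
  by rewrite !mulr0 !addr0.
have ccN : continuous (fun t => N (x0 + r * cos t) (y0 + r * sin t)).
  by apply: circle_continuous => t; exact: cN.
have E : cint (fun t => psi (x0 + r * cos t) (y0 + r * sin t)) =
    cint (fun t => u (x0 + r * cos t) (y0 + r * sin t)) - 2 * pi * W x0 y0 +
    eta * (2 * pi * (N x0 y0 + r ^+ 2)).
  rewrite -mW -mN -(cintZ eta ccN) -(cintB ccu ccW) -cintD //; first exact: csub.
  exact: (cmul (@ccst eta) ccN).
have := Hrho r r0 rrho; move: c1; rewrite E /psi => c1 c2.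
have : 0 < eta * (2 * pi * r ^+ 2).
  have p0 : 0 < 2 * (pi : R) by rewrite mulr_gt0 // pi_gt0.
  by apply: mulr_gt0 => //; apply: mulr_gt0 => //; exact: exprn_gt0.
move: c1 c2; set p := 2 * pi; set I := cint _; set A := u x0 y0; set B := W x0 y0; set C := N x0 y0; set G := r ^+ 2.
lra.
Qed.

(** The Poisson kernel of the upper half-plane at height [s]. *)
Definition pk s t := s / (pi * (s ^+ 2 + t ^+ 2)).

Lemma pk_ge0 s t : 0 <= s -> 0 <= pk s t.
Proof. by move=> s0; rewrite divr_ge0 // mulr_ge0 ?pi_ge0 // addr_ge0 ?sqr_ge0. Qed.

Let complex_kernel (X Y : R) : 0 < Y ->
  ((0 +i* 1) / (X +i* Y) = (Y / (X ^+ 2 + Y ^+ 2)) +i* (X / (X ^+ 2 + Y ^+ 2)))%C.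
Proof.
move=> Y0; have z0 : (X +i* Y)%C != 0 by rewrite eq_complex /= negb_and (gt_eqF Y0) orbT.
have n0 : X ^+ 2 + Y ^+ 2 != 0 by rewrite gt_eqF // ltr_wpDl ?sqr_ge0 // exprn_gt0.
apply: (mulIf z0); rewrite divfK //; apply/eqP; rewrite eq_complex /=; apply/andP; split; apply/eqP; by field.
Qed.

Let complex_kernel2 (X Y : R) : 0 < Y ->
  (- ((0 +i* 1) / ((X +i* Y) ^+ 2)) = (- (2 * X * Y) / (X ^+ 2 + Y ^+ 2) ^+ 2) +i*
    ((Y ^+ 2 - X ^+ 2) / (X ^+ 2 + Y ^+ 2) ^+ 2))%C.
Proof.
move=> Y0; have z0 : (X +i* Y)%C != 0 by rewrite eq_complex /= negb_and (gt_eqF Y0) orbT.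
have n0 : X ^+ 2 + Y ^+ 2 != 0 by rewrite gt_eqF // ltr_wpDl ?sqr_ge0 // exprn_gt0.
have z20 : (X +i* Y)%C ^+ 2 != 0 by rewrite expf_neq0.
apply: (mulIf z20); rewrite mulNr divfK // expr2; apply/eqP; rewrite eq_complex /=; apply/andP; split; apply/eqP; by field.
Qed.

(* [i/(z + H) - i/z + i H/z^2 = i H^2 / (z^2 (z + H))] *)
Lemma kernel_taylor (X Y h k dl : R) : 0 < dl -> dl <= Y -> `|h| <= dl / 2 -> `|k| <= dl / 2 ->
  let a := - (2 * X * Y) / (X ^+ 2 + Y ^+ 2) ^+ 2 in
  let b := (Y ^+ 2 - X ^+ 2) / (X ^+ 2 + Y ^+ 2) ^+ 2 in
  `|(Y + k) / ((X + h) ^+ 2 + (Y + k) ^+ 2) - Y / (X ^+ 2 + Y ^+ 2) - (a * h + - b * k)| <=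
     2 / dl ^+ 3 * (`|h| + `|k|) ^+ 2 /\
  `|(X + h) / ((X + h) ^+ 2 + (Y + k) ^+ 2) - X / (X ^+ 2 + Y ^+ 2) - (b * h + a * k)| <=
     2 / dl ^+ 3 * (`|h| + `|k|) ^+ 2.
Proof.
move=> d0 dY hd kd a b.
have Y0 : 0 < Y by lra.
have Yk : dl / 2 <= Y + k by move: kd; rewrite ler_norml; lra.
have Yk0 : 0 < Y + k by lra.
pose z : R[i] := (X +i* Y)%C; pose H : R[i] := (h +i* k)%C.
have z0 : z != 0 by rewrite eq_complex /= negb_and (gt_eqF Y0) orbT.
have zH : z + H = ((X + h) +i* (Y + k))%C by [].
have zH0 : z + H != 0 by rewrite zH eq_complex /= negb_and (gt_eqF Yk0) orbT.
pose w : R[i] := ((0 +i* 1) / (z + H) - (0 +i* 1) / z - (- ((0 +i* 1) / z ^+ 2)) * H)%C.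
have wE : w = ((0 +i* 1) * H ^+ 2 / (z ^+ 2 * (z + H)))%C.
  by rewrite /w; field; rewrite z0 zH0.
have wb : cmod w <= 2 / dl ^+ 3 * (`|h| + `|k|) ^+ 2.
  have i1 : cmod (0 +i* 1 : R[i])%C = 1 by rewrite /cmod /= expr0n /= add0r expr1n sqrtr1.
  rewrite wE cmodM cmodV (cmodM _ (H ^+ 2)) (cmodM (z ^+ 2) (z + H)) !cmodX i1 mul1r mulrC.
  have zb : dl <= cmod z by apply: le_trans (Im_le_cmod z); rewrite /= ger0_norm; lra.
  have zHb : dl / 2 <= cmod (z + H) by apply: le_trans (Im_le_cmod _); rewrite /= ger0_norm; lra.
  have Hb : cmod H <= `|h| + `|k| by exact: cmod_le.
  apply: ler_pM; rewrite ?invr_ge0 ?mulr_ge0 ?exprn_ge0 ?cmod_ge0 //; last first.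
    by rewrite lerXn2r ?nnegrE ?cmod_ge0 ?addr_ge0.
  have -> : 2 / dl ^+ 3 = (dl ^+ 2 * (dl / 2))^-1 by field; rewrite gt_eqF.
  rewrite lef_pV2 ?posrE; last 2 first.
  - by rewrite mulr_gt0 // ?exprn_gt0 ?cmod_gt0.
  - by rewrite mulr_gt0 ?exprn_gt0 ?divr_gt0.
  have dn : 0 <= dl by exact: ltW.
  apply: ler_pM => //; [exact: exprn_ge0|by rewrite divr_ge0|].
  by apply: lerXn2r => //; rewrite nnegrE ?cmod_ge0.
have wre : w = (((Y + k) / ((X + h) ^+ 2 + (Y + k) ^+ 2) - Y / (X ^+ 2 + Y ^+ 2) - (a * h + - b * k)) +i*
  ((X + h) / ((X + h) ^+ 2 + (Y + k) ^+ 2) - X / (X ^+ 2 + Y ^+ 2) - (b * h + a * k)))%C.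
  rewrite /w zH complex_kernel // complex_kernel // complex_kernel2 // -/a -/b /H.
  by apply/eqP; rewrite eq_complex /=; apply/andP; split; apply/eqP; ring.
split.
  by apply: le_trans wb; have := Re_le_cmod w; rewrite {1}wre.
by apply: le_trans wb; have := Im_le_cmod w; rewrite {1}wre.
Qed.

Section Poisson_integral.
Variables (g : R -> R) (lo hi yl M : R).
Hypothesis lohi : lo < hi.
Hypothesis cg : continuous g.
Hypothesis gM : forall t, lo <= t <= hi -> `|g t| <= M.

(** W + i W' is the integral of g(t) i / (z - t - i yl), hence holomorphic above the line y = yl; W
    is pi times the Poisson integral of g restricted to [lo, hi]. *)
Let W x y := rint lo hi (fun t => (y - yl) / ((x - t) ^+ 2 + (y - yl) ^+ 2) * g t).
Let W' x y := rint lo hi (fun t => (x - t) / ((x - t) ^+ 2 + (y - yl) ^+ 2) * g t).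

Let den_gt0 (X Y : R) : 0 < Y -> 0 < X ^+ 2 + Y ^+ 2.
Proof. by move=> Y0; rewrite ltr_wpDl ?sqr_ge0 // exprn_gt0. Qed.

Let csubt x : continuous (fun t => x - t).
Proof. by apply: csub => //; move=> t; exact: cvg_id. Qed.

Let cden x (Y : R) n : 0 < Y -> continuous (fun t => (((x - t) ^+ 2 + Y ^+ 2) ^+ n)^-1).
Proof.
move=> Y0 t; apply: cvgV; first by rewrite expf_neq0 // gt_eqF // den_gt0.
apply: (@continuous_comp _ _ _ (fun t => (x - t) ^+ 2 + Y ^+ 2) (fun z : R => z ^+ n)); last exact: exprn_continuous.
apply: cadd => //; move=> s.
apply: (@continuous_comp _ _ _ (fun t => x - t) (fun z : R => z ^+ 2)); [exact: csubt|exact: exprn_continuous].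
Qed.

(** The remainder in [kernel_taylor] depends on the height dl but not on t, so multiplication by g,
    bounded by M, keeps the expansion uniform along the segment. *)
Lemma poisson_CR x y : yl < y -> exists c d, CR W W' x y c d.
Proof.
move=> yly; pose dl := y - yl; have dl0 : 0 < dl by rewrite subr_gt0.
pose a t := - (2 * (x - t) * dl) / ((x - t) ^+ 2 + dl ^+ 2) ^+ 2 * g t.
pose b t := (dl ^+ 2 - (x - t) ^+ 2) / ((x - t) ^+ 2 + dl ^+ 2) ^+ 2 * g t.
have csq : continuous (fun t => (x - t) ^+ 2).
  by move=> s; apply: (@continuous_comp _ _ _ (fun t => x - t) (fun z : R => z ^+ 2)); [exact: csubt|exact: exprn_continuous].
have ca : continuous a.
  apply: cmul => //; apply: cmul; last exact: cden.
  have c' : continuous (fun t => 2 * (x - t) * dl).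
    by apply: cmul => //; apply: cmul => //; exact: csubt.
  by move=> t; apply: cvgN; exact: c'.
have cb : continuous b.
  by apply: cmul => //; apply: cmul; last exact: cden; apply: csub.
have M0 : 0 <= M by apply: le_trans (gM (t := lo) _); rewrite ?normr_ge0 // lexx ltW.
have est e : 0 < e -> exists2 d, 0 < d & forall h k, `|h| < d -> `|k| < d -> d <= dl / 2 /\
    M * (2 / dl ^+ 3 * (`|h| + `|k|) ^+ 2) <= e * (`|h| + `|k|).
  move=> e0; pose K := M * (2 / dl ^+ 3).
  have K0 : 0 <= K by rewrite mulr_ge0 // divr_ge0 // exprn_ge0 // ltW.
  exists (Num.min (dl / 2) (e / (2 * (K + 1)))).
    by rewrite lt_min divr_gt0 //= divr_gt0 // mulr_gt0 // ltr_wpDl.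
  move=> h k; rewrite !lt_min => /andP[h1 h2] /andP[k1 k2]; split; first by rewrite ge_min lexx.
  rewrite mulrA -/K expr2 mulrA ler_wpM2r ?addr_ge0 //.
  apply: (@le_trans _ _ (K * (2 * (e / (2 * (K + 1)))))); first by rewrite ler_wpM2l //; lra.
  have -> : K * (2 * (e / (2 * (K + 1)))) = e * (K / (K + 1)) by field; rewrite gt_eqF // ltr_wpDl.
  by rewrite ger_pMr // ler_pdivrMr ?mul1r ?lerDl // ltr_wpDl.
exists (rint lo hi a), (rint lo hi b); split.
  have -> : - rint lo hi b = rint lo hi (fun t => - b t).
    by rewrite -mulN1r -rintZ //; apply: eq_rint => t; rewrite mulN1r.
  apply: (@TD_rint R lo hi (fun x y t => (y - yl) / ((x - t) ^+ 2 + (y - yl) ^+ 2) * g t) a (fun t => - b t) x y dl) => //.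
  - move=> x' y' _ hy; apply: cmul => //; apply: cmul => //.
    have y'0 : 0 < y' - yl by move: hy; rewrite ltr_norml /dl; lra.
    by have := @cden x' (y' - yl) 1%N y'0; under eq_fun do rewrite expr1.
  - by move=> t; apply: cvgN; exact: cb.
  - move=> e /est [d d0 Hd]; exists d => // t h k tt hd kd.
    have [dd He] := Hd h k hd kd.
    have [K1 _] := @kernel_taylor (x - t) dl h k dl dl0 (lexx _) (le_trans (ltW hd) dd) (le_trans (ltW kd) dd).
    apply: le_trans He.
    rewrite (_ : _ - _ = g t * ((dl + k) / ((x - t + h) ^+ 2 + (dl + k) ^+ 2) - dl / ((x - t) ^+ 2 + dl ^+ 2) -
      (- (2 * (x - t) * dl) / ((x - t) ^+ 2 + dl ^+ 2) ^+ 2 * h +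
        - ((dl ^+ 2 - (x - t) ^+ 2) / ((x - t) ^+ 2 + dl ^+ 2) ^+ 2) * k))); last first.
      rewrite /a /b (_ : y + k - yl = dl + k); last by rewrite /dl; ring.
      rewrite (_ : x + h - t = x - t + h); last by ring.
      by rewrite -/dl; ring.
    by rewrite normrM; apply: ler_pM => //; exact: gM.
apply: (@TD_rint R lo hi (fun x y t => (x - t) / ((x - t) ^+ 2 + (y - yl) ^+ 2) * g t) b a x y dl) => //.
- move=> x' y' _ hy; apply: cmul => //; apply: cmul; first exact: csubt.
  have y'0 : 0 < y' - yl by move: hy; rewrite ltr_norml /dl; lra.
  by have := @cden x' (y' - yl) 1%N y'0; under eq_fun do rewrite expr1.
- move=> e /est [d d0 Hd]; exists d => // t h k tt hd kd.
  have [dd He] := Hd h k hd kd.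
  have [_ K1] := @kernel_taylor (x - t) dl h k dl dl0 (lexx _) (le_trans (ltW hd) dd) (le_trans (ltW kd) dd).
  apply: le_trans He.
  rewrite (_ : _ - _ = g t * ((x - t + h) / ((x - t + h) ^+ 2 + (dl + k) ^+ 2) - (x - t) / ((x - t) ^+ 2 + dl ^+ 2) -
    ((dl ^+ 2 - (x - t) ^+ 2) / ((x - t) ^+ 2 + dl ^+ 2) ^+ 2 * h +
      - (2 * (x - t) * dl) / ((x - t) ^+ 2 + dl ^+ 2) ^+ 2 * k))); last first.
    rewrite /a /b (_ : y + k - yl = dl + k); last by rewrite /dl; ring.
    rewrite (_ : x + h - t = x - t + h); last by ring.
    by rewrite -/dl; ring.
  by rewrite normrM; apply: ler_pM => //; exact: gM.
Qed.

Hypothesis g0 : forall t, lo <= t <= hi -> 0 <= g t.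

Lemma kernel_continuous x h : 0 < h -> continuous (fun t => h / ((x - t) ^+ 2 + h ^+ 2)).
Proof.
by move=> h0; apply: cmul => //; have := @cden x h 1%N h0; under eq_fun do rewrite expr1.
Qed.

Lemma poisson_ge0 x y : yl < y -> 0 <= W x y.
Proof.
move=> yly; have h0 : 0 < y - yl by rewrite subr_gt0.
rewrite -[leLHS](_ : rint lo hi (fun _ => 0) = 0); last by rewrite rint_cst // mulr0.
apply: rint_le => //; first by apply: cmul => //; exact: kernel_continuous.
move=> t tt; apply: mulr_ge0; last exact: g0.
by rewrite divr_ge0 ?ltW ?den_gt0.
Qed.

Lemma kernel_mass x h d : 0 < h -> 0 < d ->
  rint (x - d) (x + d) (fun t => h / ((x - t) ^+ 2 + h ^+ 2)) = 2 * atan (d / h).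
Proof.
move=> h0 d0.
have dG t : is_derive t 1 (fun t => - atan ((x - t) / h)) (h / ((x - t) ^+ 2 + h ^+ 2)).
  have L : is_derive t 1 (fun t => (x - t) / h) (- h^-1).
    apply/is_derive1P => e e0; exists 1 => // k _.
    rewrite (_ : (x - (t + k)) / h - (x - t) / h - - h^-1 * k = 0); last by ring.
    by rewrite normr0 mulr_ge0 // ltW.
  have := is_deriveN (@is_derive1_comp R atan (fun t => (x - t) / h) t _ _ (is_derive1_atan ((x - t) / h)) L).
  move=> K; apply: is_derive_eq K _.
  have n1 : (x - t) ^+ 2 + h ^+ 2 != 0 by rewrite gt_eqF // den_gt0.
  rewrite mulrN opprK exprMn.
  have n2 : 1 + (x - t) ^+ 2 * h^-1 ^+ 2 = ((x - t) ^+ 2 + h ^+ 2) / h ^+ 2.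
    by field; rewrite gt_eqF.
  by rewrite n2 invf_div /GRing.scale /=; field; rewrite n1 gt_eqF.
have := @rint_derive R (x - d) (x + d) _ _ ltac:(lra) (@kernel_continuous x h h0) dG.
move=> ->; rewrite (_ : x - (x + d) = - d); last by ring.
rewrite (_ : x - (x - d) = d); last by ring.
by rewrite mulNr atanN; ring.
Qed.

Lemma rint_subset a b (f : R -> R) : lo <= a -> a < b -> b <= hi -> continuous f ->
  (forall t, lo <= t <= hi -> 0 <= f t) -> rint a b f <= rint lo hi f.
Proof.
move=> la ab bh cf f0.
have i1 := rint_integrable a b cf; have i2 := rint_integrable lo hi cf.
rewrite /rint /Rintegral; apply: fine_le.
- exact: integrable_fin_num.
- exact: integrable_fin_num.
- apply: ge0_subset_integral => //=.
  + by apply/measurable_EFinP/measurable_funTS; exact: continuous_measurable_fun.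
  + by move=> t; rewrite /= !in_itv /=; lra.
Qed.

(** A lower bound is what a majorant requires at its boundary. On [x - d, x + d] the kernel has mass
    at least 1 - k and g is at least g(x) - e; the missing mass costs at most k g(x) <= e. If g(x)
    <= e, positivity of W suffices. *)
Lemma poisson_boundary x h d e k : 0 < h -> 0 < d -> lo <= x - d -> x + d <= hi -> 0 < e ->
  (forall t, `|t - x| <= d -> g x - e <= g t) -> 0 <= k -> k * M <= e -> 
  pi / 2 * (1 - k) <= atan (d / h) -> lo <= x <= hi ->
  g x - 2 * e <= pi^-1 * W x (yl + h).
Proof.
move=> h0 d0 l1 l2 e0 gx k0 kM ha xin.
have pi0 : 0 < (pi : R) by exact: pi_gt0.
have W0 : 0 <= pi^-1 * W x (yl + h).
  by apply: mulr_ge0; [rewrite invr_ge0 ltW|apply: poisson_ge0; rewrite ltrDl].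
have [ge|ge] := leP (g x) e; first by lra.
have hh : yl + h - yl = h by ring.
have ck := @kernel_continuous x h h0.
have P1 : rint (x - d) (x + d) (fun t => (g x - e) * (h / ((x - t) ^+ 2 + h ^+ 2))) <= W x (yl + h).
  rewrite /W hh; apply: (@le_trans _ _ (rint (x - d) (x + d) (fun t => h / ((x - t) ^+ 2 + h ^+ 2) * g t))).
    apply: rint_le; [exact: cmul|exact: cmul|].
    move=> t tt; rewrite mulrC ler_wpM2l //; first by rewrite divr_ge0 ?ltW ?den_gt0.
    by apply: gx; rewrite ler_norml; lra.
  apply: rint_subset => //; [lra|exact: cmul|].
  by move=> t tt; apply: mulr_ge0; [rewrite divr_ge0 ?ltW ?den_gt0|exact: g0].
rewrite (rintZ _ _ _ ck) kernel_mass // in P1.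
apply: (@le_trans _ _ (pi^-1 * ((g x - e) * (2 * atan (d / h))))); last first.
  by apply: ler_wpM2l => //; rewrite invr_ge0 ltW.
apply: (@le_trans _ _ (pi^-1 * ((g x - e) * (2 * (pi / 2 * (1 - k)))))); last first.
  apply: ler_wpM2l; first by rewrite invr_ge0 ltW.
  by apply: ler_wpM2l; [rewrite subr_ge0 ltW|apply: ler_wpM2l].
have -> : pi^-1 * ((g x - e) * (2 * (pi / 2 * (1 - k)))) = (g x - e) * (1 - k).
  have p1 : pi^-1 * pi = 1 :> R by rewrite mulVf // gt_eqF.
  transitivity ((g x - e) * (1 - k) * (pi^-1 * pi)); last by rewrite p1 mulr1.
  by move: {p1} pi^-1 => p'; field.
have : k * g x <= e.
  by apply: le_trans kM; rewrite ler_wpM2l //; apply: le_trans (gM xin); exact: ler_norm.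
have : 0 <= k * e by rewrite mulr_ge0 // ltW.
lra.
Qed.

End Poisson_integral.

Lemma atan_large k d : 0 < k -> k < 1 -> 0 < d ->
  exists2 h0, 0 < h0 & forall h, 0 < h -> h < h0 -> pi / 2 * (1 - k) <= atan (d / h).
Proof.
move=> k0 k1 d0; have pi0 : 0 < (pi : R) by exact: pi_gt0.
pose v := pi / 2 * (1 - k).
have v0 : 0 < v by rewrite mulr_gt0 ?divr_gt0 ?subr_gt0.
have v1 : v < pi / 2 by rewrite /v gtr_pMr ?divr_gt0 //; lra.
have vi : v \in `]- (pi / 2), (pi / 2)[ by rewrite in_itv /= v1 andbT; lra.
have t0 : 0 < tan v.
  rewrite ltNge; apply/negP => /le_atan; rewrite tanK // atan0; lra.
exists (d / tan v); first by rewrite divr_gt0.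
move=> h h0; rewrite ltr_pdivlMr // => hh; rewrite -/v -[leLHS]tanK //; apply: le_atan.
by rewrite ler_pdivlMr // mulrC ltW.
Qed.

(* The barrier [((x - x1)^2 - (y - y0)^2 + 2 L (y - y0)) / L^2] is harmonic, at least [1] on the
   three upper sides of the box, nonnegative on the bottom, and at most [2 s / L] at [(x1, y0 + s)]. *)
Theorem box_majorant u x1 y0 L s B : 0 < y0 -> 0 < s -> s < L ->
  (forall x y, 0 <= u x y) ->
  (forall x y, 0 < y -> cont2 u x y) ->
  (forall x y, 0 < y -> 0 < u x y -> exists2 rho, 0 < rho & forall r, 0 < r -> r < rho ->
     2 * pi * u x y <= cint (fun t => u (x + r * cos t) (y + r * sin t))) ->
  (forall x y, x1 - L <= x <= x1 + L -> y0 <= y <= y0 + L -> u x y <= B) ->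
  u x1 (y0 + s) <= rint (x1 - 2 * L) (x1 + 2 * L) (fun t => pk s (x1 - t) * u t y0) + B * (2 * s / L).
Proof.
move=> y00 s0 sL u0 cu sm uB.
have L0 : 0 < L by lra.
have pi0 : 0 < (pi : R) by exact: pi_gt0.
pose g t := u t y0.
have cg : continuous g by move=> t; exact: cont2_fst (cu t y0 y00).
(* The data are taken on twice the base of the box, so that every point of the base has a full
   neighbourhood of radius at most L in the segment. *)
pose lo := x1 - 2 * L; pose hi := x1 + 2 * L.
have lohi : lo < hi by rewrite /lo /hi; lra.
have [M M0 HM] := @bounded2 R u lo hi y0 y0
  (fun x y _ hy => cu x y ltac:(by case/andP: hy => hy _; exact: lt_le_trans y00 hy)).
have gM t : lo <= t <= hi -> `|g t| <= M by move=> tt; apply: HM => //; rewrite lexx.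
have B0 : 0 <= B by apply: le_trans (u0 x1 y0) (uB x1 y0 _ _); lra.
pose WP x y := rint lo hi (fun t => (y - y0) / ((x - t) ^+ 2 + (y - y0) ^+ 2) * g t).
pose WP' x y := rint lo hi (fun t => (x - t) / ((x - t) ^+ 2 + (y - y0) ^+ 2) * g t).
pose H x y := ((x - x1) ^+ 2 - (y - y0) ^+ 2 + 2 * L * (y - y0)) / L ^+ 2.
pose H' x y := (2 * (x - x1) * (y - y0) - 2 * L * (x - x1)) / L ^+ 2.
have CRH x y : CR H H' x y (2 * (x - x1) / L ^+ 2) ((2 * (y - y0) - 2 * L) / L ^+ 2).
  have T1 := TD_add (TD_fst x y) (TD_cst (- x1) x y).
  have T2 := TD_add (TD_snd x y) (TD_cst (- y0) x y).
  split.
    have := TD_scale (L ^- 2) (TD_add (TD_add (TD_sqr T1) (TD_opp (TD_sqr T2))) (TD_scale (2 * L) T2)).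
    move=> T; apply: TD_eq; first apply: TD_ext_near ltr01 _ T.
    - by move=> *; rewrite /H /=; ring.
    - by ring.
    - by ring.
  have := TD_scale (L ^- 2) (TD_add (TD_scale 2 (TD_mul T1 T2)) (TD_opp (TD_scale (2 * L) T1))).
  move=> T; apply: TD_eq; first apply: TD_ext_near ltr01 _ T.
  - by move=> *; rewrite /H' /=; ring.
  - by ring.
  - by ring.
(* The kernel degenerates at height y0, so the maximum principle is applied on a box starting at y0
   + h; the margin e pays for the comparison on that bottom side. *)
suff main e : 0 < e -> u x1 (y0 + s) <= pi^-1 * WP x1 (y0 + s) + B * H x1 (y0 + s) + e.
  have E : rint lo hi (fun t => pk s (x1 - t) * u t y0) = pi^-1 * WP x1 (y0 + s).
    have ss : y0 + s - y0 = s by ring.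
    rewrite /WP ss -rintZ.
      by apply: eq_rint => t; rewrite /pk /g invfM (addrC (s ^+ 2)) mulrCA !mulrA.
    by apply: cmul => //; exact: kernel_continuous.
  rewrite -/lo -/hi E; apply/ler_addgt0Pr => e /main /le_trans; apply.
  rewrite lerD2r lerD2l ler_wpM2l // /H.
  rewrite (_ : x1 - x1 = 0) ?subrr // (_ : y0 + s - y0 = s); last by ring.
  rewrite (_ : (0 ^+ 2 - s ^+ 2 + 2 * L * s) / L ^+ 2 = 2 * s / L - (s / L) ^+ 2); last by field; rewrite gt_eqF.
  by rewrite gerBl sqr_ge0.
move=> e0.
pose e1 := e / 4; have e10 : 0 < e1 by rewrite divr_gt0.
(* One modulus of continuity for the whole bottom side, so that one height h works for all its
   points. *)
have [d d0 Hd] : exists2 d, 0 < d & forall x, x1 - L <= x <= x1 + L -> forall x' y',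
    `|x' - x| < d -> `|y' - y0| < d -> `|u x' y' - u x y0| < e1.
  apply: segment_unif => x _; have [d d0 Hd] := cu x y0 y00 (e1 / 2) (divr_gt0 e10 (ltr0n R 2)).
  exists (d / 2); first by rewrite divr_gt0.
  move=> x2 d' hx2 d'0 d'd x' y' hx' hy'.
  have A1 : `|u x' y' - u x y0| < e1 / 2.
    apply: Hd; last by lra.
    by rewrite -(subrKA x2); apply: le_lt_trans (ler_normD _ _) _; lra.
  have A2 : `|u x2 y0 - u x y0| < e1 / 2 by apply: Hd; rewrite ?subrr ?normr0 //; lra.
  rewrite -(subrKA (u x y0)); apply: le_lt_trans (ler_normD _ _) _; rewrite (distrC (u x y0)); lra.
pose d1 := Num.min (d / 2) L; have d10 : 0 < d1 by rewrite lt_min divr_gt0.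
have d1d : d1 < d by apply: (@le_lt_trans _ _ (d / 2)); [rewrite ge_min lexx|lra].
have d1L : d1 <= L by rewrite ge_min lexx orbT.
pose k := Num.min 2^-1 (e1 / (M + 1)).
have M1 : 0 < M + 1 by lra.
have k0 : 0 < k by rewrite lt_min divr_gt0 // invr_gt0 ltr0n.
have k1 : k < 1 by apply: (@le_lt_trans _ _ 2^-1); [rewrite ge_min lexx|lra].
have kM : k * M <= e1.
  apply: (@le_trans _ _ (e1 / (M + 1) * (M + 1))); last by rewrite divfK // gt_eqF.
  by apply: ler_pM; [exact: ltW|exact: M0|rewrite ge_min lexx orbT|lra].
have [h0 h00 Hh] := atan_large k0 k1 d10.
pose h := Num.min (Num.min h0 d) s / 2.
have mh : 0 < Num.min (Num.min h0 d) s by rewrite !lt_min h00 d0.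
have hp : 0 < h by rewrite divr_gt0.
have : h < Num.min (Num.min h0 d) s by rewrite /h ltr_pdivrMr // mulr_natr mulr2n ltrDl.
rewrite !lt_min => /andP[/andP[hh0 hd] hs].
have bot x : x1 - L <= x <= x1 + L -> u x (y0 + h) <= pi^-1 * WP x (y0 + h) + e.
  move=> hx.
  have P1 := @poisson_boundary g lo hi y0 M lohi cg gM (fun t _ => u0 t y0) x h d1 e1 k hp d10
    ltac:(rewrite /lo; lra) ltac:(rewrite /hi; lra) e10 _ (ltW k0) kM (Hh h hp hh0) ltac:(rewrite /lo /hi; lra).
  have := Hd x hx x (y0 + h); rewrite subrr normr0 (_ : y0 + h - y0 = h); last by ring.
  rewrite (gtr0_norm hp) => /(_ d0 hd); rewrite ltr_norml => /andP[_ Q].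
  have := P1; rewrite -/(WP x (y0 + h)) /g => P2.
  have : u x y0 - 2 * e1 <= pi^-1 * WP x (y0 + h).
    apply: P2 => t td; have := Hd x hx t y0; rewrite subrr normr0 => /(_ (le_lt_trans td d1d) d0).
    by rewrite ltr_norml; lra.
  by move: Q; rewrite /e1; lra.
pose W x y := pi^-1 * WP x y + B * H x y + e.
pose W' x y := pi^-1 * WP' x y + B * H' x y.
have WP0 x y : y0 < y -> 0 <= pi^-1 * WP x y.
  move=> hy; apply: mulr_ge0; first by rewrite invr_ge0 ltW.
  by apply: (@poisson_ge0 g lo hi y0) => // t _; exact: u0.
have HL x y : H x y * L ^+ 2 = (x - x1) ^+ 2 + (y - y0) * (2 * L - (y - y0)).
  by rewrite /H divfK ?expf_neq0 ?gt_eqF //; ring.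
have L20 : 0 < L ^+ 2 by rewrite exprn_gt0.
have hq y : y0 <= y <= y0 + L -> 0 <= (y - y0) * (2 * L - (y - y0)).
  move=> /andP[y1 y2]; rewrite mulr_ge0 ?subr_ge0 // lerBlDl (le_trans y2) // lerD2l.
  by rewrite mulr_natl mulr2n lerDl ltW.
have H0 x y : y0 <= y <= y0 + L -> 0 <= H x y.
  move=> /andP[y1 y2]; rewrite -(pmulr_lge0 _ L20) HL addr_ge0 ?sqr_ge0 // hq //.
  by rewrite y1 y2.
have H1 x y : y0 <= y <= y0 + L -> [\/ x = x1 - L, x = x1 + L | y = y0 + L] -> 1 <= H x y.
  move=> hy hb; rewrite -(ler_pM2r L20) mul1r HL.
  have q1 := hq y hy.
  case: hb => ->.
  - by rewrite (_ : (x1 - L - x1) ^+ 2 = L ^+ 2); [rewrite lerDl|ring].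
  - by rewrite (_ : (x1 + L - x1) ^+ 2 = L ^+ 2); [rewrite lerDl|ring].
  - rewrite (_ : (y0 + L - y0) * (2 * L - (y0 + L - y0)) = L ^+ 2); last by ring.
    by rewrite lerDr sqr_ge0.
have CRW x y : y0 < y -> exists c c', CR W W' x y c c'.
  move=> hy; have [c [c' [T1 T2]]] := @poisson_CR g lo hi y0 M lohi cg gM x y hy.
  have [T3 T4] := CRH x y.
  exists (pi^-1 * c + B * (2 * (x - x1) / L ^+ 2)), (pi^-1 * c' + B * ((2 * (y - y0) - 2 * L) / L ^+ 2)).
  split.
    by apply: TD_eq (TD_add (TD_add (TD_scale pi^-1 T1) (TD_scale B T3)) (TD_cst e x y)) _ _; ring.
  by apply: TD_eq (TD_add (TD_scale pi^-1 T2) (TD_scale B T4)) _ _; ring.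
have WE x y : W x y = pi^-1 * WP x y + B * H x y + e by [].
rewrite -WE; clearbody W W' H WP h.
clear CRH HL Hd Hh hh0 hd mh h0 h00 kM k0 k1 d1d d1L d10 L20.
have hL : h < L by lra.
apply: (@max_principle u W W' (x1 - L) (x1 + L) (y0 + h) (y0 + L) y0) => //.
- by rewrite ltrDl.
- by lra.
- by rewrite lerD2l ltW.
- by move=> x y hy; apply: cu; exact: lt_trans y00 hy.
- by move=> x y hy; apply: sm; exact: lt_trans y00 hy.
- move=> x y hx hy; rewrite WE; have hy' : y0 < y <= y0 + L by lra.
  have hy'' : y0 <= y <= y0 + L by lra.
  have := WP0 x y (andP hy').1; have := mulr_ge0 B0 (H0 x y hy''); move: e0.
  by move: (pi^-1 * _) (B * _) => ? ?; lra.
- move=> x y hx hy hb; rewrite WE.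
  have hy' : y0 < y by lra.
  have Wp := WP0 x y hy'.
  have q0 : y0 <= y <= y0 + L by lra.
  have uB' : u x y <= B by exact: uB.
  have q1 : [\/ x = x1 - L, x = x1 + L | y = y0 + L] -> u x y <= pi^-1 * WP x y + B * H x y + e.
    move=> /(H1 x y q0) h1; have : B * 1 <= B * H x y by rewrite ler_wpM2l.
    by rewrite mulr1 => h2; rewrite -[leLHS]addr0 lerD // ?(ltW e0) // -[leLHS]add0r lerD // (le_trans uB').
  case: hb => hb.
  - by apply: q1; constructor 1.
  - by apply: q1; constructor 2.
  - have := mulr_ge0 B0 (H0 x y q0); have := bot x hx; rewrite -hb.
    by move: (pi^-1 * _) (B * _) => ? ?; lra.
  - by apply: q1; constructor 3.
- by lra.
- by lra.
Qed.

End Poisson.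

(** * The iterated integral: measurability, Tonelli, translation, Fatou *)

Section Iterated_integral.
Context {R : realType} {n : nat}.
Local Notation vec := ('I_n -> R).
Local Notation mu := (@lebesgue_measure R).
Local Open Scope ereal_scope.
Implicit Types (s : seq 'I_n) (x : vec) (i j : 'I_n).

Definition tup x : n.-tuple (measurableTypeR R) := [tuple x i | i < n].

Lemma tupK x : tnth (tup x) = x.
Proof. by apply/funext => i; rewrite tnth_mktuple. Qed.

(* The Borel structure of [R^n] is carried by [n.-tuple R]. *)
Definition jmeas d (S : measurableType d) (h : S -> vec -> \bar R) :=
  measurable_fun setT (fun p : S * n.-tuple (measurableTypeR R) => h p.1 (tnth p.2)).

Lemma measurable_tup d (S : measurableType d) (f : S -> vec) :
  (forall i, measurable_fun setT (fun p => f p i : measurableTypeR R)) ->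
  measurable_fun setT (fun p => tup (f p)).
Proof.
move=> H; apply/measurable_fun_tnthP => i.
by rewrite (_ : _ \o _ = (fun p => f p i)) //; apply/funext => p /=; rewrite tnth_mktuple.
Qed.

Lemma jmeas_comp d d' (S : measurableType d) (S' : measurableType d') (h : S -> vec -> \bar R)
    (a : S' -> S) (f : S' -> vec) :
  jmeas h -> measurable_fun setT a ->
  (forall i, measurable_fun setT (fun p => f p i : measurableTypeR R)) ->
  measurable_fun setT (fun p => h (a p) (f p)).
Proof.
move=> mh ma mf.
have -> : (fun p => h (a p) (f p)) =
    (fun p : S * n.-tuple (measurableTypeR R) => h p.1 (tnth p.2)) \o (fun p => (a p, tup (f p))).
  by apply/funext => p /=; rewrite tupK.
apply: measurableT_comp => //; apply/measurable_fun_pair => //.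
exact: measurable_tup.
Qed.

Lemma measurable_upd d (S : measurableType d) (f : S -> vec) (t : S -> R) i j :
  (forall i, measurable_fun setT (fun p => f p i : measurableTypeR R)) ->
  measurable_fun setT (fun p => t p : measurableTypeR R) ->
  measurable_fun setT (fun p => upd (f p) i (t p) j : measurableTypeR R).
Proof.
move=> mf mt; rewrite /upd; case: (j == i); [exact: mt|exact: mf].
Qed.

Lemma measurable_tnth_snd d (S : measurableType d) i :
  measurable_fun setT (fun p : S * n.-tuple (measurableTypeR R) => tnth p.2 i).
Proof.
apply: (@measurableT_comp _ _ _ _ _ _ (fun t : n.-tuple (measurableTypeR R) => tnth t i)).
  exact: measurable_tnth.
exact: measurable_snd.
Qed.

Lemma iter_int_ge0 s (g : vec -> \bar R) x : (forall x, 0 <= g x) -> 0 <= iter_int s g x.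
Proof. by move=> g0; elim: s x => //= i s IH x; apply: integral_ge0. Qed.

(** Measurability is kept joint with a parameter because exchanging an integral in the parameter
    with the iterated one, in [iter_int_tonelli], requires it. *)
Lemma jmeas_iter_int d (S : measurableType d) (h : S -> vec -> \bar R) s :
  jmeas h -> (forall p x, 0 <= h p x) -> jmeas (fun p x => iter_int s (h p) x).
Proof.
move=> mh h0; elim: s => [//|i s IH]; rewrite /jmeas /=.
pose f (q : (S * n.-tuple (measurableTypeR R)) * measurableTypeR R) :=
  iter_int s (h q.1.1) (upd (tnth q.1.2) i q.2).
have mf : measurable_fun setT f.
  apply: (jmeas_comp (a := fun q => q.1.1) (f := fun q => upd (tnth q.1.2) i q.2) IH).
    by apply: measurableT_comp => //; exact: measurable_fst.
  move=> j; apply: measurable_upd; last exact: measurable_snd.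
  move=> k; apply: (measurableT_comp (@measurable_tnth_snd _ S k)); exact: measurable_fst.
by apply: (@measurable_fun_fubini_tonelli_F _ _ _ _ R mu f mf) => q; exact: iter_int_ge0.
Qed.

Definition vmeas (g : vec -> \bar R) :=
  measurable_fun setT (fun t : n.-tuple (measurableTypeR R) => g (tnth t)).

Lemma vmeas_jmeas d (S : measurableType d) g : vmeas g -> jmeas (fun (_ : S) => g).
Proof. by move=> mg; apply: (measurableT_comp mg); exact: measurable_snd. Qed.

Lemma jmeas_vmeas d (S : measurableType d) (h : S -> vec -> \bar R) p : jmeas h -> vmeas (h p).
Proof.
move=> mh; apply: (jmeas_comp (a := fun _ => p) (f := fun t => tnth t) mh).
  exact: measurable_cst.
by move=> i; exact: measurable_tnth.
Qed.

Lemma vmeas_iter_int s g : vmeas g -> (forall x, 0 <= g x) -> vmeas (iter_int s g).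
Proof.
move=> mg g0; have := @jmeas_iter_int _ (measurableTypeR R) (fun _ => g) s (vmeas_jmeas mg) (fun _ => g0).
by move=> /(jmeas_vmeas (0 : measurableTypeR R)%R).
Qed.

Lemma vmeas_upd g x i : vmeas g -> measurable_fun setT (fun t : measurableTypeR R => g (upd x i t)).
Proof.
move=> mg; have := @vmeas_jmeas _ (measurableTypeR R) g mg => mg'.
apply: (jmeas_comp (a := fun t => t) (f := fun t => upd x i t) mg'); first exact: measurable_id.
move=> j; apply: measurable_upd; last exact: measurable_id.
by move=> k; exact: measurable_cst.
Qed.

Lemma iter_int_le s (g h : vec -> \bar R) x : vmeas g -> vmeas h -> (forall x, 0 <= g x) ->
  (forall x, g x <= h x) -> iter_int s g x <= iter_int s h x.
Proof.
move=> mg mh g0 gh; have h0 y : 0 <= h y by exact: le_trans (g0 y) (gh y).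
elim: s x => //= i s IH x.
apply: ge0_le_integral => //.
- by move=> t _; exact: iter_int_ge0.
- by apply: vmeas_upd; exact: vmeas_iter_int.
- by apply: vmeas_upd; exact: vmeas_iter_int.
Qed.

Lemma iter_intD s (g h : vec -> \bar R) x : vmeas g -> vmeas h -> (forall x, 0 <= g x) ->
  (forall x, 0 <= h x) ->
  iter_int s (fun x => g x + h x) x = iter_int s g x + iter_int s h x.
Proof.
move=> mg mh g0 h0; elim: s x => //= i s IH x.
under eq_integral do rewrite IH.
apply: ge0_integralD => //.
- by move=> t _; exact: iter_int_ge0.
- by apply: vmeas_upd; exact: vmeas_iter_int.
- by move=> t _; exact: iter_int_ge0.
- by apply: vmeas_upd; exact: vmeas_iter_int.
Qed.

Lemma iter_intZ s (g : vec -> \bar R) x (c : R) : vmeas g -> (forall x, 0 <= g x) -> (0 <= c)%R ->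
  iter_int s (fun x => c%:E * g x) x = c%:E * iter_int s g x.
Proof.
move=> mg g0 c0; elim: s x => //= i s IH x.
under eq_integral do rewrite IH.
apply: ge0_integralZl_EFin => //.
- by move=> t _; exact: iter_int_ge0.
- by apply: vmeas_upd; exact: vmeas_iter_int.
Qed.

Lemma iter_int_tonelli (h : measurableTypeR R -> vec -> \bar R) s x : jmeas h ->
  (forall p x, 0 <= h p x) ->
  iter_int s (fun x => \int[mu]_t h t x) x = \int[mu]_t iter_int s (h t) x.
Proof.
move=> mh h0; elim: s x => //= i s IH x.
under eq_integral do rewrite IH.
pose f (q : measurableTypeR R * measurableTypeR R) := iter_int s (h q.2) (upd x i q.1).
apply: (@fubini_tonelli _ _ _ _ R mu mu f).
  apply: (jmeas_comp (a := fun q => q.2) (f := fun q => upd x i q.1) (jmeas_iter_int s mh h0)).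
    exact: measurable_snd.
  move=> j; apply: measurable_upd; last exact: measurable_fst.
  by move=> k; exact: measurable_cst.
by move=> q; exact: iter_int_ge0.
Qed.

(** The image of Lebesgue measure under the translation gives half-open intervals their length, so
    uniqueness identifies the two measures. *)
Lemma lebesgue_translate (f : R -> \bar R) (c : R) :
  measurable_fun setT (f : measurableTypeR R -> \bar R) -> (forall t, 0 <= f t) ->
  \int[mu]_t f (t + c)%R = \int[mu]_t f t.
Proof.
move=> mf f0.
pose phi : measurableTypeR R -> measurableTypeR R := fun t => (t + c)%R.
have mphi : measurable_fun setT phi.
  by apply: measurable_funD; [exact: measurable_id|exact: measurable_cst].
have E : \int[pushforward mu phi]_t f t = \int[mu]_t f (t + c)%R.
  by rewrite ge0_integral_pushforward.
rewrite -E; apply: eq_measure_integral => A mA _ /=.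
apply/esym/lebesgue_measure_unique => //= _ [[a b]] _ <-.
rewrite /pushforward /=.
have -> : phi @^-1` [set` `]a, b]%R] = [set` `](a - c)%R, (b - c)%R]%R].
  by apply/seteqP; split=> t /=; rewrite !in_itv /= /phi; lra.
rewrite !lebesgue_measure_itv /= !lte_fin ltrD2r; case: ifP => // _.
by congr (_%:E); lra.
Qed.

Lemma iter_int_shift_notin s (g : vec -> \bar R) x j (c : R) : j \notin s ->
  iter_int s (fun x => g (upd x j (x j + c)%R)) x = iter_int s g (upd x j (x j + c)%R).
Proof.
elim: s x => //= i s IH x; rewrite inE negb_or => /andP[ji js].
apply: eq_integral => t _; rewrite IH //; congr iter_int.
by rewrite updC 1?eq_sym // /upd (negbTE ji).
Qed.

Lemma iter_int_shift s (g : vec -> \bar R) x j (c : R) : vmeas g -> (forall x, 0 <= g x) ->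
  uniq s -> j \in s ->
  iter_int s (fun x => g (upd x j (x j + c)%R)) x = iter_int s g x.
Proof.
move=> mg g0; elim: s x => //= i s IH x /andP[is_ us]; rewrite inE => /orP[/eqP ->|js].
  under eq_integral do rewrite iter_int_shift_notin // upd_upd updE.
  apply: (@lebesgue_translate (fun t => iter_int s g (upd x i t))).
    by apply: vmeas_upd; exact: vmeas_iter_int.
  by move=> t; exact: iter_int_ge0.
by apply: eq_integral => t _; exact: IH.
Qed.

Lemma measurable_limn_einf d (S : measurableType d) (f : (S -> \bar R)^nat) :
  (forall k, measurable_fun setT (f k)) -> measurable_fun setT (fun p : S => limn_einf (f ^~ p)).
Proof.
move=> mf.
have -> : (fun p : S => limn_einf (f ^~ p)) = (fun p : S => - limn_esup (fun k => - f k p)).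
  by apply/funext => p; rewrite -limn_einfN; congr limn_einf; apply/funext => k /=; rewrite oppeK.
apply: measurableT_comp => //; apply: measurable_fun_limn_esup => k.
exact: measurableT_comp.
Qed.

Lemma iter_int_fatou s (g : nat -> vec -> \bar R) x : (forall k, vmeas (g k)) ->
  (forall k x, 0 <= g k x) ->
  iter_int s (fun x => limn_einf (g ^~ x)) x <= limn_einf (fun k => iter_int s (g k) x).
Proof.
move=> mg g0; elim: s x => //= i s IH x.
have L0 y : 0 <= limn_einf (g ^~ y).
  rewrite limn_einf_lim; apply: lime_ge; first exact: is_cvg_einfs.
  by apply: nearW => k; apply: le_ereal_inf_tmp => _ [m _ <-].
have mL : vmeas (fun x => limn_einf (g ^~ x)).
  exact: (@measurable_limn_einf _ _ (fun k t => g k (tnth t))).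
apply: le_trans (fatou _ _ _ _) => //.
- apply: ge0_le_integral => //.
  + by move=> t _; exact: iter_int_ge0.
  + by apply: vmeas_upd; exact: vmeas_iter_int.
  + apply: measurable_limn_einf => k.
    by apply: vmeas_upd; exact: vmeas_iter_int.
- by move=> k; apply: vmeas_upd; exact: vmeas_iter_int.
- by move=> k t _; exact: iter_int_ge0.
Qed.

Local Close Scope ereal_scope.

(* A continuous function is the limit of its values on the grids [(1/(k+1)) Z^n]. *)
Lemma vmeas_continuous (g : vec -> R) :
  (forall x (e : R), 0 < e -> exists2 d : R, 0 < d & forall x', near_vec d x x' -> `|g x' - g x| < e) ->
  vmeas (fun x => (g x)%:E).
Proof.
move=> cg; apply/measurable_EFinP.
pose grid (k : nat) (m : 'I_n -> int) : vec := fun j => (m j)%:~R / k.+1%:R.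
pose fl (k : nat) (t : n.-tuple (measurableTypeR R)) : 'I_n -> int :=
  fun j => Num.floor ((tnth t j : R) * k.+1%:R).
apply: (@measurable_fun_cvg _ _ _ _ (fun k t => g (grid k (fl k t)))).
  move=> k _ Y mY; rewrite setTI.
  (* Grid points are indexed by integer tuples, which form a countable type; the preimage of Y is
     then a countable union of measurable cells. *)
  pose E (m : n.-tuple int) : set (n.-tuple (measurableTypeR R)) :=
    if pselect (Y (g (grid k (tnth m)))) is left _ then
      \big[setI/setT]_(j < n) ((fun t : n.-tuple (measurableTypeR R) => tnth t j) @^-1`
         [set r : measurableTypeR R | Num.floor ((r : R) * k.+1%:R) = tnth m j])
    else set0.
  have -> : (fun t => g (grid k (fl k t))) @^-1` Y = \bigcup_m E m.
    apply/seteqP; split=> t.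
      move=> Yt; exists [tuple fl k t j | j < n] => //; rewrite /E.
      have tE : tnth [tuple fl k t j | j < n] = fl k t.
        by apply/funext => j; rewrite tnth_mktuple.
      rewrite tE; case: pselect => // _; by rewrite -bigcap_seq => j _ /=.
    move=> [m _]; rewrite /E; case: pselect => // Ym; rewrite -bigcap_seq => H /=.
    rewrite (_ : fl k t = tnth m) //; apply/funext => j.
    by apply: H => /=; exact: mem_index_enum.
  apply: countable_bigcupT_measurable; first exact: countableP.
  move=> m; rewrite /E; case: pselect => // _; apply: bigsetI_measurable => j _.
  have := @measurable_tnth _ (measurableTypeR R) n j measurableT
    [set r : measurableTypeR R | Num.floor ((r : R) * k.+1%:R) = tnth m j].
  rewrite setTI; apply.
  have k0 : (0 : R) < k.+1%:R by rewrite ltr0n.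
  have -> : [set r : measurableTypeR R | Num.floor ((r : R) * k.+1%:R) = tnth m j] =
     [set` `[(tnth m j)%:~R / k.+1%:R : R, (tnth m j + 1)%:~R / k.+1%:R[].
    apply/seteqP; split=> r /=; rewrite in_itv /= ler_pdivrMr // ltr_pdivlMr //.
      by move=> <-; exact: floor_itv.
    exact: floor_def.
  exact: measurable_itv.
move=> t _; apply/cvgrPdist_lt => e e0.
have [d d0 Hd] := cg (tnth t) e e0.
have [N _ HN] : \forall k \near \oo, k.+1%:R^-1 < d.
  by apply: near_infty_natSinv_lt (PosNum d0).
exists N => // k Nk; rewrite distrC; apply: Hd => j; rewrite /grid /fl.
have k0 : (0 : R) < k.+1%:R by rewrite ltr0n.
have := floor_itv ((tnth t j : R) * k.+1%:R); set z := Num.floor _ => /andP[z1 z2].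
apply: le_lt_trans (HN k Nk); rewrite distrC.
rewrite ger0_norm; last by rewrite subr_ge0 ler_pdivrMr.
rewrite lerBlDr -(ler_pM2r k0) mulrDl !divfK ?gt_eqF // mulVf ?gt_eqF //.
by move: z2; rewrite intrD addrC => /ltW.
Qed.

End Iterated_integral.

(** * Extreme values on boxes of finite dimension *)

Section Box_compactness.
Context {R : realType} {I : finType}.
Local Notation T := (prod_topology (fun _ : I => R)).

Lemma prod_continuous_at (Phi : (I -> R) -> R) (z : I -> R) :
  (forall e : R, 0 < e -> exists2 d : R, 0 < d &
     forall z', (forall i, `|z' i - z i| < d) -> `|Phi z' - Phi z| < e) ->
  {for (z : T), continuous (Phi : T -> R)}.
Proof.
move=> cPhi; have FF : Filter (nbhs (z : T)) by exact: nbhs_filter.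
apply: (@cvgrPdist_lt R R T (nbhs (z : T)) FF Phi (Phi z)).2 => e e0.
have [d d0 Hd] := cPhi e e0.
have : \forall z' \near nbhs (z : T), forall i, `|z' i - z i| < d.
  apply: filter_forall => i.
  have /cvgrPdist_lt/(_ _ d0) := @proj_continuous I (fun _ => R) i z.
  by apply: filterS => z' /=; rewrite distrC.
by apply: filterS => z' /Hd; rewrite distrC.
Qed.

Lemma prod_continuousXM (f g : T -> R) (z : T) (k : nat) : {for z, continuous f} -> {for z, continuous g} ->
  {for z, continuous (fun z => f z ^+ k * g z)}.
Proof.
move=> cf cg.
have FF : Filter (nbhs (z : T)) by exact: nbhs_filter.
have cf' : f t ^+ k @[t --> z] --> f z ^+ k.
  apply: (@cvg_comp T R R f (fun a => a ^+ k) (nbhs z) (nbhs (f z)) (nbhs (f z ^+ k)) cf).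
  exact: exprn_continuous.
exact: (@cvgM R T (nbhs z) FF (fun z => f z ^+ k) g _ _ cf' cg).
Qed.

Lemma EVT_box (a b : I -> R) (Phi : T -> R) :
  (forall i, a i <= b i) ->
  (forall z, (forall i, a i <= z i <= b i) -> {for (z : T), continuous Phi}) ->
  exists2 z, (forall i, a i <= z i <= b i) &
    forall z', (forall i, a i <= z' i <= b i) -> Phi z' <= Phi z.
Proof.
move=> ab cPhi.
pose K : set T := [set z : T | forall i, `[a i, b i]%classic (z i)].
have cK : compact K.
  exact: (@tychonoff I (fun _ => R) (fun i => `[a i, b i]%classic) (fun i => @segment_compact R _ _)).
have K0 : K !=set0 by exists (a : T) => i /=; rewrite in_itv /= lexx ab.
have inK z : K z -> forall i, a i <= z i <= b i.
  by move=> Kz i; have := Kz i; rewrite /= in_itv.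
have cf : {within K, continuous Phi}.
  by apply: continuous_in_subspaceT => z; rewrite inE => /inK; exact: cPhi.
have [z + Hz] := compact_EVT_max K0 cK cf.
rewrite inE => /inK Kz; exists z => // z' hz'; apply: Hz; rewrite inE => i /=.
by rewrite in_itv /=.
Qed.

End Box_compactness.

(** * One-variable slices of powers of |F|, and the mass of the Poisson kernel *)

Section Slices.
Context {R : realType} {n : nat}.
Local Notation vec := ('I_n -> R).
Local Notation fct := (vec -> vec -> R[i]).
Local Notation mu := (@lebesgue_measure R).
Implicit Types (x y : vec) (F : fct) (j k : 'I_n) (q e d s t L B : R).

Definition mpow F q x y : R := cmod (F x y) `^ q.

Lemma mpow_ge0 F q x y : 0 <= mpow F q x y. Proof. exact: powR_ge0. Qed.

Lemma mpow_slice F q j x y : holomorphic_tube F -> 0 < q -> octant y ->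
  let u s t := mpow F q (upd x j s) (upd y j t) in
  (forall s t, 0 < t -> cont2 u s t) /\
  (forall s t, 0 < t -> 0 < u s t -> exists2 rho, 0 < rho & forall r, 0 < r -> r < rho ->
     2 * pi * u s t <= cint (fun a => u (s + r * cos a) (t + r * sin a))).
Proof.
move=> HF q0 oy u.
have [F' HF'] := holomorphic_tube_deriv_ex j HF.
have [_ HF2] := (holomorphic_tubeP F').1 (holomorphic_tube_deriv HF HF').
pose U s t := complex.Re (F (upd x j s) (upd y j t)).
pose V s t := complex.Im (F (upd x j s) (upd y j t)).
pose a s t := complex.Re (F' (upd x j s) (upd y j t)).
pose b s t := complex.Im (F' (upd x j s) (upd y j t)).
have CUV s t : 0 < t -> CR U V s t (a s t) (b s t).
  move=> t0; have /cderivP := HF' (upd x j s) (upd y j t) (octant_upd j oy t0).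
  rewrite !updE; under eq_fun do under eq_fun do rewrite !upd_upd.
  by under [X in CR _ X]eq_fun do under eq_fun do rewrite !upd_upd.
have Cab s t : 0 < t -> exists c d, CR a b s t c d.
  move=> t0; have [c /cderivP] := HF2 (upd x j s) (upd y j t) (octant_upd j oy t0) j.
  rewrite !updE; under eq_fun do under eq_fun do rewrite !upd_upd.
  under [X in CR _ X]eq_fun do under eq_fun do rewrite !upd_upd.
  by exists (complex.Re c), (complex.Im c).
by split=> s t t0; [exact: (cont2_powR q0 CUV)|exact: (powR_sub_mean_value q0 CUV Cab)].
Qed.

Lemma cmod_dist (a b : R[i]) : `|cmod a - cmod b| <= cmod (a - b).
Proof.
have H1 := cmodD (a - b) b; have H2 := cmodD (b - a) a; move: H1 H2.
by rewrite !subrK (cmodBC b a) ler_norml; lra.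
Qed.

Lemma mpow_cont F q x y : holomorphic_tube F -> 0 < q -> octant y -> forall e, 0 < e ->
  exists2 d, 0 < d & forall x' y', octant y' -> near_vec d x x' -> near_vec d y y' ->
    `|mpow F q x' y' - mpow F q x y| < e.
Proof.
move=> /holomorphic_tubeP[cF _] q0 oy e e0.
have [d d0 Hd] := powR_cont q0 (cmod_ge0 (F x y)) e0.
have [d1 d10 H1] := cF x y oy d d0.
exists d1 => // x' y' oy' hx hy; apply: Hd; first exact: cmod_ge0.
apply: le_lt_trans (H1 x' y' oy' hx hy).
exact: cmod_dist.
Qed.

Lemma pkE s t : 0 < s -> pk s t = pi^-1 * (s / (t ^+ 2 + s ^+ 2)).
Proof.
move=> s0; rewrite /pk invfM mulrCA (addrC (s ^+ 2)) //.
Qed.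

Lemma pk_le s t : 0 < s -> pk s t <= (pi * s)^-1.
Proof.
move=> s0; have pi0 : 0 < (pi : R) by exact: pi_gt0.
rewrite pkE // invfM ler_pM2l ?invr_gt0 // ler_pdivrMr; last first.
  by rewrite ltr_pwDr ?sqr_ge0 // exprn_gt0.
rewrite mulrDr expr2 mulKf ?gt_eqF // lerDr mulr_ge0 ?sqr_ge0 // invr_ge0 ltW //.
Qed.

Lemma pk_continuous s (x0 : R) : 0 < s -> continuous (fun t => pk s (x0 - t)).
Proof.
move=> s0 t; under eq_fun do rewrite pkE //.
by apply: cvgMr; exact: (@kernel_continuous R x0 s s0 t).
Qed.

Lemma rintE a b (f : R -> R) : continuous f ->
  (rint a b f)%:E = (\int[mu]_(t in `[a, b]) (f t)%:E)%E.
Proof.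
move=> cf; rewrite /rint /Rintegral fineK //.
by apply: integrable_fin_num => //; exact: rint_integrable.
Qed.

Lemma pk_mass s (x0 : R) d : 0 < s -> 0 < d -> rint (x0 - d) (x0 + d) (fun t => pk s (x0 - t)) <= 1.
Proof.
move=> s0 d0; under eq_fun do rewrite pkE //.
rewrite rintZ; last exact: kernel_continuous.
rewrite kernel_mass //; have pi0 : 0 < (pi : R) by exact: pi_gt0.
by rewrite mulrC ler_pdivrMr // mul1r; have := atan_ltpi2 (d / s); lra.
Qed.

Lemma ge0_integral_windows (f : R -> \bar R) (x0 : R) (C : \bar R) :
  measurable_fun setT (f : measurableTypeR R -> \bar R) -> (forall t, 0 <= f t)%E ->
  (forall d, (0 < d)%R -> \int[mu]_(t in `[(x0 - d)%R, (x0 + d)%R]) f t <= C)%E ->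
  (\int[mu]_t f t <= C)%E.
Proof.
move=> mf f0 H.
pose E (k : nat) : set (measurableTypeR R) := `[x0 - k.+1%:R, x0 + k.+1%:R]%classic.
have UE : \bigcup_k E k = setT.
  apply/seteqP; split=> // t _; exists (Num.trunc `|t - x0|) => //; rewrite /E /= in_itv /=.
  have : `|t - x0| < (Num.trunc `|t - x0|).+1%:R by exact: truncnS_gt.
  by rewrite ltr_norml; lra.
rewrite -[X in (integral _ X _ <= _)%E]UE.
have mE (k : nat) : measurable (E k) by exact: measurable_itv.
have nE : nondecreasing_seq E.
  move=> a b ab; apply/subsetPset => t; rewrite /E /= !in_itv /=.
  have : (a.+1%:R : R) <= b.+1%:R by rewrite ler_nat.
  lra.
have cv := @ge0_nondecreasing_set_cvg_integral _ (measurableTypeR R) R E f mu nE mE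
  (fun i => measurable_funS measurableT (@subsetT _ (E i)) mf) (fun i t _ => f0 t).
rewrite -(cvg_lim _ cv) //; apply: lime_le; first by apply/cvg_ex; eexists; exact: cv.
by apply: nearW => i; exact: H.
Qed.

Lemma pk_mass_total s (x0 : R) : 0 < s -> (\int[mu]_t (pk s (x0 - t))%:E <= 1)%E.
Proof.
move=> s0; apply: (ge0_integral_windows (x0 := x0)).
- by apply/measurable_EFinP; apply: continuous_measurable_fun; exact: pk_continuous.
- by move=> t; rewrite lee_fin pk_ge0 // ltW.
- by move=> d d0; rewrite -rintE ?lee_fin ?pk_mass //; exact: pk_continuous.
Qed.

Lemma mpow_slice_continuous F q j x y t : holomorphic_tube F -> 0 < q -> octant y ->
  {for t, continuous (fun t => mpow F q (upd x j t) y)}.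
Proof.
move=> HF q0 oy; have [H _] := mpow_slice j x HF q0 oy.
by have := cont2_fst (H t (y j) (oy j)); rewrite upd_id.
Qed.

Lemma mpow_box_majorant F q j x y s L B : holomorphic_tube F -> 0 < q -> octant y ->
  0 < s -> s < L -> s < y j ->
  (forall a b, x j - L <= a <= x j + L -> y j - s <= b <= y j - s + L ->
     mpow F q (upd x j a) (upd y j b) <= B) ->
  ((mpow F q x y)%:E <=
     \int[mu]_(t in `[(x j - 2 * L)%R, (x j + 2 * L)%R])
        (pk s (x j - t) * mpow F q (upd x j t) (upd y j (y j - s)))%:E + (B * (2 * s / L))%:E)%E.
Proof.
move=> HF q0 oy s0 sL sy HB.
have [H1 H2] := mpow_slice j x HF q0 oy.
have oy' : octant (upd y j (y j - s)) by apply: octant_upd; rewrite // subr_gt0.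
rewrite -rintE; last first.
  by move=> t; apply: cvgM; [exact: pk_continuous|exact: mpow_slice_continuous].
rewrite -EFinD lee_fin.
have ys : 0 < y j - s by rewrite subr_gt0.
have := box_majorant ys s0 sL (fun s t => mpow_ge0 F q (upd x j s) (upd y j t)) H1 H2 HB.
by rewrite subrK !upd_id.
Qed.

End Slices.

(** * Boundedness of $H^p$ functions away from the boundary *)

Section Local_bound.
Context {R : realType} {n : nat}.
Local Notation vec := ('I_n -> R).
Local Notation fct := (vec -> vec -> R[i]).
Local Notation mu := (@lebesgue_measure R).
Implicit Types (x y : vec) (F : fct) (j k : 'I_n) (q e d t : R) (s : seq 'I_n).

Lemma iter_int_off s (g : vec -> \bar R) x x' :
  (forall i, i \notin s -> x i = x' i) -> iter_int s g x = iter_int s g x'.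
Proof.
elim: s x x' => [|i s IH] x x' H /=; first by congr g; apply/funext => i; exact: H.
apply: eq_integral => t _; apply: IH => j js; rewrite /upd; case: eqP => // ji.
by apply: H; rewrite inE negb_or js andbT; apply/eqP.
Qed.

Lemma vmeas_mpow F q y : holomorphic_tube F -> 0 < q -> octant y ->
  vmeas (fun x => (mpow F q x y)%:E).
Proof.
move=> HF q0 oy; apply: vmeas_continuous => x e e0.
have [d d0 Hd] := mpow_cont x HF q0 oy e0.
by exists d => // x' hx; apply: Hd => //; exact: near_vec_refl.
Qed.

Definition lower s e y : vec := fun k => if k \in s then y k - e else y k.

(** The box majorant is applied to one coordinate after the other, with L = D/2 and height e D/2.
    Each use costs the factor sup pk = 1 / (pi e D/2) and an error 2 e B from the other sides of the
    box; the error already accumulated is integrated against a kernel of mass at most 1 and does not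
    grow. Coordinates still in [s] sit at the centre, so the next box stays within distance D. *)
Lemma iterated_majorant F q x1 y1 D B e s : holomorphic_tube F -> 0 < q -> 0 < D ->
  (forall k, D < y1 k) -> 0 < e -> e < 1 ->
  (forall x y, (forall k, `|x k - x1 k| <= D) -> (forall k, `|y k - y1 k| <= D) ->
     mpow F q x y <= B) ->
  uniq s -> forall x y, (forall k, `|x k - x1 k| <= D) -> (forall k, `|y k - y1 k| <= D) ->
  (forall k, k \in s -> x k = x1 k /\ y k = y1 k) ->
  ((mpow F q x y)%:E <= ((pi * (e * (D / 2)))^-1 ^+ size s)%:E *
     iter_int s (fun x => (mpow F q x (lower s (e * (D / 2)) y))%:E) x +
     ((size s)%:R * (B * (4 * e)))%:E)%E.
Proof.
move=> HF q0 D0 Dy e0 e1 HB.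
set sg := e * (D / 2); have L0 : 0 < D / 2 by rewrite divr_gt0.
have sg0 : 0 < sg by rewrite mulr_gt0.
have sgL : sg < D / 2 by rewrite gtr_pMl.
have pi0 : 0 < (pi : R) by exact: pi_gt0.
have B0 : 0 <= B.
  apply: le_trans (mpow_ge0 F q x1 y1) (HB _ _ _ _) => k; by rewrite subrr normr0 ltW.
have octB y : (forall k, `|y k - y1 k| <= D) -> octant y.
  by move=> H k; have := H k; have := Dy k; rewrite ler_norml; lra.
elim: s => [_ x y _ _ _|k s IH /= /andP[ks us] x y hx hy hs].
  rewrite /= expr0 mul1e mul0r adde0 (_ : lower _ _ _ = y) //.
have [xk yk] := hs k (mem_head _ _).
have oy := octB y hy.
have sgy : sg < y k by rewrite yk; have := Dy k; lra.
have Hbox a b : x k - D / 2 <= a <= x k + D / 2 -> y k - sg <= b <= y k - sg + D / 2 ->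
    mpow F q (upd x k a) (upd y k b) <= B.
  move=> ha hb; apply: HB => i; rewrite /upd; case: eqP => // ->.
    by rewrite -xk ler_norml; lra.
  by rewrite -yk ler_norml; lra.
apply: le_trans (mpow_box_majorant HF q0 oy sg0 sgL sgy Hbox) _.
rewrite (_ : 2 * (D / 2) = D); last by field.
rewrite (_ : 2 * sg / (D / 2) = 2 * e); last by rewrite /sg; field; rewrite gt_eqF.
set y' := upd y k (y k - sg).
have hy' i : `|y' i - y1 i| <= D.
  by rewrite /y' /upd; case: eqP => // ->; rewrite yk ler_norml; lra.
have ly : lower s sg y' = lower (k :: s) sg y.
  apply/funext => i; rewrite /lower /y' /upd inE; case: eqP => [->|//].
  by rewrite (negbTE ks).
set y'' := lower (k :: s) sg y in ly *.
have oy'' : octant y''.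
  move=> i; rewrite -ly /lower; case: ifPn => is_; last exact: octB hy' i.
  have ik : i != k by apply: contraNneq ks => <-.
  rewrite /y' /upd (negbTE ik); have [_ ->] := hs i (@mem_behead _ (k :: s) i is_).
  by have := Dy i; lra.
set g := fun x => (mpow F q x y'')%:E.
have mg : vmeas g by exact: vmeas_mpow.
have g0 x' : (0 <= g x')%E by rewrite lee_fin mpow_ge0.
have mA := vmeas_upd x k (vmeas_iter_int s mg g0).
set C := (pi * sg)^-1; have C0 : 0 <= C by rewrite invr_ge0 mulr_ge0 ?ltW.
set E' := (size s)%:R * (B * (4 * e)).
have E'0 : 0 <= E' by rewrite !mulr_ge0 // ltW.
set W := `[(x k - D)%R, (x k + D)%R]%classic.
have mW : measurable (W : set (measurableTypeR R)) by exact: measurable_itv.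
have main : (\int[mu]_(t in W) (pk sg (x k - t) * mpow F q (upd x k t) y')%:E <=
    \int[mu]_(t in W) ((C ^+ (size s).+1)%:E * iter_int s g (upd x k t) + (E' * pk sg (x k - t))%:E))%E.
  apply: ge0_le_integral => //.
  - by move=> t _; rewrite lee_fin mulr_ge0 ?mpow_ge0 // pk_ge0 // ltW.
  - apply/measurable_EFinP/measurable_funTS; apply: continuous_measurable_fun => t.
    apply: cvgM; [exact: pk_continuous|apply: mpow_slice_continuous => //; exact: octB].
  - apply: measurable_funTS; apply: emeasurable_funD.
      by apply: measurable_funeM.
    apply/measurable_EFinP; apply: continuous_measurable_fun => t.
    by apply: cvgMr; exact: pk_continuous.
  move=> t; rewrite /W /= in_itv /= => ht.
  have hx' i : `|upd x k t i - x1 i| <= D.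
    by rewrite /upd; case: eqP => // ->; rewrite -xk ler_norml; lra.
  have hs' i : i \in s -> upd x k t i = x1 i /\ y' i = y1 i.
    move=> is_; have ik : i != k by apply: contraNneq ks => <-.
    by rewrite /y' /upd (negbTE ik); apply: hs; rewrite inE is_ orbT.
  have := IH us (upd x k t) y' hx' hy' hs'; rewrite ly -/g -/C -/E' => IH'.
  have p0 : 0 <= pk sg (x k - t) by rewrite pk_ge0 // ltW.
  rewrite EFinM; apply: le_trans (lee_wpmul2l _ IH') _; first by rewrite lee_fin.
  rewrite ge0_muleDr ?lee_fin //; last first.
    by rewrite mule_ge0 ?lee_fin ?exprn_ge0 ?iter_int_ge0.
  rewrite -EFinM (mulrC E'); apply: leeD => //.
  rewrite muleA -EFinM exprS; apply: lee_wpmul2r; first exact: iter_int_ge0.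
  by rewrite lee_fin ler_wpM2r ?exprn_ge0 // pk_le.
apply: le_trans (leeD main (lexx _)) _.
rewrite ge0_integralD //; last 4 first.
- by move=> t _; rewrite mule_ge0 ?lee_fin ?exprn_ge0 ?iter_int_ge0.
- by apply: measurable_funTS; apply: measurable_funeM.
- by move=> t _; rewrite lee_fin mulr_ge0 // pk_ge0 // ltW.
- apply/measurable_EFinP/measurable_funTS; apply: continuous_measurable_fun => t.
  by apply: cvgMr; exact: pk_continuous.
rewrite -addeA; apply: leeD.
  rewrite ge0_integralZl_EFin ?exprn_ge0 //; last 2 first.
  - by move=> t _; exact: iter_int_ge0.
  - exact: measurable_funTS.
  apply: lee_wpmul2l; first by rewrite lee_fin exprn_ge0.
  by apply: ge0_subset_integral => // t _; exact: iter_int_ge0.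
have cE : continuous (fun t => pk sg (x k - t)) by exact: pk_continuous.
rewrite -rintE; last by move=> t; apply: cvgMr; exact: cE.
rewrite rintZ // -EFinD lee_fin.
have := ler_wpM2l E'0 (pk_mass (x k) sg0 D0); rewrite /E' mulr1 -natr1.
have : 0 <= B * e by rewrite mulr_ge0 // ltW.
lra.
Qed.

(** A direct use of [iterated_majorant] at the given point would involve a local bound B that is not
    yet controlled. At a maximizer z1 of (r - |z - c|)^(n+1) u(z), where u = |F|^q, nearby values
    are at most 2^(n+1) u(z1), so B becomes a multiple of u(z1) and the error can be absorbed on the
    left. What remains bounds u(z1) by M times d1^(-n), where d1 = r - |z1 - c|, and the weight
    compensates this power. *)
Lemma Hp_locally_bounded F q (M d : R) : holomorphic_tube F -> 0 < q -> 0 < d ->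
  (forall y, octant y -> (int_Rn (fun x => (mpow F q x y)%:E) <= M%:E)%E) ->
  exists C, forall x y, (forall k, d <= y k) -> mpow F q x y <= C.
Proof.
move=> HF q0 d0 HM; have pi0 : 0 < (pi : R) by exact: pi_gt0.
(* Chosen so that the total error n 2^(n+1) 4 e is at most 1/2; the summand 2 gives e < 1 also for n
   = 0. *)
pose e : R := (n * 2 ^ (n + 4) + 2)%:R^-1.
have e0 : 0 < e by rewrite invr_gt0 ltr0n addn2.
have e1 : e < 1 by rewrite invf_lt1 ?ltr1n ?ltr0n addn2.
have ne : n%:R * (2 ^+ n.+1 * (4 * e)) <= 2^-1.
  rewrite !mulrA ler_pdivrMr; last by rewrite ltr0n addn2.
  rewrite natrD natrM natrX exprD exprS.
  have : 0 <= n%:R * 2 ^+ n :> R by rewrite mulr_ge0 ?exprn_ge0.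
  lra.
pose r := d / 2; have r0 : 0 < r by rewrite divr_gt0.
exists (2 * (pi * e / 4)^-1 ^+ n * M / r ^+ n) => x0 y0 hy0.
pose I : finType := (bool * 'I_n)%type.
pose X (z : I -> R) : vec := fun k => z (false, k).
pose Y (z : I -> R) : vec := fun k => z (true, k).
pose c : I -> R := fun i => if i.1 then y0 i.2 else x0 i.2.
pose nrm (z : I -> R) := \big[Num.max/0]_i `|z i - c i|.
have nrm_ge z i : `|z i - c i| <= nrm z by exact: le_bigmax.
have nrm_ge0 z : 0 <= nrm z by exact: bigmax_ge_id.
have nrm_le z (a : R) : 0 <= a -> (forall i, `|z i - c i| <= a) -> nrm z <= a.
  by move=> a0 H; apply: bigmax_le.
have nrm_lip z z' (a : R) : 0 <= a -> (forall i, `|z' i - z i| <= a) -> nrm z' <= nrm z + a.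
  move=> a0 H; apply: nrm_le => [|i]; first by rewrite addr_ge0.
  rewrite -(subrKA (z i)) addrC; apply: le_trans (ler_normD _ _) _.
  by apply: lerD; [exact: nrm_ge|exact: H].
(* The exponent n + 1 covers the blow-up d1^(-n) and is positive even for n = 0, so the weight
   vanishes on the boundary of the box. *)
pose Phi (z : prod_topology (fun _ : I => R)) : R := (r - nrm z) ^+ n.+1 * mpow F q (X z) (Y z).
have inbox z : (forall i, c i - r <= z i <= c i + r) -> nrm z <= r.
  by move=> H; apply: nrm_le => [|i]; [exact: ltW|have := H i; rewrite ler_norml; lra].
have octY z : nrm z <= r -> forall k, r <= Y z k.
  move=> zr k; have := le_trans (nrm_ge z (true, k)) zr; have := hy0 k.
  by rewrite /Y /c /r /= ler_norml; lra.
have cPhi z : (forall i, c i - r <= z i <= c i + r) -> {for z, continuous Phi}.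
  move=> /inbox zr; apply: (@prod_continuousXM R I (fun z => r - nrm z) (fun z => mpow F q (X z) (Y z))).
    apply: (@prod_continuous_at R I) => a a0; exists (a / 2); first by rewrite divr_gt0.
    move=> z' zz; have a2 : 0 <= a / 2 by rewrite divr_ge0 ?ltW.
    have h1 := nrm_lip z z' _ a2 (fun i => ltW (zz i)).
    have h2 : nrm z <= nrm z' + a / 2 by apply: nrm_lip => // i; rewrite distrC ltW.
    by rewrite ltr_norml; lra.
  have oz : octant (Y z) by move=> k; exact: lt_le_trans r0 (octY z zr k).
  apply: (@prod_continuous_at R I) => a a0.
  have [b b0 Hb] := mpow_cont (X z) HF q0 oz a0.
  exists (Num.min b r); first by rewrite lt_min b0.
  move=> z' zz; apply: Hb => k.
  - have := zz (true, k); rewrite lt_min => /andP[_]; have := octY z zr k.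
    by rewrite /Y ltr_norml; lra.
  - by have := zz (false, k); rewrite lt_min => /andP[].
  - by have := zz (true, k); rewrite lt_min => /andP[].
have cr i : c i - r <= c i + r by lra.
have [z1 z1box Hz1] := @EVT_box R I (fun i => c i - r) (fun i => c i + r) Phi
  cr cPhi.
have z1r := inbox z1 z1box.
set u1 := mpow F q (X z1) (Y z1); set u0 := mpow F q x0 y0.
have nc : nrm c = 0.
  by apply/eqP; rewrite eq_le nrm_ge0 andbT; apply: nrm_le => // i; rewrite subrr normr0.
have Phic : r ^+ n.+1 * u0 <= (r - nrm z1) ^+ n.+1 * u1.
  have : Phi c <= Phi z1 by apply: Hz1 => i; lra.
  by rewrite /Phi nc subr0.
have u10 : 0 <= u1 by exact: mpow_ge0.
have u00 : 0 <= u0 by exact: mpow_ge0.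
set d1 := r - nrm z1 in Phic.
have d1r : d1 <= r by rewrite /d1 gerBl.
have M0 : 0 <= M.
  rewrite -lee_fin; apply: le_trans (HM (Y z1) _); last by move=> k; exact: lt_le_trans r0 (octY z1 z1r k).
  by apply: iter_int_ge0 => x; rewrite lee_fin mpow_ge0.
have [u0z|u0nz] := eqVneq u0 0.
  rewrite u0z; apply: mulr_ge0; last by rewrite invr_ge0 exprn_ge0 // ltW.
  by apply: mulr_ge0 => //; apply: mulr_ge0 => //; rewrite exprn_ge0 // invr_ge0 divr_ge0 // mulr_ge0 // ltW.
have d10 : 0 < d1.
  rewrite lt_neqAle subr_ge0 z1r andbT; apply/eqP => d1z; move: Phic.
  by rewrite -d1z expr0n /= mul0r pmulr_rle0 ?exprn_gt0 // leNgt lt_def u0nz u00.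
pose D := d1 / 2; have D0 : 0 < D by rewrite divr_gt0.
have HD k : D < Y z1 k.
  by apply: lt_le_trans (octY z1 z1r k); rewrite /D; move: d10 d1r r0; clear; lra.
(* Within D = d1/2 of z1 the weight is at least D^(n+1), that is 2^-(n+1) times its value at z1. *)
have HB x y : (forall k, `|x k - X z1 k| <= D) -> (forall k, `|y k - Y z1 k| <= D) ->
    mpow F q x y <= 2 ^+ n.+1 * u1.
  move=> hx hy; pose z : I -> R := fun i => if i.1 then y i.2 else x i.2.
  have zz i : `|z i - z1 i| <= D by case: i => [[] k]; [exact: hy|exact: hx].
  have nz := nrm_lip z1 z _ (ltW D0) zz.
  have zD : D <= r - nrm z by move: nz; rewrite /D /d1; lra.
  have zr i : c i - r <= z i <= c i + r.
    by have := nrm_ge z i; move: zD D0; rewrite ler_norml; clear; lra.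
  have := Hz1 z zr; rewrite /Phi -/u1 -/d1 => P1.
  have P2 : D ^+ n.+1 * mpow F q x y <= (r - nrm z) ^+ n.+1 * mpow F q x y.
    apply: ler_wpM2r; first exact: mpow_ge0.
    by apply: lerXn2r; rewrite ?nnegrE ?(ltW D0) // (le_trans (ltW D0)).
  have := le_trans P2 P1; rewrite (_ : d1 = 2 * D); last by rewrite /D; field.
  by rewrite [(2 * D) ^+ _]exprMn [X in _ <= X * _ -> _]mulrC -mulrA ler_pM2l // exprn_gt0.
have us : uniq (enum 'I_n) by exact: enum_uniq.
have := iterated_majorant HF q0 D0 HD e0 e1 HB us (x := X z1) (y := Y z1).
set y2 := lower _ _ _.
have oy2 : octant y2.
  move=> k; rewrite /y2 /lower mem_enum /=; have := HD k.
  have : e * (D / 2) < D / 2 by rewrite gtr_pMl // divr_gt0.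
  by lra.
rewrite (@iter_int_off _ _ _ (fun _ => 0)); last by move=> k; rewrite mem_enum.
rewrite size_enum_ord -/(int_Rn _) => H.
set K := (pi * (e * (D / 2)))^-1 in H.
have K0 : 0 <= K by rewrite invr_ge0 !mulr_ge0 ?invr_ge0 ?ltW.
have u1le : u1 <= K ^+ n * M + n%:R * (2 ^+ n.+1 * u1 * (4 * e)).
  rewrite -lee_fin EFinD; apply: le_trans (H _ _ _) _.
  - by move=> k; rewrite subrr normr0 ltW.
  - by move=> k; rewrite subrr normr0 ltW.
  - by [].
  apply: leeD => //; rewrite EFinM; apply: lee_wpmul2l; first by rewrite lee_fin exprn_ge0.
  exact: HM.
(* Absorption: by the choice of e, the error is at most half of u1. *)
have {}u1le : u1 <= 2 * (K ^+ n * M).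
  have := ler_wpM2r u10 ne; move: u1le.
  rewrite (_ : n%:R * (2 ^+ n.+1 * u1 * (4 * e)) = n%:R * (2 ^+ n.+1 * (4 * e)) * u1); last by ring.
  by lra.
have dK : d1 ^+ n * K ^+ n = (pi * e / 4)^-1 ^+ n.
  have aux (a b f : R) : a != 0 -> b != 0 -> f != 0 ->
      a * (b * (f * (a / 2 / 2)))^-1 = (b * f / 4)^-1.
    by move=> a0 b0 f0; field; rewrite ?a0 ?b0 ?f0.
  by rewrite -exprMn aux // gt_eqF.
rewrite ler_pdivlMr ?exprn_gt0 // -dK -(ler_pM2r r0).
rewrite (_ : u0 * r ^+ n * r = r ^+ n.+1 * u0); last by rewrite exprSr; ring.
apply: le_trans Phic _; rewrite exprS.
apply: (@le_trans _ _ (d1 * d1 ^+ n * (2 * (K ^+ n * M)))).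
  by apply: ler_wpM2l => //; rewrite mulr_ge0 ?exprn_ge0 ?ltW.
rewrite (_ : _ * _ * _ = 2 * (d1 ^+ n * K ^+ n) * M * d1); last by ring.
apply: ler_wpM2l => //; apply: mulr_ge0 => //; apply: mulr_ge0 => //.
by apply: mulr_ge0; apply: exprn_ge0 => //; exact: ltW.
Qed.

End Local_bound.

(** * Functions dominated by Poisson integrals, and monotonicity of slice integrals *)

Section Poisson_subharmonic.
Context {R : realType} {n : nat}.
Local Notation vec := ('I_n -> R).
Local Notation fct := (vec -> vec -> R[i]).
Local Notation mu := (@lebesgue_measure R).
Implicit Types (x y : vec) (F : fct) (j k : 'I_n) (q e d t s : R) (u w : vec -> vec -> R).

(** Positivity, continuity along slices (for measurability) and domination by the half-plane Poisson
    integral of a lower level, in each variable. Monotonicity of slice integrals follows from these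
    alone, and they survive sums and squares, so it also applies to functions that are not powers of
    one modulus. *)
Definition psub u := [/\ forall x y, 0 <= u x y,
  forall x y, octant y -> forall e, 0 < e -> exists2 d, 0 < d &
    forall x', near_vec d x x' -> `|u x' y - u x y| < e &
  forall x y j s, octant y -> 0 < s ->
    ((u x (upd y j (y j + s)))%:E <= \int[mu]_t (pk s (x j - t) * u (upd x j t) y)%:E)%E].

Lemma psub_vmeas u y : psub u -> octant y -> vmeas (fun x => (u x y)%:E).
Proof. by move=> [_ cu _] oy; apply: vmeas_continuous => x e e0; exact: cu. Qed.

Lemma psub_slice_measurable u x y j s : psub u -> octant y -> 0 < s ->
  measurable_fun setT (fun t : measurableTypeR R => (pk s (x j - t) * u (upd x j t) y)%:E).
Proof.
move=> pu oy s0; apply/measurable_EFinP; apply: measurable_funM.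
  by apply: continuous_measurable_fun; exact: pk_continuous.
by apply/measurable_EFinP; exact: vmeas_upd (psub_vmeas pu oy).
Qed.

Lemma octant_lower_bound y : octant y -> exists2 d, 0 < d & forall k, d <= y k.
Proof.
move=> oy; exists (\big[Num.min/1]_k y k); last by move=> k; exact: bigmin_le.
by elim/big_ind: _ => // a b a0 b0; rewrite lt_min a0.
Qed.

Definition tube_bounded u := forall d, 0 < d ->
  exists C, forall x y, (forall k, d <= y k) -> u x y <= C.

Lemma psub_mpow F q : holomorphic_tube F -> 0 < q -> tube_bounded (mpow F q) -> psub (mpow F q).
Proof.
move=> HF q0 HB; split=> [x y|x y oy e e0|x y j s oy s0]; first exact: mpow_ge0.
  have [d d0 Hd] := mpow_cont x HF q0 oy e0.
  by exists d => // x' hx; apply: Hd => //; exact: near_vec_refl.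
set y' := upd y j (y j + s); have yj := oy j.
have oy' : octant y' by apply: octant_upd; rewrite // addr_gt0.
have [d d0 yd] := octant_lower_bound oy; have [C HC] := HB d d0.
have y'j : y' j = y j + s by rewrite /y' updE.
have C0 : 0 <= C by exact: le_trans (mpow_ge0 F q x y) (HC x y yd).
apply/lee_addgt0Pr => e e0.
(* With this width the error of the box majorant is C * (2 s / L) = C e / (C + e), at most e;
   boundedness makes arbitrarily wide boxes usable. *)
pose L := 2 * s * (1 + C / e).
have Ce : 0 <= C / e by rewrite divr_ge0 // ltW.
have sL : s < L by rewrite /L; nra.
have L0 : 0 < L by lra.
have Hbox a b : x j - L <= a <= x j + L -> y' j - s <= b <= y' j - s + L ->
    mpow F q (upd x j a) (upd y' j b) <= C.
  move=> _ hb; apply: HC => k; rewrite /y' upd_upd /upd; case: eqP => // _.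
  by have := yd j; lra.
have sy : s < y' j by rewrite y'j; lra.
apply: le_trans (mpow_box_majorant HF q0 oy' s0 sL sy Hbox) _.
have -> : upd y' j (y' j - s) = y by rewrite y'j /y' upd_upd addrK upd_id.
apply: leeD.
  apply: ge0_subset_integral => //.
  - apply/measurable_EFinP; apply: continuous_measurable_fun => t.
    by apply: cvgM; [exact: pk_continuous|exact: mpow_slice_continuous].
  - by move=> t _; rewrite lee_fin mulr_ge0 ?mpow_ge0 // pk_ge0 // ltW.
rewrite lee_fin mulrA ler_pdivrMr // /L.
have := mulr_gt0 s0 e0; rewrite (_ : e * _ = 2 * s * (e + C)); last by field; rewrite gt_eqF.
by nra.
Qed.

Lemma psub_add u w : psub u -> psub w -> psub (fun x y => u x y + w x y).
Proof.
move=> pu pw; have [u0 cu Pu] := pu; have [w0 cw Pw] := pw.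
split=> [x y|x y oy e e0|x y j s oy s0]; first exact: addr_ge0.
  have e2 : 0 < e / 2 by rewrite divr_gt0.
  have [d1 d10 H1] := cu x y oy _ e2; have [d2 d20 H2] := cw x y oy _ e2.
  exists (Num.min d1 d2); first by rewrite lt_min d10.
  move=> x' hx; have h1 : near_vec d1 x x' by apply: near_vec_le hx; rewrite ge_min lexx.
  have h2 : near_vec d2 x x' by apply: near_vec_le hx; rewrite ge_min lexx orbT.
  have := H1 x' h1; have := H2 x' h2; rewrite !ltr_norml; lra.
under eq_integral do rewrite mulrDr EFinD.
rewrite ge0_integralD //; first by rewrite EFinD; apply: leeD; [exact: Pu|exact: Pw].
- by move=> t _; rewrite lee_fin mulr_ge0 // pk_ge0 // ltW.
- exact: psub_slice_measurable.
- by move=> t _; rewrite lee_fin mulr_ge0 // pk_ge0 // ltW.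
- exact: psub_slice_measurable.
Qed.

(* Jensen's inequality for the kernel, from [2 a b <= a^2 + b^2] with [a] the value at [x]. *)
Lemma psub_sqr u : psub u -> psub (fun x y => u x y ^+ 2).
Proof.
move=> pu; have [u0 cu Pu] := pu.
split=> [x y|x y oy e e0|x y j s oy s0]; first exact: sqr_ge0.
  have /cvgrPdist_lt/(_ _ e0)/nbhs_ballP[r /= r0 Hr] := @exprn_continuous R 2 (u x y).
  have [d d0 Hd] := cu x y oy r r0; exists d => // x' hx.
  by rewrite distrC; apply: Hr; rewrite /ball /= distrC; exact: Hd.
set a := u x (upd y j (y j + s)); have a0 : 0 <= a by exact: u0.
have m1 := psub_slice_measurable x j pu oy s0.
have mpk : measurable_fun setT (fun t : measurableTypeR R => (pk s (x j - t))%:E).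
  by apply/measurable_EFinP; apply: continuous_measurable_fun; exact: pk_continuous.
have p0 t : 0 <= pk s (x j - t) by rewrite pk_ge0 // ltW.
have m2 : measurable_fun setT (fun t : measurableTypeR R => (pk s (x j - t) * u (upd x j t) y ^+ 2)%:E).
  apply/measurable_EFinP; apply: measurable_funM; first by apply/measurable_EFinP.
  by apply: measurable_funX; apply/measurable_EFinP; exact: vmeas_upd (psub_vmeas pu oy).
have H1 : ((2 * a)%:E * a%:E <= \int[mu]_t (pk s (x j - t) * u (upd x j t) y ^+ 2)%:E + (a ^+ 2)%:E)%E.
  have a20 : 0 <= 2 * a by rewrite mulr_ge0.
  apply: le_trans (lee_wpmul2l _ (Pu x y j s oy s0)) _; first by rewrite lee_fin.
  rewrite -ge0_integralZl_EFin //; last by move=> t _; rewrite lee_fin mulr_ge0.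
  apply: (@le_trans _ _ (\int[mu]_t ((pk s (x j - t) * u (upd x j t) y ^+ 2)%:E + (a ^+ 2)%:E * (pk s (x j - t))%:E))%E).
    apply: ge0_le_integral => //.
    - by move=> t _; rewrite -EFinM lee_fin mulr_ge0 // mulr_ge0.
    - exact: measurable_funeM.
    - by apply: emeasurable_funD => //; exact: measurable_funeM.
    move=> t _; rewrite -!EFinM -EFinD lee_fin.
    have := mulr_ge0 (p0 t) (sqr_ge0 (u (upd x j t) y - a)); nra.
  rewrite ge0_integralD //; last 3 first.
  - by move=> t _; rewrite lee_fin mulr_ge0 // sqr_ge0.
  - by move=> t _; rewrite -EFinM lee_fin mulr_ge0 // sqr_ge0.
  - exact: measurable_funeM.
  apply: leeD => //; rewrite ge0_integralZl_EFin ?sqr_ge0 //; last by move=> t _; rewrite lee_fin.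
  by rewrite -[leRHS]mule1; apply: lee_wpmul2l; [rewrite lee_fin sqr_ge0|exact: pk_mass_total].
rewrite -(@leeD2rE _ (a ^+ 2)%:E) // -EFinD; apply: le_trans H1.
by rewrite -EFinM lee_fin; nra.
Qed.

(** Integrate the Poisson domination over the slice. After translating the kernel variable by x_j,
    the kernel no longer depends on x, so Tonelli and translation invariance leave the integral at
    the lower level times the mass of the kernel. *)
Lemma psub_int_upd u y j s : psub u -> octant y -> 0 < s ->
  (int_Rn (fun x => (u x (upd y j (y j + s)))%:E) <= int_Rn (fun x => (u x y)%:E))%E.
Proof.
move=> pu oy s0; have [u0 cu Pu] := pu.
have yj := oy j; have oy' : octant (upd y j (y j + s)) by apply: octant_upd; rewrite // addr_gt0.
have p0 t : 0 <= pk s (0 - t) by rewrite pk_ge0 // ltW.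
pose h (t : measurableTypeR R) x : \bar R := ((pk s (0 - t))%:E * (u (upd x j (x j + t)%R) y)%:E)%E.
have mpk : measurable_fun setT (fun t : measurableTypeR R => (pk s (0 - t))%:E).
  by apply/measurable_EFinP; apply: continuous_measurable_fun; exact: pk_continuous.
have mh : jmeas h.
  apply: emeasurable_funM.
    by apply: (measurableT_comp mpk); exact: measurable_fst.
  have mj := @vmeas_jmeas R n _ (measurableTypeR R) _ (psub_vmeas pu oy).
  apply: (jmeas_comp (a := fun p : measurableTypeR R * n.-tuple (measurableTypeR R) => p.1)
    (f := fun p => upd (tnth p.2) j (tnth p.2 j + p.1)) mj) => [|i]; first exact: measurable_fst.
  apply: measurable_upd => [k|]; first exact: measurable_tnth_snd.
  apply: measurable_funD; [exact: measurable_tnth_snd|exact: measurable_fst].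
have h0 t x : (0 <= h t x)%E by rewrite mule_ge0 ?lee_fin.
have E x : (\int[mu]_t (pk s (x j - t) * u (upd x j t) y)%:E = \int[mu]_t h t x)%E.
  rewrite -(@lebesgue_translate R _ (x j)); last first.
  - by move=> t; rewrite lee_fin mulr_ge0 // pk_ge0 // ltW.
  - exact: psub_slice_measurable.
  by apply: eq_integral => t _; rewrite /h -EFinM (addrC t) opprD addrA subrr.
have mint : vmeas (fun x => \int[mu]_t h t x)%E.
  by apply: (@measurable_fun_fubini_tonelli_G _ _ _ _ R mu _ mh) => p.
apply: (@le_trans _ _ (int_Rn (fun x => \int[mu]_t h t x)%E)).
  apply: iter_int_le => //; first exact: psub_vmeas.
  - by move=> x; rewrite lee_fin.
  - by move=> x; rewrite -E; exact: Pu.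
rewrite /int_Rn iter_int_tonelli //.
have mu_ := psub_vmeas pu oy.
have mus t : vmeas (fun x => (u (upd x j (x j + t)) y)%:E).
  have mj := @vmeas_jmeas R n _ (measurableTypeR R) _ mu_.
  apply: (jmeas_comp (a := fun _ => (0 : measurableTypeR R)) (f := fun p => upd (tnth p) j (tnth p j + t)) mj).
    exact: measurable_cst.
  move=> i; apply: measurable_upd => [k|]; first exact: measurable_tnth.
  by apply: measurable_funD; [exact: measurable_tnth|exact: measurable_cst].
have -> : (\int[mu]_t iter_int (enum 'I_n) (h t) (fun _ => 0%R) =
    \int[mu]_t ((pk s (0 - t))%:E * int_Rn (fun x => (u x y)%:E)))%E.
  apply: eq_integral => t _; rewrite /h iter_intZ //; last by move=> x; rewrite lee_fin.
  congr (_ * _)%E; apply: (@iter_int_shift R n (enum 'I_n) (fun x => (u x y)%:E)) => //.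
  - by move=> x; rewrite lee_fin.
  - exact: enum_uniq.
  - by rewrite mem_enum.
set J := int_Rn _.
have J0 : (0 <= J)%E by apply: iter_int_ge0 => x; rewrite lee_fin.
rewrite ge0_integralZr //; last by move=> t _; rewrite lee_fin.
by rewrite -[leRHS]mul1e; apply: lee_wpmul2r => //; exact: pk_mass_total.
Qed.

(** Coordinates are raised one at a time; [mix r] has those in [r] already raised. *)
Lemma psub_int_le u y y' : psub u -> octant y -> (forall k, y k <= y' k) ->
  (int_Rn (fun x => (u x y')%:E) <= int_Rn (fun x => (u x y)%:E))%E.
Proof.
move=> pu oy yy'.
pose mix (r : seq 'I_n) : vec := fun k => if k \in r then y' k else y k.
have omix r : octant (mix r).
  by move=> k; rewrite /mix; case: ifP => _; [exact: lt_le_trans (oy k) (yy' k)|exact: oy].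
have key r : (int_Rn (fun x => (u x (mix r))%:E) <= int_Rn (fun x => (u x y)%:E))%E.
  elim: r => [|k r IH]; first by rewrite (_ : mix [::] = y).
  have -> : mix (k :: r) = upd (mix r) k (mix r k + (y' k - mix r k)).
    rewrite addrC subrK; apply/funext => i; rewrite /mix /upd inE.
    by case: eqP => [->|].
  have : 0 <= y' k - mix r k by rewrite /mix; case: ifP; rewrite subr_ge0.
  rewrite le_eqVlt => /predU1P[<-|s0]; first by rewrite addr0 upd_id.
  exact: le_trans (psub_int_upd k pu (omix r) s0) IH.
have := key (enum 'I_n); rewrite (_ : mix (enum 'I_n) = y') //.
by apply/funext => k; rewrite /mix mem_enum.
Qed.

End Poisson_subharmonic.

(** * Fatou's lemma on a slice; closure properties of holomorphic and of bounded functions *)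

Section Closure.
Context {R : realType} {n : nat}.
Local Notation vec := ('I_n -> R).
Local Notation fct := (vec -> vec -> R[i]).
Implicit Types (x y : vec) (F G : fct) (j : 'I_n) (p q e d t s : R).

(** A strict lower bound for the integral of the limit is inherited by all late members of the
    sequence, a form that avoids lower limits afterwards. *)
Lemma int_Rn_fatou_lt (g : nat -> vec -> R) (g0 : vec -> R) (a : R) :
  (forall k, vmeas (fun x => (g k x)%:E)) -> (forall k x, 0 <= g k x) ->
  (forall x, g k x @[k --> \oo] --> g0 x) ->
  (a%:E < int_Rn (fun x => (g0 x)%:E))%E ->
  exists K, forall k, (K <= k)%N -> (a%:E <= int_Rn (fun x => (g k x)%:E))%E.
Proof.
move=> mg gge0 cg alt.
pose b k := int_Rn (fun x => (g k x)%:E).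
have : (a%:E < limn_einf b)%E.
  apply: lt_le_trans alt _; have g0' k x : (0 <= (g k x)%:E)%E by rewrite lee_fin.
  have := @iter_int_fatou R n (enum 'I_n) (fun k x => (g k x)%:E) (fun _ => 0) mg g0'.
  rewrite (_ : (fun x => limn_einf _) = (fun x => (g0 x)%:E)) //.
  apply/funext => x; have cx : (g k x)%:E @[k --> \oo] --> (g0 x)%:E by apply: cvg_EFin; [exact: nearW|exact: cg].
  by rewrite is_cvg_limn_einfE; [exact: cvg_lim|apply/cvg_ex; eexists; exact: cx].
rewrite limn_einf_lim => lta.
have [[K HK]|nK] := pselect (exists K, (a%:E <= einfs b K)%E).
  exists K => k Kk; apply: le_trans HK _; apply: ereal_inf_lbound; exists k => //.
exfalso; move: lta; rewrite ltNge => /negP; apply.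
apply: lime_le; first exact: is_cvg_einfs.
by apply: nearW => K; have [//|/ltW H] := leP (einfs b K) a%:E; exfalso; apply: nK; exists K.
Qed.

Lemma holomorphic_tube_shift F d : 0 <= d -> holomorphic_tube F ->
  holomorphic_tube (fun x y => F x (fun i => y i + d)).
Proof.
move=> d0 /holomorphic_tubeP[cF HF]; apply/holomorphic_tubeP.
have os y : octant y -> octant (fun i => y i + d) by move=> oy i; rewrite ltr_wpDr.
split=> x y oy.
  move=> e e0; have [r r0 H] := cF x _ (os y oy) e e0; exists r => // x' y' oy' hx hy.
  by apply: H => //; [exact: os|move=> i; rewrite opprD addrACA subrr addr0].
move=> j; have [c Hc] := HF x _ (os y oy) j; exists c => e /Hc[r r0 H]; exists r => // h h0 hr.
rewrite (_ : (fun i => upd y j _ i + d) = upd (fun i => y i + d) j (y j + d + complex.Im h)).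
  exact: H.
by apply/funext => i; rewrite /upd; case: eqP => // _; rewrite addrAC.
Qed.

Lemma holomorphic_tube_add F G : holomorphic_tube F -> holomorphic_tube G ->
  holomorphic_tube (fun x y => F x y + G x y).
Proof.
move=> /holomorphic_tubeP[cF HF] /holomorphic_tubeP[cG HG]; apply/holomorphic_tubeP.
split=> x y oy.
  move=> e e0; have e2 : 0 < e / 2 by rewrite divr_gt0.
  have [d1 d10 H1] := cF x y oy _ e2; have [d2 d20 H2] := cG x y oy _ e2.
  exists (Num.min d1 d2); first by rewrite lt_min d10.
  move=> x' y' oy' hx hy; rewrite opprD addrACA; apply: le_lt_trans (cmodD _ _) _.
  have l1 : Num.min d1 d2 <= d1 by rewrite ge_min lexx.
  have l2 : Num.min d1 d2 <= d2 by rewrite ge_min lexx orbT.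
  have := H1 x' y' oy' (near_vec_le l1 hx) (near_vec_le l1 hy).
  have := H2 x' y' oy' (near_vec_le l2 hx) (near_vec_le l2 hy); lra.
move=> j; have [c Hc] := HF x y oy j; have [c' Hc'] := HG x y oy j; exists (c + c') => e e0.
have e2 : 0 < e / 2 by rewrite divr_gt0.
have [d1 d10 H1] := Hc _ e2; have [d2 d20 H2] := Hc' _ e2.
exists (Num.min d1 d2); first by rewrite lt_min d10.
move=> h h0; rewrite lt_min => /andP[h1 h2].
rewrite opprD addrACA mulrDl opprD addrACA; apply: le_lt_trans (cmodD _ _) _.
by have := H1 h h0 h1; have := H2 h h0 h2; lra.
Qed.

Lemma holomorphic_tube_mul F G : holomorphic_tube F -> holomorphic_tube G ->
  holomorphic_tube (fun x y => F x y * G x y).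
Proof.
move=> /holomorphic_tubeP[cF HF] /holomorphic_tubeP[cG HG]; apply/holomorphic_tubeP.
split=> x y oy.
  move=> e e0.
  pose A := cmod (F x y) + cmod (G x y) + 1.
  have f0 := cmod_ge0 (F x y); have g0 := cmod_ge0 (G x y).
  have A0 : 0 < A by rewrite /A; lra.
  pose r := Num.min 1 (e / (2 * A)); have r0 : 0 < r by rewrite lt_min ltr01 divr_gt0 // mulr_gt0.
  have r1 : r <= 1 by rewrite ge_min lexx.
  have re : r * A <= e / 2.
    have : r <= e / (2 * A) by rewrite ge_min lexx orbT.
    by rewrite ler_pdivlMr ?mulr_gt0 //; lra.
  have [d1 d10 H1] := cF x y oy _ r0; have [d2 d20 H2] := cG x y oy _ r0.
  exists (Num.min d1 d2); first by rewrite lt_min d10.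
  move=> x' y' oy' hx hy.
  have l1 : Num.min d1 d2 <= d1 by rewrite ge_min lexx.
  have l2 : Num.min d1 d2 <= d2 by rewrite ge_min lexx orbT.
  have {}H1 := H1 x' y' oy' (near_vec_le l1 hx) (near_vec_le l1 hy).
  have {}H2 := H2 x' y' oy' (near_vec_le l2 hx) (near_vec_le l2 hy).
  have -> : F x' y' * G x' y' - F x y * G x y =
    (F x' y' - F x y) * (G x' y' - G x y) + (F x' y' - F x y) * G x y + F x y * (G x' y' - G x y) by ring.
  apply: le_lt_trans (cmodD _ _) _; rewrite cmodM.
  apply: le_lt_trans (lerD (cmodD _ _) (lexx _)) _; rewrite !cmodM.
  move: H1 H2 (cmod_ge0 (F x' y' - F x y)) (cmod_ge0 (G x' y' - G x y)) => H1 H2 H10 H20.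
  have : cmod (F x' y' - F x y) * cmod (G x' y' - G x y) <= r * 1 by rewrite ler_pM //; lra.
  have : cmod (F x' y' - F x y) * cmod (G x y) <= r * cmod (G x y) by rewrite ler_wpM2r //; lra.
  have : cmod (F x y) * cmod (G x' y' - G x y) <= cmod (F x y) * r by rewrite ler_wpM2l //; lra.
  move: re; rewrite /A; lra.
move=> j; have [c /cderivP Hc] := HF x y oy j; have [c' /cderivP Hc'] := HG x y oy j.
exists (c * G x y + F x y * c'); apply/cderivP; have [] := CR_mul Hc Hc'; rewrite !upd_id => H1 H2.
split; [apply: TD_eq (TD_ext_near (r := 1) _ _ H1) _ _|apply: TD_eq (TD_ext_near (r := 1) _ _ H2) _ _] => //;
  rewrite ?ReD ?ImD ?ReM ?ImM; move=> *; rewrite ?ReM ?ImM; ring.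
Qed.

Lemma holomorphic_tube_cst (c : R[i]) : @holomorphic_tube R n (fun _ _ => c).
Proof.
apply/holomorphic_tubeP; split=> x y _; first by move=> e e0; exists 1 => // *; rewrite subrr cmod0.
by move=> j; exists 0 => e e0; exists 1 => // h _ _; rewrite subrr mul0r subr0 cmod0.
Qed.

Lemma holomorphic_tube_sub F G : holomorphic_tube F -> holomorphic_tube G ->
  holomorphic_tube (fun x y => F x y - G x y).
Proof.
move=> HF HG; have := holomorphic_tube_add HF (holomorphic_tube_mul (holomorphic_tube_cst (-1)) HG).
by under eq_fun do under eq_fun do rewrite mulN1r.
Qed.

Definition cmod_bounded F := forall d, 0 < d ->
  exists C, forall x y, (forall k, d <= y k) -> cmod (F x y) <= C.

Lemma cmod_boundedP F p : 0 < p -> tube_bounded (mpow F p) <-> cmod_bounded F.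
Proof.
move=> p0; split=> H d d0; have [C HC] := H d d0.
  exists (`|C| `^ p^-1) => x y hy; rewrite -[leLHS](@powRr1 R) ?cmod_ge0 //.
  have pi0 : 0 <= p^-1 by rewrite invr_ge0 ltW.
  rewrite -(@mulfV R p) ?gt_eqF // powRrM; apply: (ge0_ler_powR pi0); rewrite ?nnegrE ?powR_ge0 //.
  exact: le_trans (HC x y hy) (ler_norm _).
exists (`|C| `^ p) => x y hy; apply: (ge0_ler_powR (ltW p0)); rewrite ?nnegrE ?cmod_ge0 //.
exact: le_trans (HC x y hy) (ler_norm _).
Qed.

Lemma cmod_bounded_shift F e : 0 <= e -> cmod_bounded F ->
  cmod_bounded (fun x y => F x (fun i => y i + e)).
Proof.
move=> e0 H d d0; have [C HC] := H d d0; exists C => x y hy; apply: HC => k.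
by apply: le_trans (hy k) _; rewrite lerDl.
Qed.

Lemma cmod_bounded_add F G : cmod_bounded F -> cmod_bounded G ->
  cmod_bounded (fun x y => F x y + G x y).
Proof.
move=> H1 H2 d d0; have [C HC] := H1 d d0; have [C' HC'] := H2 d d0; exists (C + C') => x y hy.
by apply: le_trans (cmodD _ _) _; rewrite lerD ?HC ?HC'.
Qed.

Lemma cmod_bounded_sub F G : cmod_bounded F -> cmod_bounded G ->
  cmod_bounded (fun x y => F x y - G x y).
Proof.
move=> H1 H2 d d0; have [C HC] := H1 d d0; have [C' HC'] := H2 d d0; exists (C + C') => x y hy.
by apply: le_trans (cmodB _ _) _; rewrite lerD ?HC ?HC'.
Qed.

Lemma cmod_bounded_mul F G : cmod_bounded F -> cmod_bounded G ->
  cmod_bounded (fun x y => F x y * G x y).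
Proof.
move=> H1 H2 d d0; have [C HC] := H1 d d0; have [C' HC'] := H2 d d0; exists (C * C') => x y hy.
by rewrite cmodM ler_pM ?cmod_ge0 ?HC ?HC'.
Qed.

Lemma psub_mpow_bounded F p : holomorphic_tube F -> cmod_bounded F -> 0 < p -> psub (mpow F p).
Proof. by move=> HF BF p0; apply: psub_mpow => //; apply/cmod_boundedP. Qed.

End Closure.

(** * Pointwise inequalities between |a - b|^p, |a + b|^p, |a|^p and |b|^p *)

Section Translation.
Context {R : realType} {n : nat}.
Local Notation vec := ('I_n -> R).
Local Notation fct := (vec -> vec -> R[i]).
Implicit Types (x y : vec) (F G : fct) (j : 'I_n) (p q e d t s : R) (a b : R[i]).

Lemma cmod_parallelogram a b :
  cmod (a - b) ^+ 2 + cmod (a + b) ^+ 2 = 2 * cmod a ^+ 2 + 2 * cmod b ^+ 2.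
Proof. by rewrite !cmod_sqr; case: a; case: b => * /=; ring. Qed.

(* If [|a - b|] is not small against [m = max (|a|, |b|)], the parallelogram law bounds [|a + b| / 2]
   by a fixed multiple [th < 1] of [m]. *)
Lemma cmod_pow_midpoint p (l : R) : 0 < p -> 0 < l -> exists2 C, 0 <= C & forall a b (m : R),
  cmod a <= m -> cmod b <= m ->
  cmod (a - b) `^ p <= l * m `^ p + C * (m `^ p - (cmod (a + b) / 2) `^ p).
Proof.
move=> p0 l0; have p1 := ltW p0.
(* Differences up to r m contribute at most r^p m^p <= l m^p; r <= 1 keeps 1 - r^2/4 positive. *)
pose r := Num.min 1 (l `^ p^-1).
have r0 : 0 < r by rewrite lt_min ltr01 powR_gt0.
have r1 : r <= 1 by rewrite ge_min lexx.
have rl : r `^ p <= l.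
  rewrite -[leRHS](@powRr1 R) ?(ltW l0) // -(@mulVf R p) ?gt_eqF // powRrM.
  by apply: (ge0_ler_powR p1); rewrite ?nnegrE ?powR_ge0 ?(ltW r0) // ge_min lexx orbT.
have r2 : 0 < r ^+ 2 <= 1 by rewrite exprn_gt0 //= exprn_ile1 // ltW.
pose th := Num.sqrt (1 - r ^+ 2 / 4).
have th0 : 0 <= th by exact: sqrtr_ge0.
have th2 : th ^+ 2 = 1 - r ^+ 2 / 4 by rewrite sqr_sqrtr //; lra.
have th1 : th < 1.
  by rewrite -(@ltr_pXn2r _ 2) ?nnegrE // th2 expr1n; lra.
have thp : th `^ p < 1.
  by have := @gt0_ltr_powR R p p0 th 1; rewrite !nnegrE powR1 => ->.
(* For a large difference, |a - b|^p <= 2^p m^p = C (1 - th^p) m^p, and this is at most C (m^p - (|a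
   + b| / 2)^p). *)
pose C := 2 `^ p / (1 - th `^ p).
have C0 : 0 <= C by rewrite divr_ge0 ?powR_ge0 // subr_ge0 ltW.
have CE : C * (1 - th `^ p) = 2 `^ p by rewrite divfK // gt_eqF // subr_gt0.
clearbody C r th; exists C => // a b m am bm.
have m0 : 0 <= m by exact: le_trans (cmod_ge0 a) am.
set c := cmod (a + b) / 2; set dd := cmod (a - b).
have c0 : 0 <= c by rewrite divr_ge0 ?cmod_ge0.
have d0 : 0 <= dd by exact: cmod_ge0.
have par : dd ^+ 2 <= 4 * (m ^+ 2 - c ^+ 2).
  have := cmod_parallelogram a b; rewrite -/dd (_ : cmod (a + b) = 2 * c); last by rewrite /c; field.
  have : cmod a ^+ 2 <= m ^+ 2 by apply: lerXn2r; rewrite ?nnegrE ?cmod_ge0.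
  have : cmod b ^+ 2 <= m ^+ 2 by apply: lerXn2r; rewrite ?nnegrE ?cmod_ge0.
  by rewrite exprMn; lra.
have cm : c <= m by have := cmodD a b; rewrite /c; lra.
clearbody c.
have cmp : c `^ p <= m `^ p by apply: (ge0_ler_powR p1); rewrite ?nnegrE.
have [dr|dr] := leP dd (r * m).
  have : dd `^ p <= l * m `^ p.
    apply: (@le_trans _ _ ((r * m) `^ p)).
      by apply: (ge0_ler_powR p1); rewrite ?nnegrE // mulr_ge0 // ltW.
    by rewrite powRM ?(ltW r0) // ler_wpM2r ?powR_ge0.
  have c1 : 0 <= m `^ p - c `^ p by rewrite subr_ge0.
  by move=> /le_trans; apply; rewrite lerDl mulr_ge0.
have rm : (r * m) ^+ 2 <= dd ^+ 2.
  by apply: lerXn2r; rewrite ?nnegrE ?mulr_ge0 ?(ltW r0) // ltW.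
have tm0 : 0 <= th * m by exact: mulr_ge0.
have tm2 : 0 <= 2 * m by exact: mulr_ge0.
have cth : c <= th * m.
  rewrite -(@ler_pXn2r _ 2) ?nnegrE //.
  rewrite [(th * m) ^+ 2]exprMn th2.
  by move: rm; rewrite [(r * m) ^+ 2]exprMn; lra.
have cthp : c `^ p <= th `^ p * m `^ p.
  by rewrite -powRM //; apply: (ge0_ler_powR p1); rewrite ?nnegrE.
have d2m : dd `^ p <= 2 `^ p * m `^ p.
  rewrite -powRM //; apply: (ge0_ler_powR p1); rewrite ?nnegrE //.
  by have := cmodB a b; rewrite -/dd; lra.
have mp0 := powR_ge0 m p.
have : C * (m `^ p * (1 - th `^ p)) <= C * (m `^ p - c `^ p).
  by apply: ler_wpM2l => //; rewrite mulrBr mulr1 lerD2l lerN2 mulrC.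
rewrite mulrCA CE mulrC => /(le_trans d2m) /le_trans; apply.
by rewrite lerDr mulr_ge0 // ltW.
Qed.

Lemma powR_half_sqr (c : R) p : (c `^ (p / 2)) ^+ 2 = c `^ p.
Proof. by rewrite -powR_mulrn ?powR_ge0 // -powRrM divfK ?pnatr_eq0. Qed.

(** The maximum in the midpoint estimate is replaced by the half sum of |a|^p and |b|^p, whose
    integrals are under control, at the price of the square of a difference of half powers. The
    coefficients are matched: with all integrals close to m, the C1 terms on both sides cancel and
    only 2 l m remains. *)
Lemma cmod_pow_sub p (l : R) : 0 < p -> 0 < l -> exists C1 C2, [/\ 0 <= C1, 0 <= C2 & forall a b,
  cmod (a - b) `^ p + C1 * (cmod (a + b) / 2) `^ p <=
    (l + C1 / 2) * (cmod a `^ p + cmod b `^ p) + C2 * (cmod a `^ (p / 2) - cmod b `^ (p / 2)) ^+ 2].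
Proof.
move=> p0 l0; have [C C0 HC] := cmod_pow_midpoint p0 l0.
have lC : 0 < l + C by lra.
(* Solves (l + C) (1 + mm) / 2 = l + C / 2. *)
pose mm := l / (l + C); have m0 : 0 < mm by rewrite divr_gt0.
have ml : (l + C) * mm = l by rewrite /mm mulrC divfK // gt_eqF.
exists C, ((l + C) / (4 * mm)); split => // [|a b]; first by apply: divr_ge0; [exact: ltW|rewrite mulr_ge0 // ltW].
set al := cmod a `^ (p / 2); set be := cmod b `^ (p / 2).
(* A^2 is the half sum of A^2 and B^2 plus (A - B)(A + B) / 2; Young's inequality with weight mm
   splits the product. *)
have half (A B : R) : A ^+ 2 <= (1 + mm) / 2 * (A ^+ 2 + B ^+ 2) + (4 * mm)^-1 * (A - B) ^+ 2.
  have : 0 <= (4 * mm)^-1 * (A - B - mm * (A + B)) ^+ 2 + mm / 4 * (A - B) ^+ 2.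
    by apply: addr_ge0; apply: mulr_ge0; rewrite ?sqr_ge0 //; [rewrite invr_ge0; lra|lra].
  have -> : (4 * mm)^-1 * (A - B - mm * (A + B)) ^+ 2 + mm / 4 * (A - B) ^+ 2 =
      (1 + mm) / 2 * (A ^+ 2 + B ^+ 2) + (4 * mm)^-1 * (A - B) ^+ 2 - A ^+ 2.
    by move: mm m0 {ml} => mu_ mu0; field; rewrite gt_eqF.
  by rewrite subr_ge0.
have key (m A B : R) : cmod a <= m -> cmod b <= m -> m `^ p = A ^+ 2 ->
    A ^+ 2 + B ^+ 2 = cmod a `^ p + cmod b `^ p -> (A - B) ^+ 2 = (al - be) ^+ 2 ->
    cmod (a - b) `^ p + C * (cmod (a + b) / 2) `^ p <=
      (l + C / 2) * (cmod a `^ p + cmod b `^ p) + (l + C) / (4 * mm) * (al - be) ^+ 2.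
  move=> am bm mA E1 E2; have H1 := HC a b m am bm; have H2 := half A B.
  have := ler_wpM2l (ltW lC) H2; rewrite E1 E2 -mA mulrDr.
  have E : (l + C) * ((1 + mm) / 2) = l + C / 2 by rewrite mulrA mulrDr mulr1 ml; field.
  rewrite !mulrA -(mulrA (l + C)) E.
  move=> H3; apply: le_trans H3.
  by rewrite -lerBrDr; apply: le_trans H1 _; rewrite mulrBr mulrDl addrA.
have al2 : al ^+ 2 = cmod a `^ p by exact: powR_half_sqr.
have be2 : be ^+ 2 = cmod b `^ p by exact: powR_half_sqr.
have [ab|ba] := leP (cmod a) (cmod b).
  apply: (key _ be al ab (lexx _) (esym be2)); first by rewrite al2 be2 addrC.
  by rewrite -sqrrN opprB.
apply: (key _ al be (lexx _) (ltW ba) (esym al2)) => //.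
by rewrite al2 be2.
Qed.

Lemma cvg_cmod_powR (z : nat -> R[i]) (z0 : R[i]) p : 0 < p ->
  (forall e, 0 < e -> \forall k \near \oo, cmod (z k - z0) < e) ->
  cmod (z k) `^ p @[k --> \oo] --> cmod z0 `^ p.
Proof.
move=> p0 H; apply/cvgrPdist_lt => e e0.
have [d d0 Hd] := powR_cont p0 (cmod_ge0 z0) e0.
apply: filterS (H d d0) => k hk; rewrite distrC; apply: Hd; first exact: cmod_ge0.
exact: le_lt_trans (cmod_dist _ _) hk.
Qed.

Lemma ge0_fin_ub (E : \bar R) (M : R) : (0 <= E)%E -> (E <= M%:E)%E -> exists2 r : R, 0 <= r & E = r%:E.
Proof. by case: E => // r; rewrite lee_fin => r0 _; exists r. Qed.

End Translation.

(** * Continuity of translation in $H^p$ *)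

Section Translation_continuity.
Context {R : realType} {n : nat}.
Local Notation vec := ('I_n -> R).
Local Notation fct := (vec -> vec -> R[i]).
Implicit Types (x y : vec) (F G : fct) (j : 'I_n) (p q e d t s : R).

Lemma mpow_int_ge0 F p y : (0 <= int_Rn (fun x => (mpow F p x y)%:E))%E.
Proof. by apply: iter_int_ge0 => x; rewrite lee_fin mpow_ge0. Qed.

(** A slice whose integral cannot be exceeded by more than e on any other slice; it provides the
    upper side of the squeeze. *)
Lemma mpow_int_almost_sup F p (M e : R) : 0 < e ->
  (forall y, octant y -> (int_Rn (fun x => (mpow F p x y)%:E) <= M%:E)%E) ->
  exists (y0 : vec) (m : R), [/\ octant y0, 0 <= m <= M, int_Rn (fun x => (mpow F p x y0)%:E) = m%:E &
    forall y, octant y -> (int_Rn (fun x => (mpow F p x y)%:E) <= (m + e)%:E)%E].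
Proof.
move=> e0 HM; pose I y := int_Rn (fun x => (mpow F p x y)%:E).
have fI y : octant y -> I y = (fine (I y))%:E.
  by move=> oy; rewrite /I; have [r r0 ->] := ge0_fin_ub (mpow_int_ge0 F p y) (HM y oy).
pose A := [set fine (I y) | y in octant].
have supA : has_sup A.
  split; first by exists (fine (I (fun _ => 1))); exists (fun _ => 1) => // j /=.
  by exists M => _ [y oy <-]; rewrite -lee_fin -fI //; exact: HM.
have [_ [y0 oy0 <-] H] := sup_adherent e0 supA.
exists y0, (fine (I y0)); split => //; last 2 first.
- exact: fI.
- move=> y oy; rewrite -/(I y) fI // lee_fin.
  have : fine (I y) <= sup A by apply: sup_upper_bound => //; exists y.
  by move=> /le_trans; apply; rewrite -lerBlDr ltW.
by rewrite fine_ge0 ?mpow_int_ge0 // -lee_fin -fI //; exact: HM.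
Qed.

Let half : R[i] := (2^-1 +i* 0)%C.

Let cmod_half : cmod half = 2^-1.
Proof. by rewrite /cmod /= expr0n addr0 sqrtr_sqr ger0_norm ?invr_ge0. Qed.

Let mpow_mid F G p x y :
  mpow (fun x y => half * (F x y + G x y)) p x y = (cmod (F x y + G x y) / 2) `^ p.
Proof. by rewrite /mpow cmodM mulrC cmod_half. Qed.

Theorem Hp_translation F p (M e : R) : holomorphic_tube F -> 0 < p ->
  (forall y, octant y -> (int_Rn (fun x => (mpow F p x y)%:E) <= M%:E)%E) -> 0 < e ->
  exists2 d, 0 < d & forall y, octant y ->
    (int_Rn (fun x => (mpow (fun x y => F x y - F x (fun i => y i + d)) p x y)%:E) <= e%:E)%E.
Proof.
move=> HF p0 HM e0.
(* The terms C1 m cancel and leave 2 l m + (2 l + 2 C1 + 8 C2) eta; the choices of l and eta make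
   each of the two parts at most ep / 2. *)
have arith (xi l C1 C2 m mx eta ep i1 i2 v : R) : 0 < l -> 0 <= C1 -> 0 <= C2 -> 0 <= m -> m <= mx ->
    i1 <= m + eta -> i2 <= m + eta -> v <= 8 * eta ->
    xi + C1 * (m - eta) <= (l + C1 / 2) * (i1 + i2) + C2 * v ->
    (2 * l + 2 * C1 + 8 * C2 + 1) * eta = ep / 2 -> l * (4 * (mx + 1)) = ep -> 0 < eta -> xi <= ep.
  move=> l0 C10 C20 m0 mM i1m i2m v8 main P3 P4 eta0.
  have P1 : (l + C1 / 2) * (i1 + i2) <= (l + C1 / 2) * (2 * (m + eta)) by apply: ler_wpM2l; lra.
  have P2 : C2 * v <= C2 * (8 * eta) by exact: ler_wpM2l.
  have P5 : l * m <= l * mx by apply: ler_wpM2l => //; exact: ltW.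
  by lra.
have BF : cmod_bounded F.
  by apply/(cmod_boundedP F p0) => d d0; exact: (@Hp_locally_bounded R n F p M d HF p0 d0 HM).
have M0 : 0 <= M.
  by rewrite -lee_fin; apply: le_trans (mpow_int_ge0 F p (fun _ => 1)) (HM _ _) => j.
pose l := e / (4 * (M + 1)); have l0 : 0 < l by rewrite divr_gt0 // mulr_gt0 //; lra.
have [C1 [C2 [C10 C20 HC]]] := cmod_pow_sub p0 l0.
pose A := 2 * l + 2 * C1 + 8 * C2 + 1; have A0 : 0 < A by rewrite /A; lra.
pose eta := e / (2 * A); have eta0 : 0 < eta by rewrite divr_gt0 // mulr_gt0.
have [t [m [ot /andP[m0 mM] It HI]]] := mpow_int_almost_sup eta0 HM.
pose q := p / 2; have q0 : 0 < q by rewrite divr_gt0.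
pose dl (k : nat) : R := k.+1%:R^-1; have dl0 k : 0 < dl k by rewrite invr_gt0 ltr0n.
pose Fd k : fct := fun x y => F x (fun i => y i + dl k).
have HFd k : holomorphic_tube (Fd k) by exact: holomorphic_tube_shift (ltW (dl0 k)) HF.
have BFd k : cmod_bounded (Fd k) by exact: cmod_bounded_shift (ltW (dl0 k)) BF.
pose W k x y := mpow F q x y + mpow (Fd k) q x y.
have pW k : psub (fun x y => W k x y ^+ 2).
  by apply: psub_sqr; apply: psub_add; exact: psub_mpow_bounded.
pose Z k : fct := fun x y => half * (F x y + Fd k x y).
have HZ k : holomorphic_tube (Z k).
  exact: holomorphic_tube_mul (holomorphic_tube_cst half) (holomorphic_tube_add HF (HFd k)).
have BZ k : cmod_bounded (Z k).
  apply: cmod_bounded_mul; last exact: cmod_bounded_add.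
  by move=> d _; exists (cmod half).
have pZ k : psub (mpow (Z k) p) by exact: psub_mpow_bounded.
have cvgF x : forall r, 0 < r -> \forall k \near \oo, cmod (Fd k x t - F x t) < r.
  move=> r r0; have [cF _] := (holomorphic_tubeP F).1 HF.
  have [d d0 Hd] := cF x t ot r r0.
  near=> k; apply: Hd; [|exact: near_vec_refl|].
    by move=> i; rewrite addr_gt0 ?ot.
  move=> i; rewrite addrAC subrr add0r gtr0_norm //.
  by near: k; exact: near_infty_natSinv_lt (PosNum d0).
(* On the slice [t], W_k^2 tends to (2 |F|^(p/2))^2 = 4 |F|^p, of integral 4 m. *)
have [K1 HK1] : exists K, forall k, (K <= k)%N ->
    ((4 * m - 4 * eta)%:E <= int_Rn (fun x => (W k x t ^+ 2)%:E))%E.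
  apply: (@int_Rn_fatou_lt R n (fun k x => W k x t ^+ 2) (fun x => 4 * mpow F p x t)).
  - by move=> k; exact: psub_vmeas (pW k) ot.
  - by move=> k x; exact: sqr_ge0.
  - move=> x; have c1 : mpow (Fd k) q x t @[k --> \oo] --> mpow F q x t by apply: cvg_cmod_powR => //; exact: cvgF.
    have c2 : W k x t @[k --> \oo] --> mpow F q x t + mpow F q x t.
      exact: (cvgD (cvg_cst (mpow F q x t)) c1).
    have -> : 4 * mpow F p x t = (mpow F q x t + mpow F q x t) * (mpow F q x t + mpow F q x t).
      by rewrite {1}/mpow -powR_half_sqr -/q -/(mpow F q x t); ring.
    exact: (cvgM c2 c2).
  - under eq_fun do rewrite EFinM.
    rewrite /int_Rn iter_intZ //; last by move=> x; rewrite lee_fin mpow_ge0.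
      by rewrite -/(int_Rn _) It -EFinM lte_fin; lra.
    exact: vmeas_mpow.
(* On the same slice the midpoints Z_k tend to F, so their p-th powers recover m in the limit. *)
have [K2 HK2] : exists K, forall k, (K <= k)%N ->
    ((m - eta)%:E <= int_Rn (fun x => (mpow (Z k) p x t)%:E))%E.
  apply: (@int_Rn_fatou_lt R n (fun k x => mpow (Z k) p x t) (fun x => mpow F p x t)).
  - by move=> k; exact: psub_vmeas (pZ k) ot.
  - by move=> k x; exact: mpow_ge0.
  - move=> x; apply: cvg_cmod_powR => // r r0.
    apply: filterS (cvgF x r r0) => k; rewrite /Z.
    rewrite (_ : half * _ - _ = half * (Fd k x t - F x t)); last first.
      have h2 : half + half = 1 by rewrite /half; apply/eqP; rewrite eq_complex /= addr0 eqxx andbT; apply/eqP; field.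
      by rewrite -[X in _ - X]mul1r -h2; ring.
    by rewrite cmodM cmod_half; have := cmod_ge0 (Fd k x t - F x t); lra.
  - by rewrite It lte_fin; lra.
pose k := maxn K1 K2; exists (dl k) => // y oy.
(* Below [y], so an upper bound there suffices, and below [t], so the lower bounds found on [t]
   persist there. *)
pose y1 : vec := fun i => Num.min (y i) (t i).
have oy1 : octant y1 by move=> i; rewrite lt_min oy ot.
have y1y i : y1 i <= y i by rewrite ge_min lexx.
have y1t i : y1 i <= t i by rewrite ge_min lexx orbT.
have HD := holomorphic_tube_sub HF (HFd k); have BD := cmod_bounded_sub BF (BFd k).
have pD := psub_mpow_bounded HD BD p0.
apply: le_trans (psub_int_le pD oy1 y1y) _.
set X := int_Rn _.
pose y2 : vec := fun i => y1 i + dl k.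
have oy2 : octant y2 by move=> i; rewrite addr_gt0.
have [i1 i10 E1] := ge0_fin_ub (mpow_int_ge0 F p y1) (HI y1 oy1).
have [i2 i20 E2] := ge0_fin_ub (mpow_int_ge0 F p y2) (HI y2 oy2).
have i1m : i1 <= m + eta by rewrite -lee_fin -E1; exact: HI.
have i2m : i2 <= m + eta by rewrite -lee_fin -E2; exact: HI.
have HW := le_trans (HK1 k (leq_maxl _ _)) (psub_int_le (pW k) oy1 y1t).
have HZ' := le_trans (HK2 k (leq_maxr _ _)) (psub_int_le (pZ k) oy1 y1t).
have m1 : vmeas (fun x => (mpow F p x y1)%:E) by exact: vmeas_mpow.
have m2 : vmeas (fun x => (mpow F p x y2)%:E) by exact: vmeas_mpow.
pose V x := (mpow F q x y1 - mpow F q x y2) ^+ 2.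
have mV : vmeas (fun x => (V x)%:E).
  apply/measurable_EFinP; apply: measurable_funX; apply: measurable_funB; apply/measurable_EFinP;
  exact: vmeas_mpow.
have V0 x : (0 <= (V x)%:E)%E by rewrite lee_fin sqr_ge0.
have mW := psub_vmeas (pW k) oy1; have mZ := psub_vmeas (pZ k) oy1; have mX := psub_vmeas pD oy1.
have p0' G x z : (0 <= (mpow G p x z)%:E)%E by rewrite lee_fin mpow_ge0.
have vZ (c : R) g : vmeas g -> vmeas (fun x : vec => (c%:E * g x)%E) by exact: measurable_funeM.
have vD (g h : vec -> \bar R) : vmeas g -> vmeas h -> vmeas (fun x => (g x + h x)%E).
  by exact: emeasurable_funD.
have cp0 (c : R) G x z : 0 <= c -> (0 <= c%:E * (mpow G p x z)%:E)%E.
  by move=> c0; rewrite mule_ge0.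
(* Parallelogram law for the half powers: the difference squared plus the sum squared equals 2 |F|^p
   + 2 |F_d|^p. As the right side integrates to at most 4 m + 4 eta and the sum to at least 4 m - 4
   eta, at most 8 eta is left for the difference. *)
have EV : (int_Rn (fun x => (V x)%:E) + int_Rn (fun x => (W k x y1 ^+ 2)%:E) = (2 * i1 + 2 * i2)%:E)%E.
  rewrite -iter_intD //; last by move=> x; rewrite lee_fin sqr_ge0.
  rewrite (_ : (fun x => _) = (fun x => 2%:E * (mpow F p x y1)%:E + 2%:E * (mpow F p x y2)%:E)%E).
    rewrite iter_intD; [|exact: vZ|exact: vZ|by move=> x; exact: cp0|by move=> x; exact: cp0].
    rewrite (iter_intZ _ _ m1 (fun x => p0' F x y1) (ler0n R 2)).
    by rewrite (iter_intZ _ _ m2 (fun x => p0' F x y2) (ler0n R 2)) -!/(int_Rn _) E1 E2.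
  apply/funext => x; rewrite -!EFinM -!EFinD; congr EFin.
  by rewrite /V /W /mpow -!(powR_half_sqr _ p) -/q; ring.
have [v v0 Ev] : exists2 v, 0 <= v & int_Rn (fun x => (V x)%:E) = v%:E.
  apply: (@ge0_fin_ub R _ (2 * i1 + 2 * i2)); first exact: iter_int_ge0.
  by rewrite -EV leeDl //; apply: iter_int_ge0 => x; rewrite lee_fin sqr_ge0.
have v8 : v <= 8 * eta.
  have : (v%:E + (4 * m - 4 * eta)%:E <= (2 * i1 + 2 * i2)%:E)%E by rewrite -EV Ev; apply: leeD.
  by rewrite -EFinD lee_fin; lra.
have main : (X + C1%:E * int_Rn (fun x => (mpow (Z k) p x y1)%:E) <=
    ((l + C1 / 2) * (i1 + i2) + C2 * v)%:E)%E.
  have lC : 0 <= l + C1 / 2 by lra.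
  pose S x := ((mpow F p x y1)%:E + (mpow F p x y2)%:E)%E.
  have mS : vmeas S by exact: vD.
  have S0 x : (0 <= S x)%E by rewrite adde_ge0.
  have R1 : (((l + C1 / 2) * (i1 + i2) + C2 * v)%:E =
      int_Rn (fun x => (l + C1 / 2)%:E * S x + C2%:E * (V x)%:E))%E.
    rewrite /int_Rn iter_intD; [|exact: vZ|exact: vZ| |]; last 2 first.
    - by move=> x; rewrite mule_ge0.
    - by move=> x; rewrite mule_ge0.
    rewrite (iter_intZ _ _ mS S0 lC) (iter_intZ _ _ mV V0 C20).
    by rewrite (iter_intD _ _ m1 m2 (fun x => p0' F x y1) (fun x => p0' F x y2)) -!/(int_Rn _) E1 E2 Ev -EFinD.
  rewrite R1 /X {1 2}/int_Rn -(iter_intZ _ _ mZ (fun x => p0' (Z k) x y1) C10).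
  rewrite -(iter_intD _ _ mX (vZ C1 _ mZ) (fun x => p0' _ x y1) (fun x => cp0 C1 (Z k) x y1 C10)).
  apply: (iter_int_le _ _ (vD _ _ mX (vZ C1 _ mZ)) (vD _ _ (vZ _ _ mS) (vZ C2 _ mV))).
    by move=> x; apply: adde_ge0; [exact: p0'|exact: cp0].
  by move=> x; rewrite /S -!EFinM -!EFinD lee_fin mpow_mid; exact: HC.
have {}main : (X + (C1 * (m - eta))%:E <= ((l + C1 / 2) * (i1 + i2) + C2 * v)%:E)%E.
  apply: le_trans main; apply: leeD; first exact: lexx.
  by rewrite EFinM; apply: lee_wpmul2l HZ'; rewrite lee_fin.
have X0 : (0 <= X)%E by exact: mpow_int_ge0.
move: main X0; case: X => [xi| |] //; rewrite -EFinD !lee_fin => main _.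
have P3 : A * eta = e / 2 by rewrite /eta; field; rewrite gt_eqF.
have P4 : l * (4 * (M + 1)) = e by rewrite /l divfK // gt_eqF // mulr_gt0 // ltr_wpDl.
exact: (arith _ _ _ _ _ _ _ _ _ _ _ l0 C10 C20 m0 mM i1m i2m v8 main P3 P4 eta0).
Unshelve. all: by end_near.
Qed.

End Translation_continuity.

(** * The damping factor: holomorphy, convergence to 1 and decay *)

Section Damping.
Context {R : realType} {n : nat}.
Local Notation vec := ('I_n -> R).
Local Notation fct := (vec -> vec -> R[i]).
Implicit Types (x y : vec) (F G H : fct) (j k : 'I_n) (p e d t s : R).

Lemma holomorphic_tube_coord j : holomorphic_tube (fun x y => (x j +i* y j)%C : R[i]).
Proof.
apply/holomorphic_tubeP; split=> x y oy.
  move=> e e0; exists (e / 2); first by rewrite divr_gt0.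
  move=> x' y' _ hx hy; apply: le_lt_trans (cmod_le _) _.
  by have := hx j; have := hy j; rewrite /=; lra.
move=> k; have [->|kj] := eqVneq k j; [exists 1|exists 0] => e e0; exists 1 => // h h0 _.
  rewrite !updE (_ : (_ +i* _)%C - _ = h); last first.
    by case: h {h0} => a b; apply/eqP; rewrite eq_complex /=; apply/andP; split; apply/eqP; ring.
  by rewrite divff // subrr cmod0.
by rewrite /upd eq_sym (negbTE kj) subrr mul0r subr0 cmod0.
Qed.

Lemma holomorphic_tube_inv H : holomorphic_tube H ->
  (forall x y, octant y -> 1 <= cmod (H x y)) -> holomorphic_tube (fun x y => (H x y)^-1).
Proof.
move=> /holomorphic_tubeP[cH dH] H1; apply/holomorphic_tubeP.
have nz x y : octant y -> H x y != 0 by move=> oy; rewrite -cmod_gt0; exact: lt_le_trans ltr01 (H1 x y oy).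
split=> x y oy.
  move=> e e0; have [d d0 Hd] := cH x y oy e e0; exists d => // x' y' oy' hx hy.
  apply: le_lt_trans (Hd x' y' oy' hx hy).
  rewrite (_ : _ - _ = (H x y - H x' y') * ((H x y)^-1 * (H x' y')^-1)); last first.
    by field; rewrite !nz.
  rewrite !cmodM (cmodBC (H x y)) ler_piMr ?cmod_ge0 // !cmodV -invfM invf_le1; last first.
    by rewrite mulr_gt0 // cmod_gt0 nz.
  by rewrite -[leLHS]mulr1 ler_pM ?H1.
move=> j; have [c /cderivP Hc] := dH x y oy j.
have S0 : complex.Re (H (upd x j (x j)) (upd y j (y j))) ^+ 2 +
    complex.Im (H (upd x j (x j)) (upd y j (y j))) ^+ 2 != 0.
  by rewrite !upd_id -cmod_sqr expf_eq0 /= gt_eqF // cmod_gt0 nz.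
have [a [b Hab]] := CR_inv S0 Hc.
exists (a +i* b)%C; apply/cderivP; rewrite /=.
have RI (w : R[i]) : complex.Re w^-1 = complex.Re w / (complex.Re w ^+ 2 + complex.Im w ^+ 2) /\
    complex.Im w^-1 = - complex.Im w / (complex.Re w ^+ 2 + complex.Im w ^+ 2).
  by case: w => u v /=; rewrite mulNr.
case: Hab => H2 H3; split; [apply: (@TD_ext_near _ _ _ _ _ _ _ 1 _ _ H2)|
  apply: (@TD_ext_near _ _ _ _ _ _ _ 1 _ _ H3)] => // s t _ _;
  by have [E1 E2] := RI (H (upd x j s) (upd y j t)); rewrite ?E1 ?E2.
Qed.

Lemma holomorphic_tube_exp F m : holomorphic_tube F -> holomorphic_tube (fun x y => F x y ^+ m).
Proof.
move=> HF; elim: m => [|m IH]; first exact: holomorphic_tube_cst.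
by under eq_fun do under eq_fun do rewrite exprS; exact: holomorphic_tube_mul.
Qed.

Lemma holomorphic_tube_prod (r : seq 'I_n) (H : 'I_n -> fct) : (forall j, holomorphic_tube (H j)) ->
  holomorphic_tube (fun x y => \prod_(j <- r) H j x y).
Proof.
move=> HH; elim: r => [|j r IH].
  by under eq_fun do under eq_fun do rewrite big_nil; exact: holomorphic_tube_cst.
by under eq_fun do under eq_fun do rewrite big_cons; exact: holomorphic_tube_mul.
Qed.

(* [1 - i e z_j] *)
Definition lin e j x y : R[i] := ((1 + e * y j) +i* (- (e * x j)))%C.

Definition damp e (K : nat) x y : R[i] := \prod_(j < n) (lin e j x y)^-1 ^+ K.

Lemma cmod_lin_ge1 e j x y : 0 <= e -> 0 <= y j -> 1 <= cmod (lin e j x y).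
Proof.
move=> e0 y0; apply: le_trans (Re_le_cmod _); rewrite /lin /= ger0_norm ?lerDl ?mulr_ge0 //.
by rewrite addr_ge0 // mulr_ge0.
Qed.

Lemma cmod_lin_ge e d j x y : 0 <= e -> 0 <= d -> 0 <= y j ->
  e * Num.sqrt (x j ^+ 2 + y j ^+ 2) <= cmod (lin e j x (fun i => y i + d)).
Proof.
move=> e0 d0 y0; have ye : 0 <= e * y j by rewrite mulr_ge0.
have de : 0 <= e * d by rewrite mulr_ge0.
rewrite -[X in X * _](ger0_norm e0) -sqrtr_sqr -sqrtrM ?sqr_ge0 // ler_wsqrtr //= sqrrN mulrDr.
by rewrite -!exprMn addrC lerD2r lerXn2r ?nnegrE; lra.
Qed.

Lemma cmod_damp e K x y : cmod (damp e K x y) = (\prod_(j < n) cmod (lin e j x y)) ^- K.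
Proof.
rewrite /damp -exprVn -prodfV -prodrXl.
elim/big_rec2: _ => [|j a b _ <-]; first by rewrite cmod1.
by rewrite cmodM cmodX cmodV.
Qed.

Lemma prod_lin_ge e x y : 0 <= e -> octant_cl y ->
  1 <= \prod_(j < n) cmod (lin e j x y) /\
  (forall j, cmod (lin e j x y) <= \prod_(j < n) cmod (lin e j x y)).
Proof.
move=> e0 oy; have q1 j : 1 <= cmod (lin e j x y) by exact: cmod_lin_ge1.
have P1 (P : pred 'I_n) : 1 <= \prod_(j < n | P j) cmod (lin e j x y).
  by elim/big_rec: _ => // j a _ a1; rewrite -[leLHS]mulr1 ler_pM.
split=> // j; rewrite (bigD1 j) //= ler_peMr ?P1 //.
exact: le_trans ler01 (q1 j).
Qed.

Lemma cmod_damp_le1 e K x y : 0 <= e -> octant_cl y -> cmod (damp e K x y) <= 1.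
Proof.
move=> e0 oy; rewrite cmod_damp; have [Q1 _] := prod_lin_ge x e0 oy.
by rewrite -exprVn exprn_ile1 ?invr_ge0 ?(le_trans ler01) // invf_le1 // (lt_le_trans ltr01).
Qed.

Lemma holomorphic_tube_damp e K : 0 <= e -> holomorphic_tube (damp e K).
Proof.
move=> e0; apply: (@holomorphic_tube_prod (index_enum _) (fun j x y => (lin e j x y)^-1 ^+ K)) => j.
apply: holomorphic_tube_exp; apply: holomorphic_tube_inv; last first.
  by move=> x y oy; apply: cmod_lin_ge1 => //; exact: ltW (oy j).
have := holomorphic_tube_add (holomorphic_tube_cst 1)
  (holomorphic_tube_mul (holomorphic_tube_cst (0 +i* (- e))%C) (holomorphic_tube_coord j)).
congr holomorphic_tube; apply/funext => x; apply/funext => y.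
by apply/eqP; rewrite eq_complex /=; apply/andP; split; apply/eqP; ring.
Qed.

Definition ccvg1 (z : nat -> R[i]) := forall r : R, 0 < r -> \forall m \near \oo, cmod (z m - 1) < r.

Lemma ccvg1_mul z w : ccvg1 z -> ccvg1 w -> ccvg1 (fun m => z m * w m).
Proof.
move=> Hz Hw r r0; pose r' := Num.min 1 (r / 3).
have r'0 : 0 < r' by rewrite lt_min ltr01 divr_gt0.
have r'1 : r' <= 1 by rewrite ge_min lexx.
have r'3 : r' <= r / 3 by rewrite ge_min lexx orbT.
near=> m.
have h1 : cmod (z m - 1) < r' by near: m; exact: Hz.
have h2 : cmod (w m - 1) < r' by near: m; exact: Hw.
rewrite (_ : _ - 1 = (z m - 1) * (w m - 1) + (z m - 1) + (w m - 1)); last by ring.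
apply: le_lt_trans (cmodD _ _) _; apply: le_lt_trans (lerD (cmodD _ _) (lexx _)) _; rewrite cmodM.
have : cmod (z m - 1) * cmod (w m - 1) <= r' * 1.
  by apply: ler_pM; rewrite ?cmod_ge0 ?(ltW h1) // (le_trans (ltW h2)).
by lra.
Unshelve. all: by end_near.
Qed.

Lemma damp_cvg K x y : octant_cl y -> ccvg1 (fun m => damp (m.+1%:R^-1) K x y).
Proof.
move=> oy.
have c1 : ccvg1 (fun _ => 1) by move=> r r0; apply: nearW => m; rewrite subrr cmod0.
have lin1 j : ccvg1 (fun m => (lin m.+1%:R^-1 j x y)^-1).
  move=> r r0; pose B := `|x j| + `|y j| + 1.
  have B0 : 0 < B by rewrite /B; have := normr_ge0 (x j); have := normr_ge0 (y j); lra.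
  have rB : 0 < r / B by rewrite divr_gt0.
  near=> m; set e := m.+1%:R^-1; have e0 : 0 < e by rewrite invr_gt0 ltr0n.
  have er : e < r / B by rewrite /e; near: m; exact: near_infty_natSinv_lt (PosNum rB).
  have q1 : 1 <= cmod (lin e j x y) by apply: cmod_lin_ge1; [exact: ltW|exact: oy].
  have nz : lin e j x y != 0 by rewrite -cmod_gt0; exact: lt_le_trans ltr01 q1.
  rewrite (_ : _ - 1 = (1 - lin e j x y) / lin e j x y); last by rewrite mulrBl divff // mul1r.
  rewrite cmodM cmodV; apply: (@le_lt_trans _ _ (cmod (1 - lin e j x y))).
    by rewrite ler_piMr ?cmod_ge0 // invf_le1 // (lt_le_trans ltr01).
  apply: le_lt_trans (cmod_le _) _; rewrite /= opprD addNKr sub0r opprK normrN !normrM (gtr0_norm e0).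
  by move: er; rewrite ltr_pdivlMr // /B mulrDr mulr1 mulrDr; lra.
rewrite /damp; elim: (index_enum _) => [|j r IH].
  by under eq_fun do rewrite big_nil.
under eq_fun do rewrite big_cons; apply: ccvg1_mul => //.
elim: K {IH} => [|K IH]; first by under eq_fun do rewrite expr0.
by under eq_fun do rewrite exprS; exact: ccvg1_mul.
Unshelve. all: by end_near.
Qed.

(** Let Q be the product of the moduli of the linear factors. Each factor is at least 1, so Q
    dominates each of them and |z| <= (n / e) Q. Of the N + 1 powers of 1/Q, N absorb |z|^N and the
    last one tends to 0. *)
Lemma damp_decay (N : nat) e d F (C : R) : (0 < N)%N -> 0 < e -> 0 <= d -> 0 <= C ->
  (forall x y, octant_cl y -> cmod (F x y) <= C) ->
  decays_at_infty N (fun x y => F x y * damp e N.+1 x (fun i => y i + d)).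
Proof.
move=> N0 e0 d0 C0 HC ep ep0.
pose A := C * (n%:R / e) ^+ N; have A0 : 0 <= A by rewrite mulr_ge0 // exprn_ge0 // divr_ge0 // ltW.
(* A coordinate of modulus above this bound gives Q > A / ep, hence A / Q < ep. *)
exists (A / (e * ep)) => x y oy hM; set y' := fun i => y i + d.
have oy' : octant_cl y' by move=> i; rewrite addr_ge0 //; exact: oy.
have [Q1 Qj] := prod_lin_ge x (ltW e0) oy'.
set Q := \prod_(j < n) _ in Q1 Qj.
have Q0 : 0 < Q by exact: lt_le_trans ltr01 Q1.
have rQ j : Num.sqrt (x j ^+ 2 + y j ^+ 2) <= Q / e.
  rewrite ler_pdivlMr // mulrC; apply: le_trans (Qj j).
  exact: cmod_lin_ge (ltW e0) d0 (oy j).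
have zQ : znorm x y <= n%:R / e * Q.
  rewrite /znorm; have Z0 : 0 <= n%:R / e * Q by rewrite mulr_ge0 ?divr_ge0 // ltW.
  rewrite -[leRHS](ger0_norm Z0) -sqrtr_sqr ler_wsqrtr //.
  apply: (@le_trans _ _ (\sum_(j < n) (Q / e) ^+ 2)).
    apply: ler_sum => j _; rewrite -[leLHS]sqr_sqrtr ?addr_ge0 ?sqr_ge0 //.
    by apply: lerXn2r; rewrite ?nnegrE ?sqrtr_ge0 // divr_ge0 // ltW.
  rewrite sumr_const card_ord -[leLHS]mulr_natl (_ : (n%:R / e * Q) ^+ 2 = n%:R ^+ 2 * (Q / e) ^+ 2); last first.
    by rewrite -exprMn; congr (_ ^+ 2); rewrite mulrAC -mulrA.
  by apply: ler_wpM2r; rewrite ?sqr_ge0 // -natrX ler_nat; case: n => // m; rewrite expnS leq_pmulr.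
rewrite cmodM cmod_damp -/Q.
have H1 : znorm x y ^+ N * (cmod (F x y) * Q ^- N.+1) <= A / Q.
  apply: (@le_trans _ _ ((n%:R / e * Q) ^+ N * (C * Q ^- N.+1))).
    apply: ler_pM.
    - by rewrite exprn_ge0 // sqrtr_ge0.
    - by rewrite mulr_ge0 ?cmod_ge0 // invr_ge0 exprn_ge0 // ltW.
    - by apply: lerXn2r; rewrite ?nnegrE ?sqrtr_ge0 // mulr_ge0 ?divr_ge0 // ltW.
    - by apply: ler_wpM2r; [rewrite invr_ge0 exprn_ge0 // ltW|exact: HC].
  rewrite exprMn exprS /A; have QN : Q ^+ N != 0 by rewrite expf_neq0 // gt_eqF.
  rewrite le_eqVlt; apply/orP; left; apply/eqP; field.
  by rewrite QN gt_eqF.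
(* In dimension 0 no coordinate makes Q large; there [znorm] is 0 and N > 0 makes the product
   vanish. *)
case: (posnP n) => [n0|n0].
  rewrite (_ : znorm x y = 0) ?expr0n ?gtn_eqF ?mul0r //.
  apply/eqP; rewrite eq_le sqrtr_ge0 andbT; apply: le_trans zQ _.
  by rewrite (_ : (n%:R : R) = 0) ?mul0r // n0.
apply: le_lt_trans H1 _.
have := hM (Ordinal n0) => H2; have := lt_le_trans H2 (rQ (Ordinal n0)).
rewrite ltr_pdivlMr // ltr_pdivrMr // => H3.
rewrite mulrC -ltr_pdivrMr //; apply: le_lt_trans H3.
have gen (a b c : R) : b != 0 -> c != 0 -> a / (b * c) * b = a / c.
  by move=> b0 c0; field; rewrite b0 c0.
by rewrite gen // gt_eqF.
Qed.

End Damping.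

(** * The approximating functions *)

Section Approximation.
Context {R : realType} {n : nat}.
Local Notation vec := ('I_n -> R).
Local Notation fct := (vec -> vec -> R[i]).
Implicit Types (x y : vec) (F G H g : fct) (j : 'I_n) (p e d t s : R).

Lemma Hp_norm_bound F p : 0 < p -> (Hp_norm p F < +oo)%E ->
  exists M : R, forall y, octant y -> (int_Rn (fun x => (mpow F p x y)%:E) <= M%:E)%E.
Proof.
move=> p0 Hoo.
have ub y : octant y -> (poweR (Lp_slice p F y) p^-1 <= Hp_norm p F)%E.
  by move=> oy; apply: ereal_sup_ubound; exists y.
have h0 : (0 <= Hp_norm p F)%E.
  by apply: le_trans (ub (fun _ => 1) _) => [|j]; [exact: poweR_ge0|exact: ltr01].
move: Hoo h0 ub; case: (Hp_norm p F) => // r _; rewrite lee_fin => r0 ub.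
exists (r `^ p) => y oy; have := ub y oy; rewrite -/(Lp_slice p F y).
have : (0 <= Lp_slice p F y)%E by exact: mpow_int_ge0.
have pV : p^-1 != 0 by rewrite invr_eq0 gt_eqF.
case: (Lp_slice p F y) => [l| |] //; last by rewrite poweRyr.
rewrite poweR_EFin !lee_fin => l0 lr.
rewrite -[leLHS](@powRr1 R) // -(@mulVf R p) ?gt_eqF // powRrM.
by apply: (ge0_ler_powR (ltW p0)); rewrite ?nnegrE ?powR_ge0.
Qed.

Lemma Hp_norm_le F p (c : R) : 0 < p -> 0 <= c ->
  (forall y, octant y -> (int_Rn (fun x => (mpow F p x y)%:E) <= (c `^ p)%:E)%E) ->
  (Hp_norm p F <= c%:E)%E.
Proof.
move=> p0 c0 H; apply: ub_ereal_sup => _ [y oy <-]; have := H y oy.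
have : (0 <= Lp_slice p F y)%E by exact: mpow_int_ge0.
rewrite -/(Lp_slice p F y); case: (Lp_slice p F y) => [l| |] //.
rewrite poweR_EFin !lee_fin => l0 lc.
rewrite -[leRHS](@powRr1 R) // -(@mulfV R p) ?gt_eqF // powRrM.
have pV : 0 <= p^-1 by rewrite invr_ge0 ltW.
by apply: (ge0_ler_powR pV); rewrite ?nnegrE ?powR_ge0.
Qed.

(** Dominated convergence obtained from Fatou's lemma for 2^p |F|^p - |F - F Psi|^p, which is
    nonnegative because |1 - Psi| <= 2; finiteness of the integral of |F|^p on this slice allows the
    subtraction. *)
Lemma damp_Lp_small F p K (y0 : vec) (m ep : R) : holomorphic_tube F -> 0 < p -> octant y0 ->
  int_Rn (fun x => (mpow F p x y0)%:E) = m%:E -> 0 < ep ->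
  exists2 e, 0 < e &
    (int_Rn (fun x => (mpow (fun x y => F x y - F x y * damp e K x y) p x y0)%:E) <= ep%:E)%E.
Proof.
move=> HF p0 oy0 Em ep0; have oc : octant_cl y0 by move=> j; exact: ltW (oy0 j).
pose ee (k : nat) : R := k.+1%:R^-1; have ee0 k : 0 < ee k by rewrite invr_gt0 ltr0n.
pose H k : fct := fun x y => F x y - F x y * damp (ee k) K x y.
have HH k : holomorphic_tube (H k).
  apply: holomorphic_tube_sub => //; apply: holomorphic_tube_mul => //.
  exact: holomorphic_tube_damp (ltW (ee0 k)).
have HE k x : cmod (H k x y0) = cmod (F x y0) * cmod (damp (ee k) K x y0 - 1).
  by rewrite (cmodBC _ 1) -cmodM mulrBr mulr1.
pose T : R := 2 `^ p; have T0 : 0 <= T by exact: powR_ge0.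
have Hle k x : mpow (H k) p x y0 <= T * mpow F p x y0.
  rewrite /T -powRM ?cmod_ge0 //; apply: (ge0_ler_powR (ltW p0)); rewrite ?nnegrE ?cmod_ge0 //.
    by rewrite mulr_ge0 // cmod_ge0.
  rewrite HE mulrC ler_wpM2r ?cmod_ge0 //; apply: le_trans (cmodB _ _) _; rewrite cmod1.
  by have := cmod_damp_le1 K x (ltW (ee0 k)) oc; lra.
have mF : vmeas (fun x => (mpow F p x y0)%:E) by exact: vmeas_mpow.
have mH k : vmeas (fun x => (mpow (H k) p x y0)%:E) by exact: vmeas_mpow.
have F0 x : (0 <= (mpow F p x y0)%:E)%E by rewrite lee_fin mpow_ge0.
have ET : (int_Rn (fun x => (T * mpow F p x y0)%:E) = (T * m)%:E)%E.
  by under eq_fun do rewrite EFinM; rewrite /int_Rn iter_intZ // -/(int_Rn _) Em.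
pose g k x := T * mpow F p x y0 - mpow (H k) p x y0.
have mg k : vmeas (fun x => (g k x)%:E).
  apply/measurable_EFinP; apply: measurable_funB; last by apply/measurable_EFinP; exact: mH.
  by apply: measurable_funM; [exact: measurable_cst|apply/measurable_EFinP].
have g0 k x : 0 <= g k x by rewrite subr_ge0.
have [k0 Hk0] : exists K0, forall k, (K0 <= k)%N ->
    ((T * m - ep)%:E <= int_Rn (fun x => (g k x)%:E))%E.
  apply: (@int_Rn_fatou_lt R n g (fun x => T * mpow F p x y0)) => //.
    move=> x; rewrite -[X in _ --> X]subr0; apply: cvgB; first exact: cvg_cst.
    have -> : 0 = cmod (0 : R[i]) `^ p by rewrite cmod0 powR0 // gt_eqF.
    apply: cvg_cmod_powR => // r r0.
    have f1 : 0 < cmod (F x y0) + 1 by have := cmod_ge0 (F x y0); lra.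
    have rf : 0 < r / (cmod (F x y0) + 1) by rewrite divr_gt0.
    apply: filterS (damp_cvg K x oc rf) => k; rewrite subr0 HE ltr_pdivlMr // => h.
    apply: le_lt_trans h; rewrite mulrC ler_wpM2l ?cmod_ge0 // lerDl //.
  by rewrite ET lte_fin; lra.
exists (ee k0) => //; rewrite -/(H k0).
set X := int_Rn _; have X0 : (0 <= X)%E by exact: mpow_int_ge0.
have E : (int_Rn (fun x => (g k0 x)%:E) + X = (T * m)%:E)%E.
  have g0' x : (0 <= (g k0 x)%:E)%E by rewrite lee_fin.
  have H0 x : (0 <= (mpow (H k0) p x y0)%:E)%E by rewrite lee_fin mpow_ge0.
  have := @iter_intD R n (enum 'I_n) _ _ (fun _ => 0) (mg k0) (mH k0) g0' H0.
  rewrite -/(int_Rn _) -/(int_Rn _) -/X => <-; rewrite -ET; congr (int_Rn _).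
  by apply/funext => x; rewrite -EFinD /g subrK.
have : ((T * m - ep)%:E + X <= (T * m)%:E)%E by rewrite -E; apply: leeD => //; exact: Hk0.
by move: X0; case: X {E} => // r _; rewrite -EFinD !lee_fin; lra.
Qed.

(** The shift moves the closed tube into the open one, where all iterated complex derivatives exist
    and are continuous, so no extension to the boundary has to be constructed. *)
Lemma smooth_closure_shift g d : holomorphic_tube g -> 0 < d ->
  exists D, smooth_closure_family (fun x y => g x (fun i => y i + d)) D /\
    D [::] = (fun x y => g x (fun i => y i + d)).
Proof.
move=> Hg d0.
(* One derivative operator chosen for all functions, with an arbitrary value off the holomorphic
   ones, so that words of derivatives can be folded. *)
have [der Hder] : exists der : fct * 'I_n -> fct, forall Fj, holomorphic_tube Fj.1 ->
    forall x y, octant y -> cderiv Fj.1 Fj.2 x y (der Fj x y).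
  have ex (Fj : fct * 'I_n) : exists F', holomorphic_tube Fj.1 ->
      forall x y, octant y -> cderiv Fj.1 Fj.2 x y (F' x y).
    have [HF|nHF] := pselect (holomorphic_tube Fj.1); last by exists Fj.1 => HF; case: nHF.
    by have [F' HF'] := holomorphic_tube_deriv_ex Fj.2 HF; exists F' => _.
  by have [der Hder] := choice ex; exists der.
(* For holomorphic F, the derivative in x_j is the complex derivative and the one in y_j is i times
   it. *)
pose step (dr : bool * 'I_n) F : fct :=
  if dr.1 then fun x y => (0 +i* 1)%C * der (F, dr.2) x y else der (F, dr.2).
pose Dg (a : seq (bool * 'I_n)) : fct := foldr step g a.
have HDg a : holomorphic_tube (Dg a).
  elim: a => [//|[b j] a IH]; have HD := holomorphic_tube_deriv IH (Hder (Dg a, j) IH).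
  rewrite /Dg /= -/(Dg a) /step /=; case: b => //.
  exact: holomorphic_tube_mul (holomorphic_tube_cst _) HD.
have sh y j t : (fun i => upd y j (y j + t) i + d) = upd (fun i => y i + d) j (y j + d + t).
  by apply/funext => i; rewrite /upd; case: eqP => // _; rewrite addrAC.
exists (fun a x y => Dg a x (fun i => y i + d)); split => //; split=> //; split.
  move=> a x y oy [b j].
  have oy' : octant (fun i => y i + d) by move=> i; rewrite addr_gt0 ?oy.
  have Hc := Hder (Dg a, j) (HDg a) x (fun i => y i + d) oy'.
  move=> e /Hc[r r0 Hr]; exists r => // t t0 tr; rewrite /Dg /= -/(Dg a) /step /shift /=.
  have tC (u v : R) : (u +i* v)%C != 0 = ((u != 0) || (v != 0)) by rewrite eq_complex /= negb_and.
  case: b => /=.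
    have := Hr (0 +i* t)%C; rewrite tC t0 orbT /= addr0 upd_id => /(_ isT) Hr'.
    rewrite sh; set Q := Dg a x (upd _ _ _) - _.
    have -> : Q / (t +i* 0)%C - (0 +i* 1)%C * der (Dg a, j) x (fun i => y i + d) =
        (0 +i* 1)%C * (Q / (0 +i* t)%C - der (Dg a, j) x (fun i => y i + d)).
      rewrite mulrBr; congr (_ - _); rewrite mulrCA; congr (Q * _).
      have t1 : (t +i* 0)%C != 0 by rewrite tC t0.
      have t2 : (0 +i* t)%C != 0 by rewrite tC t0 orbT.
      apply: (mulIf t1); rewrite mulVf //; apply: (mulIf t2); rewrite mul1r mulrAC divfK //.
      by apply/eqP; rewrite eq_complex /=; apply/andP; split; apply/eqP; ring.
    rewrite cmodM (_ : cmod (0 +i* 1)%C = 1) ?mul1r; last by rewrite /cmod /= expr0n add0r expr1n sqrtr1.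
    by apply: Hr'; rewrite /cmod /= expr0n add0r sqrtr_sqr.
  have := Hr (t +i* 0)%C; rewrite tC t0 /= addr0 => /(_ isT).
  rewrite (@upd_id R n (fun i => y i + d) j) => Hr'.
  by apply: Hr'; rewrite /cmod /= expr0n addr0 sqrtr_sqr.
move=> a x y oy e e0; have [cD _] := (holomorphic_tubeP (Dg a)).1 (HDg a).
have os (z : vec) : octant_cl z -> octant (fun i => z i + d) by move=> oz i; have := oz i; rewrite /=; lra.
have [r r0 Hr] := cD x _ (os y oy) e e0; exists r => // x' y' oy' /near_vec_znorm[hx hy].
by apply: Hr => //; [exact: os|move=> i; rewrite opprD addrACA subrr addr0].
Qed.

(** Quasi-triangle inequality valid for every p > 0, from |a + b| <= 2 max(|a|, |b|). *)
Lemma mpow_add_le F G p x y : 0 < p ->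
  mpow (fun x y => F x y + G x y) p x y <= 2 `^ p * (mpow F p x y + mpow G p x y).
Proof.
move=> p0; rewrite /mpow; set a := cmod (F x y); set b := cmod (G x y).
have a0 : 0 <= a by exact: cmod_ge0.
have b0 : 0 <= b by exact: cmod_ge0.
have T0 : 0 <= 2 `^ p :> R by exact: powR_ge0.
apply: (@le_trans _ _ ((2 * Num.max a b) `^ p)).
  apply: (ge0_ler_powR (ltW p0)); rewrite ?nnegrE ?cmod_ge0 ?mulr_ge0 // ?le_max ?a0 //.
  apply: le_trans (cmodD _ _) _; rewrite -/a -/b.
  have : a <= Num.max a b by rewrite le_max lexx.
  have : b <= Num.max a b by rewrite le_max lexx orbT.
  by lra.
rewrite powRM ?le_max ?a0 //; apply: ler_wpM2l => //.
by case: (leP a b) => _; [rewrite lerDr|rewrite lerDl]; exact: powR_ge0.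
Qed.

End Approximation.

Theorem theorem4p1 (R : realType) (n N : nat) (p : R) :
  (0 < N)%N -> 0 < p -> 1 < p * N%:R ->
  forall F : ('I_n -> R) -> ('I_n -> R) -> R[i], in_Hp p F ->
  forall eps : R, 0 < eps ->
  exists G : ('I_n -> R) -> ('I_n -> R) -> R[i],
    w_class N p G /\ (Hp_norm p (fun x y => (F x y - G x y)%R) < eps%:E)%E.
Proof.
move=> N0 p0 _ F [HF Foo] eps eps0.
have [M HM] := Hp_norm_bound p0 Foo.
have M0 : 0 <= M.
  by rewrite -lee_fin; apply: le_trans (mpow_int_ge0 F p (fun _ => 1)) (HM _ _) => j.
have BF : cmod_bounded F.
  by apply/(cmod_boundedP F p0) => d d0; exact: (@Hp_locally_bounded R n F p M d HF p0 d0 HM).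
(* Half of eps, because the slice bounds give a non-strict inequality for the norm. *)
pose c := eps / 2; have c0 : 0 < c by rewrite divr_gt0.
pose T : R := 2 `^ p; have T0 : 0 < T by rewrite powR_gt0.
(* The translation error and the damping error, each at most e1, combine through the factor T = 2^p
   to exactly c^p. *)
pose e1 := c `^ p / (2 * T); have e10 : 0 < e1 by rewrite divr_gt0 ?powR_gt0 // mulr_gt0.
have [d d0 Hd] := Hp_translation HF p0 HM e10.
pose sh (y : 'I_n -> R) i := y i + d.
have osh y : octant y -> octant (sh y) by move=> oy i; rewrite addr_gt0 ?oy.
(* Every translated slice y + d lies above this one, so damping has to be controlled here only. *)
pose yd : 'I_n -> R := fun _ => d; have oyd : octant yd by [].
have [m _ Em] := ge0_fin_ub (mpow_int_ge0 F p yd) (HM yd oyd).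
have [e e0 He] := @damp_Lp_small R n F p N.+1 yd m e1 HF p0 oyd Em e10.
have Hdamp := @holomorphic_tube_damp R n e N.+1 (ltW e0).
have dle y : octant y -> forall x, cmod (damp e N.+1 x y) <= 1.
  by move=> oy x; apply: cmod_damp_le1; [exact: ltW|move=> i; exact: ltW (oy i)].
pose g x y := F x y * damp e N.+1 x y.
have Hg : holomorphic_tube g by exact: holomorphic_tube_mul.
pose H x y := F x y - g x y.
have HH : holomorphic_tube H by exact: holomorphic_tube_sub.
have Bdamp : cmod_bounded (@damp R n e N.+1).
  by move=> r r0; exists 1 => x y hy; apply: dle => k; exact: lt_le_trans r0 (hy k).
have BH : cmod_bounded H by apply: cmod_bounded_sub => //; exact: cmod_bounded_mul.
pose G x y := g x (sh y).
have HG : holomorphic_tube G by exact: holomorphic_tube_shift (ltW d0) Hg.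
exists G; split.
  split.
    split; first exact: HG.
    pose M1 := M `^ p^-1.
    apply: (@le_lt_trans _ _ M1%:E); last exact: ltry.
    apply: Hp_norm_le => //; first exact: powR_ge0.
    move=> y oy; rewrite /M1 -powRrM mulVf ?gt_eqF // powRr1 //.
    apply: le_trans (HM (sh y) (osh y oy)); apply: iter_int_le.
    - exact: vmeas_mpow.
    - by apply: vmeas_mpow => //; exact: osh.
    - by move=> x; rewrite lee_fin mpow_ge0.
    move=> x; rewrite lee_fin; apply: (ge0_ler_powR (ltW p0)); rewrite ?nnegrE ?cmod_ge0 //.
    by rewrite /G /g cmodM ler_piMr ?cmod_ge0 // dle //; exact: osh.
  have [D [SD D0]] := smooth_closure_shift Hg d0; exists D; split => //; rewrite D0.
  have [C HC] := BF d d0.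
  apply: (@damp_decay R n N e d (fun x y => F x (sh y)) `|C|) => //; first exact: ltW.
  move=> x y oy; apply: le_trans (ler_norm C); apply: HC => k.
  by rewrite /sh lerDr; exact: oy.
apply: (@le_lt_trans _ _ c%:E); last by rewrite lte_fin /c; lra.
apply: Hp_norm_le => //; first exact: ltW.
move=> y oy.
(* F - G splits into the translation error A and the damping error B evaluated at height y + d. *)
pose A x y := F x y - F x (sh y).
pose B x y := H x (sh y).
have HA : holomorphic_tube A by exact: holomorphic_tube_sub HF (holomorphic_tube_shift (ltW d0) HF).
have HB : holomorphic_tube B by exact: holomorphic_tube_shift (ltW d0) HH.
have mA : vmeas (fun x => (mpow A p x y)%:E) by exact: vmeas_mpow.
have mB : vmeas (fun x => (mpow B p x y)%:E) by exact: vmeas_mpow.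
have mAB : vmeas (fun x => (mpow A p x y)%:E + (mpow B p x y)%:E)%E by exact: (emeasurable_funD mA mB).
have A0 x : (0 <= (mpow A p x y)%:E)%E by rewrite lee_fin mpow_ge0.
have B0 x : (0 <= (mpow B p x y)%:E)%E by rewrite lee_fin mpow_ge0.
have IA : (int_Rn (fun x => (mpow A p x y)%:E) <= e1%:E)%E by exact: Hd.
have IB : (int_Rn (fun x => (mpow B p x y)%:E) <= e1%:E)%E.
  apply: le_trans He; apply: (psub_int_le (psub_mpow_bounded HH BH p0) oyd) => k.
  by rewrite /sh /yd lerDr ltW // oy.
apply: (@le_trans _ _ (int_Rn (fun x => T%:E * ((mpow A p x y)%:E + (mpow B p x y)%:E))%E)).
  apply: iter_int_le.
  - by apply: vmeas_mpow => //; exact: holomorphic_tube_sub.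
  - exact: measurable_funeM mAB.
  - by move=> x; rewrite lee_fin mpow_ge0.
  move=> x; rewrite -EFinD -EFinM lee_fin.
  apply: le_trans (mpow_add_le A B x y p0).
  by rewrite /mpow /A /B /H /G addrA subrK.
have AB0 x : (0 <= (mpow A p x y)%:E + (mpow B p x y)%:E)%E by rewrite adde_ge0.
rewrite /int_Rn (iter_intZ _ _ mAB AB0 (ltW T0)).
rewrite (iter_intD _ _ mA mB A0 B0) -!/(int_Rn _).
have TE : c `^ p = T * (e1 + e1) by rewrite /e1; field; rewrite gt_eqF.
rewrite TE EFinM EFinD; apply: lee_wpmul2l; first by rewrite lee_fin ltW.
exact: leeD.
Qed.
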